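(* Let $k$ be a positive integer. For all positive integers $q$ and $h$, $$ V_k(q;h) = \mu_k\, V_2(q;h)^{k/2} + O_k\bigg(h^{k/2-1/(7k)}\Big(\frac{q}{\phi(q)}\Big)^{2^k+k/2}\bigg), $$ where the implied constant depends only on $k$, and $\mu_k = 1\cdot 3\cdots (k-1)$ if $k$ is even, $\mu_k=0$ if $k$ is odd.
   Context: Write $e(\theta)=e^{2\pi i\theta}$; $\mu$ is the Möbius function and $\phi$ Euler's totient function. For positive integers $q,h$ and $k\ge 1$ define $$ V_k(q;h)= \sum_{\substack{d_1,\ldots,d_k\\ 1\le d_i\le h}}\ \sum_{\substack{q_1,\ldots,q_k\\ 1<q_i\mid q}}\bigg(\prod_{i=1}^k\frac{\mu(q_i)}{\phi(q_i)}\bigg)\sum_{\substack{a_1,\ldots,a_k\\ 1\le a_i\le q_i\\ (a_i,q_i)=1\\ \sum_i a_i/q_i\in\mathbb Z}} e\Big(\sum_{i=1}^k\frac{a_id_i}{q_i}\Big), $$ where the $d_i$ range over integers and the $q_i$ over divisors of $q$ exceeding $1$; $V_2(q;h)$ is the case $k=2$ (equivalently $V_2(q;h)=\sum_{d\mid q,\,d>1}\frac{\mu(d)^2}{\phi(d)^2}\sum_{1\le a\le d,(a,d)=1}|E(a/d)|^2$ with $E(\alpha)=\sum_{m=1}^h e(m\alpha)$), which is a nonnegative real number. *)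

(* Defs.v *)
From mathcomp Require Import all_boot all_order all_algebra.
From mathcomp Require Import all_classical all_reals all_analysis.
From mathcomp Require Import complex.

Set Implicit Arguments.
Unset Strict Implicit.
Unset Printing Implicit Defensive.

Import Order.TTheory GRing.Theory Num.Theory.
Local Open Scope ring_scope.
Local Open Scope complex_scope.

(* The library has no Moebius function. The value at 0 is irrelevant: only
   divisors greater than 1 of a positive integer are used. *)
Definition mobius (n : nat) : int :=
  if [forall p : 'I_n.+1, prime p ==> ~~ (p ^ 2 %| n)%N]
  then (-1) ^+ size (primes n) else 0.

Definition e (R : realType) (t : R) : R[i] :=
  cos (2 * pi * t) +i* sin (2 * pi * t).

(* The values d_i, q_i, a_i range over ordinals bounded by h, q, q, which loses
   nothing since a_i <= q_i <= q for every divisor q_i of q > 0. *)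
Definition V (R : realType) (k q h : nat) : R[i] :=
  \sum_(d : {ffun 'I_k -> 'I_h.+1} | [forall i, (1 <= d i)%N])
  \sum_(r : {ffun 'I_k -> 'I_q.+1} | [forall i, (1 < r i)%N && (r i %| q)%N])
    (\prod_(i < k) ((mobius (r i))%:~R / (totient (r i))%:R)) *
    \sum_(a : {ffun 'I_k -> 'I_q.+1} |
           [forall i, (1 <= a i <= r i)%N && coprime (a i) (r i)] &&
           (\sum_(i < k) ((a i)%:R / (r i)%:R : rat) \is a Num.int))
      e (\sum_(i < k) ((a i)%:R * (d i)%:R / (r i)%:R : R)).

(* V_2(q;h) as a real number. Taking the real part loses nothing: pairing
   q_1 = q_2 and a_1 = - a_2 mod q_1 writes V_2 as a sum of
   mu(q_1)^2 / phi(q_1)^2 * |E(a_1/q_1)|^2, so it is real and nonnegative. *)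
Definition V2 (R : realType) (q h : nat) : R := complex.Re (V R 2 q h).

(* 1 * 3 * ... * (k - 1) for even k, and 0 for odd k. *)
Definition gauss_moment (k : nat) : nat :=
  if odd k then 0%N else (\prod_(i < k./2) (i.*2.+1))%N.

(* Main.v *)
Require Import Defs.
From mathcomp Require Import all_boot all_order all_fingroup all_algebra.
From mathcomp Require Import all_classical all_reals all_analysis.
From mathcomp Require Import complex ring lra zify.

(* Put V_k into the form of a sum over zero-sum k-tuples (x_1, ..., x_k) in Z/q
   of the product of f(x_i), where f(x) = mu(r)/phi(r) E(x/q), r being the order
   of x. Counting the j with x_j = -x_1 gives V_k = (k-1) V_2 V_(k-2) up to a
   contribution of tuples in which x_1 is cancelled at least twice (negligible,
   as f is bounded by 3/2 q/phi(q)) or not at all; the theorem follows by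
   induction on k. By the fundamental lemma, the tuples of orders r_1, ..., r_k
   contribute at most (1/lcm r) prod (r_i sum |f|^2)^(1/2), and only tuples in
   which every prime divides at least two r_i occur, whence the power of
   q/phi(q). This saves h^(-1/(7k)) when some x_i/q is at distance more than
   eta from the integers. Otherwise, if x_1 is not cancelled, some r_j with
   j > 1 has a common factor at least h^(1/k) with r_1; then x_1 + x_j is
   nonzero of order prime to t, where t is the product of the primes dividing
   r_1 and r_j only, and writing x_1/q = a/r_1 and x_j/q = b/r_j with small a, b
   this makes t a divisor of a nonzero integer determined by a, b, r_1/t and
   r_j/t. Averaging over t, the divisor bound shows that such tuples are rare. *)

Set Implicit Arguments.
Unset Strict Implicit.
Unset Printing Implicit Defensive.

Import Order.TTheory GRing.Theory Num.Theory.
Local Open Scope ring_scope.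

(** Beyond the term with the factor [V_2], all is estimated with [g = |f|]; no cancellation is used.
    The obstacle is a pair of orders [a], [b] with gcd [d], where [eta d < 1] and [t] exceeds
    [eta a] and [eta b]: the direct count of pairs is then too weak, hence the average over [t]. The
    fundamental lemma yields the square root of a count, which cannot be averaged as it stands;
    [sqrt x <= (lam x + 1/lam)/2] makes it linear, and the factor [1/t] contained in the inverse lcm
    leaves only a harmonic sum of [1/lam]. All parameters are powers of [w = h^(1/(35 k))], and the
    target saving is [w^-5]. Far entries save [(eta h)^(-1/2) = w^-5]. The harmonic sum costs [w],
    so [lam = w^6]. The averaged count costs [lam (eta h)^2 = w^26], then [w^2] for two harmonic
    sums and [w^2] for the divisor bound, against the gain [D = w^35]: again [w^-5]. Without the
    five units lost to the harmonic and divisor bounds, the same balance would need only [D = w^30],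
    that is [6 k] in place of [7 k]. *)

Lemma ler_sum_inj (R : numDomainType) (I J : finType) (P : pred I) (Q : pred J)
    (h : I -> J) (F : I -> R) (G : J -> R) :
  {in P &, injective h} -> (forall i, P i -> Q (h i)) ->
  (forall i, P i -> F i <= G (h i)) -> (forall j, Q j -> 0 <= G j) ->
  \sum_(i | P i) F i <= \sum_(j | Q j) G j.
Proof.
move=> hinj PQ FG G0.
apply: (@le_trans _ _ (\sum_(i in P) G (h i))); first exact: ler_sum.
rewrite -(big_imset G hinj) /= [leRHS](bigID [in h @: P]) /=.
rewrite -[leLHS]addr0 lerD //; last by apply: sumr_ge0 => j /andP[/G0].
rewrite le_eqVlt; apply/orP; left; apply/eqP; apply: eq_bigl => j.
apply/idP/andP => [jh|[]//]; split=> //.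
by case/imsetP: jh => i /PQ Qi ->.
Qed.

(** * Squarefree integers and admissible lists of orders *)

Definition sqfree n := (0 < n)%N && all (fun p => logn p n == 1%N) (primes n).

Lemma sqfree_gt0 n : sqfree n -> (0 < n)%N.
Proof. by case/andP. Qed.

Lemma sqfreeP n : (0 < n)%N ->
  reflect (forall p, prime p -> ~~ (p ^ 2 %| n)%N) (sqfree n).
Proof.
move=> n0; rewrite /sqfree n0 /=; apply: (iffP allP) => [sq p pp|sq p].
  rewrite pfactor_dvdn // -ltnNge ltnS; case: (boolP (p \in primes n)).
    by move/sq/eqP->.
  by rewrite -logn_gt0 -leqNgt leqn0 => /eqP ->.
rewrite -logn_gt0 => lp.
have pp : prime p by move: lp; rewrite logn_gt0 mem_primes => /and3P[].
have := sq p pp; rewrite pfactor_dvdn // -ltnNge ltnS => lp1.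
by rewrite eqn_leq lp1.
Qed.

Lemma sqfree_dvdn a b : sqfree b -> (a %| b)%N -> sqfree a.
Proof.
move=> sb ab; have b0 := sqfree_gt0 sb; have a0 := dvdn_gt0 b0 ab.
apply/(sqfreeP a0) => p pp; apply: contra (sqfreeP b0 sb p pp) => pa.
exact: dvdn_trans ab.
Qed.

(** Reduces divisibilities between squarefree orders to one prime at a time, the form in which
    admissibility is given. *)
Lemma sqfree_dvdP a b : sqfree a ->
  (forall p, prime p -> (p %| a)%N -> (p %| b)%N) -> (a %| b)%N.
Proof.
case/andP=> a0 /allP sa ab; apply/dvdn_partP => // p.
rewrite /= => pa; move: (pa); rewrite mem_primes => /and3P[pp _ pda].
by rewrite p_part (eqP (sa p pa)) expn1; apply: ab.
Qed.

Lemma sqfree_gcd a b : sqfree a -> sqfree (gcdn a b).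
Proof. by move=> sa; apply: sqfree_dvdn sa (dvdn_gcdl _ _). Qed.

Lemma Euclid_dvdn_lcm p a b : prime p ->
  (p %| lcmn a b)%N = (p %| a)%N || (p %| b)%N.
Proof.
move=> pp; apply/idP/orP => [pl|[pa|pb]].
- by apply/orP; rewrite -Euclid_dvdM // -muln_lcm_gcd dvdn_mulr.
- exact: dvdn_trans pa (dvdn_lcml _ _).
- exact: dvdn_trans pb (dvdn_lcmr _ _).
Qed.

Lemma lognlcm p a b : (0 < a)%N -> (0 < b)%N ->
  logn p (lcmn a b) = maxn (logn p a) (logn p b).
Proof.
move=> a0 b0; have := logn_gcd p a0 b0.
have := congr1 (logn p) (muln_lcm_gcd a b).
by rewrite !lognM ?lcmn_gt0 ?gcdn_gt0 ?a0 ?b0 //; lia.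
Qed.

Lemma sqfree_lcm a b : sqfree a -> sqfree b -> sqfree (lcmn a b).
Proof.
move=> sa sb; have [a0 b0] := (sqfree_gt0 sa, sqfree_gt0 sb).
have l0 : (0 < lcmn a b)%N by rewrite lcmn_gt0 a0.
apply/(sqfreeP l0) => p pp; rewrite pfactor_dvdn // lognlcm //.
have := sqfreeP a0 sa p pp; have := sqfreeP b0 sb p pp.
by rewrite !pfactor_dvdn // /maxn; case: ifP.
Qed.

Definition lcms (s : seq nat) := foldr lcmn 1%N s.

Lemma sqfree_lcms s : all sqfree s -> sqfree (lcms s).
Proof. by elim: s => [|a s IH] //= /andP[sa /IH]; apply: sqfree_lcm. Qed.

Lemma Euclid_dvdn_lcms p s : prime p -> (p %| lcms s)%N = has (dvdn p) s.
Proof.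
move=> pp; elim: s => [|a s IH] /=; last by rewrite Euclid_dvdn_lcm // IH.
by rewrite dvdn1; apply: contraTF pp => /eqP ->.
Qed.

(* Zero-sum tuples with one entry of each exact order [r_i] exist only if no
   prime divides exactly one of the [r_i]. *)
Definition admissible (s : seq nat) := forall p, prime p -> count (dvdn p) s != 1%N.

(** A prime dividing only one of [a] and [b] must divide an entry of [L], so nothing is lost when
    the lcm of [a] and [b] shrinks to their gcd. *)
Lemma gcd_lcm_merge a b L : sqfree a -> sqfree b ->
  admissible [:: a, b & L] ->
  lcmn (gcdn a b) (lcms L) = lcmn a (lcmn b (lcms L)).
Proof.
move=> sa sb adm; apply/eqP; rewrite eqn_dvd; apply/andP; split.
  rewrite dvdn_lcm; apply/andP; split.
    exact: dvdn_trans (dvdn_gcdl _ _) (dvdn_lcml _ _).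
  exact: dvdn_trans (dvdn_lcmr _ _) (dvdn_lcmr _ _).
rewrite !dvdn_lcm dvdn_lcmr andbT; apply/andP; split;
  apply: sqfree_dvdP => // p pp; rewrite Euclid_dvdn_lcm // dvdn_gcd;
  rewrite Euclid_dvdn_lcms // has_count;
  have := adm p pp; rewrite /=;
  by case: (p %| a)%N (p %| b)%N (count _ _) => [] [] [|].
Qed.

(** A prime of the new head divides some entry of [L], hence at least two entries of the new list.
    Any other prime dividing an entry of [L] divides neither [a] nor [b], so its count is
    unchanged. *)
Lemma admissible_merge a b L :
  admissible [:: a, b & L] -> admissible (gcdn (lcmn a b) (lcms L) :: L).
Proof.
move=> adm p pp; have := adm p pp; rewrite /= dvdn_gcd Euclid_dvdn_lcm //.
rewrite Euclid_dvdn_lcms // has_count.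
by case: (p %| a)%N (p %| b)%N (count _ _) => [] [] [|[|]].
Qed.

(** * Convolutions and torsion in a finite abelian group *)

Section Convolution.
Variables (K : comNzRingType) (A : finZmodType).

(** A recursive form of the sum over tuples with total [z], so that a list of different functions
    can be merged or replaced entry by entry; [nconv_tuple] gives back the sum over tuples. *)
Fixpoint nconv (s : seq (A -> K)) (z : A) : K :=
  if s is g :: s' then \sum_x g x * nconv s' (z - x) else (z == 0)%:R.

Definition conv (f g : A -> K) (z : A) := \sum_x f x * g (z - x).

Lemma nconv_merge f g s z : nconv [:: f, g & s] z = nconv (conv f g :: s) z.
Proof.
rewrite /=; under eq_bigr => x _ do rewrite mulr_sumr.
under [RHS]eq_bigr => x _ do rewrite mulr_suml.
rewrite [RHS]exchange_big; apply: eq_bigr => x _ /=.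
rewrite (reindex_inj (addIr (- x))) /=; apply: eq_bigr => y _.
by rewrite mulrA; congr (_ * nconv _ _); rewrite opprB addrA addrNK.
Qed.

End Convolution.

Section Torsion.
Variable A : finZmodType.

Definition killed (r : nat) (x : A) := x *+ r == 0.

Lemma killed0 r : killed r 0. Proof. by rewrite /killed mul0rn. Qed.

Lemma killedD r x y : killed r x -> killed r y -> killed r (x + y).
Proof. by rewrite /killed mulrnDl => /eqP-> /eqP->; rewrite addr0. Qed.

Lemma killedN r x : killed r (- x) = killed r x.
Proof. by rewrite /killed mulNrn oppr_eq0. Qed.

Lemma killedB r x y : killed r x -> killed r y -> killed r (x - y).
Proof. by move=> ? ?; rewrite killedD ?killedN. Qed.

Lemma killed_dvdn a b x : (a %| b)%N -> killed a x -> killed b x.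
Proof.
by case/dvdnP=> c -> /eqP ka; rewrite /killed mulnC mulrnA ka mul0rn.
Qed.

Lemma killed_gcd a b x : killed a x -> killed b x -> killed (gcdn a b) x.
Proof.
case: (posnP a) => [->|a0]; first by rewrite gcd0n.
move=> ka kb; case: (egcdnP b a0) => km kn e _.
have : killed (km * a) x by apply: killed_dvdn ka; rewrite dvdn_mull.
rewrite e /killed mulrnDr.
have /eqP -> : killed (kn * b) x by apply: killed_dvdn kb; rewrite dvdn_mull.
by rewrite add0r.
Qed.

End Torsion.

(** * The fundamental lemma *)

Section Fundamental.
Variables (R : rcfType) (A : finZmodType).
(** Cyclicity of Z/q enters the fundamental lemma through this bound, which fails in a group such as
    (Z/p)^2. *)
Hypothesis card_killed : forall r, (0 < r)%N -> (#|[pred x : A | killed r x]| <= r)%N.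

(* A weight on [A] together with an integer killing its support. *)
Definition weight := (nat * (A -> R))%type.

Definition weight_ok (w : weight) :=
  [/\ sqfree w.1, forall x, 0 <= w.2 x & forall x, w.2 x != 0 -> killed w.1 x].

Definition weights_ok (s : seq weight) := foldr (fun w P => weight_ok w /\ P) True s.

Definition l2 (g : A -> R) := \sum_x g x ^+ 2.

Definition wnorm (w : weight) := Num.sqrt (w.1%:R * l2 w.2).

Lemma l2_ge0 g : 0 <= l2 g. Proof. by apply: sumr_ge0 => x _; apply: sqr_ge0. Qed.

Lemma nconv_ge0 (s : seq weight) z : weights_ok s -> 0 <= nconv (unzip2 s) z.
Proof.
elim: s z => [|w s IH] z /= => [_|[[_ w0 _] ok]]; first by rewrite ler0n.
by apply: sumr_ge0 => x _; apply: mulr_ge0; rewrite ?IH.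
Qed.

Lemma sum_neq0P (I : finType) (F : I -> R) :
  \sum_i F i != 0 -> exists i, F i != 0.
Proof.
move=> h; case: (pickP (fun i => F i != 0)) => [i Fi|F0]; first by exists i.
by case/eqP: h; apply: big1 => i _; apply/eqP; have := F0 i; case: eqP.
Qed.

Lemma nconv_supp (s : seq weight) z : weights_ok s ->
  nconv (unzip2 s) z != 0 -> killed (lcms (unzip1 s)) z.
Proof.
elim: s z => [|w s IH] z /=.
  by move=> _; rewrite /killed mulr1n; case: (z == 0) => //; rewrite eqxx.
case=> [[_ _ supp] ok] /sum_neq0P[x]; rewrite mulf_eq0 negb_or => /andP[gx zx].
rewrite -[z](subrK x); apply: killedD.
  exact: killed_dvdn (dvdn_lcmr _ _) (IH _ ok zx).
exact: killed_dvdn (dvdn_lcml _ _) (supp _ gx).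
Qed.

Lemma conv_supp (a b : nat) (g1 g2 : A -> R) z :
  (forall x, g1 x != 0 -> killed a x) -> (forall x, g2 x != 0 -> killed b x) ->
  conv g1 g2 z != 0 -> killed (lcmn a b) z.
Proof.
move=> s1 s2 /sum_neq0P[x]; rewrite mulf_eq0 negb_or => /andP[gx zx].
rewrite -[z](subrK x); apply: killedD.
  exact: killed_dvdn (dvdn_lcmr _ _) (s2 _ zx).
exact: killed_dvdn (dvdn_lcml _ _) (s1 _ gx).
Qed.

(** Subtracting one solution [b0] sends every solution into the torsion subgroup of the gcd. *)
Lemma card_killed_coset u d c : (0 < d)%N ->
  (#|[pred b : A | killed u b && killed d (b - c)%R]| <= gcdn u d)%N.
Proof.
move=> d0; case: (pickP [pred b : A | killed u b && killed d (b - c)]) => [b0|e].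
  move=> /= /andP[ub db].
  have g0 : (0 < gcdn u d)%N by rewrite gcdn_gt0 d0 orbT.
  apply: leq_trans (card_killed g0).
  rewrite -(fintype.card_image (addIr (- b0)) [pred b : A | killed u b && killed d (b - c)]).
  apply: subset_leq_card; apply/fintype.subsetP => y /fintype.imageP[x]; rewrite inE => /andP[ux dx] ->.
  rewrite inE; apply: killed_gcd; first exact: killedB.
  have -> : x - b0 = (x - c) - (b0 - c) by rewrite opprB addrA subrK.
  exact: killedB.
by rewrite (eq_card e) card0.
Qed.

Lemma l2_conv (a b u : nat) (g1 g2 : A -> R) : (0 < a)%N ->
  (forall x, g1 x != 0 -> killed a x) -> (forall x, g2 x != 0 -> killed b x) ->
  \sum_(z | killed u z) conv g1 g2 z ^+ 2 <= (gcdn u (gcdn a b))%:R * (l2 g1 * l2 g2).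
Proof.
move=> a0 s1 s2; set d := gcdn a b.
have d0 : (0 < d)%N by rewrite gcdn_gt0 a0.
(* Expand the square and use [2 X Y <= X^2 + Y^2]: two representations of [z]
   differ by an element killed by both [a] and [b]. *)
have amgm z : conv g1 g2 z ^+ 2 <=
    \sum_x \sum_(y | killed d (z - (x + y))) g1 x ^+ 2 * g2 y ^+ 2.
  pose S := \sum_x \sum_(y | killed d (x - y)) g1 x ^+ 2 * g2 (z - y) ^+ 2.
  have -> : \sum_x \sum_(y | killed d (z - (x + y))) g1 x ^+ 2 * g2 y ^+ 2 = S.
    apply: eq_bigr => x _; rewrite (reindex_inj (subrI z)) /=.
    apply: eq_bigl => y; rewrite -killedN; congr killed.
    by rewrite opprB addrA addrAC addrK.
  have S2 : S = \sum_x \sum_(y | killed d (x - y)) g1 y ^+ 2 * g2 (z - x) ^+ 2.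
    rewrite /S (exchange_big_dep xpredT) //=; apply: eq_bigr => x _; apply: eq_bigl => y.
    by rewrite -killedN opprB.
  suff : conv g1 g2 z ^+ 2 *+ 2 <= S + S by rewrite -mulr2n lerMn2r.
  rewrite {2}S2 /S -big_split expr2 /conv mulr_suml -sumrMnl /=; apply: ler_sum => x _.
  rewrite -big_split /= mulr_sumr -sumrMnl (bigID (fun y => killed d (x - y))) /=.
  rewrite [X in _ + X]big1 ?addr0 => [|y nk]; last first.
    apply/eqP; rewrite mulrn_eq0 /=; apply: contraNT nk.
    rewrite !mulf_eq0 !negb_or => /andP[/andP[/s1 k1 /s2 k2] /andP[/s1 k3 /s2 k4]].
    apply: killed_gcd; first exact: killedB.
    have -> : x - y = (z - y) - (z - x) by rewrite opprB [RHS]addrC addrA subrK.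
    exact: killedB.
  apply: ler_sum => y _.
  rewrite -subr_ge0; apply: le_trans (sqr_ge0 (g1 x * g2 (z - y) - g1 y * g2 (z - x))) _.
  by rewrite le_eqVlt; apply/orP; left; apply/eqP; ring.
(* The sum over [z] goes inside: for fixed [x] and [y], the [z] that occur are killed by [u] and lie
   in one coset of the [d]-torsion, which gives the factor [gcdn u d]. *)
apply: le_trans (ler_sum _ (fun z _ => amgm z)) _.
rewrite exchange_big /=; under eq_bigr => x _ do rewrite (exchange_big_dep xpredT) //=.
rewrite /l2 mulr_suml mulr_sumr; apply: ler_sum => x _.
rewrite !mulr_sumr; apply: ler_sum => y _.
rewrite sumr_const -[X in X <= _]mulr_natl; apply: ler_wpM2r; first by rewrite mulr_ge0 ?sqr_ge0.
by rewrite ler_nat; apply: (card_killed_coset u (x + y)).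
Qed.

Definition convH (u : nat) (f g : A -> R) z := (killed u z)%:R * conv f g z.

(* Only sums killed by [u] meet the support of the convolution of the other weights. *)
Lemma nconv_mergeH (w1 w2 : weight) s : weight_ok w1 -> weight_ok w2 -> weights_ok s ->
  let u := gcdn (lcmn w1.1 w2.1) (lcms (unzip1 s)) in
  nconv [:: w1.2, w2.2 & unzip2 s] 0 = nconv (convH u w1.2 w2.2 :: unzip2 s) 0.
Proof.
move=> [_ _ s1] [_ _ s2] oks u; rewrite nconv_merge /=; apply: eq_bigr => z _.
rewrite /convH; case: (boolP (killed u z)) => [|nk]; first by rewrite mul1r.
rewrite !mul0r; apply/eqP; apply: contraNT nk.
rewrite mulf_eq0 negb_or => /andP[/(conv_supp s1 s2) k1].
by move/(nconv_supp oks); rewrite add0r killedN => k2; apply: killed_gcd.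
Qed.

Lemma weight_ok_convH (w1 w2 : weight) L : sqfree L -> weight_ok w1 -> weight_ok w2 ->
  weight_ok (gcdn (lcmn w1.1 w2.1) L, convH (gcdn (lcmn w1.1 w2.1) L) w1.2 w2.2).
Proof.
move=> sL [q1 p1 s1] [q2 p2 s2]; split => [|x|x] /=.
- by apply: sqfree_gcd; apply: sqfree_lcm.
- by rewrite mulr_ge0 ?ler0n // sumr_ge0 // => y _; rewrite mulr_ge0.
- by rewrite /convH; case: killed; rewrite ?mul0r ?eqxx.
Qed.

Lemma weights_ok_sqfree s : weights_ok s -> all sqfree (unzip1 s).
Proof. by elim: s => [|w s IH] //= [[-> _ _] /IH]. Qed.

(* Montgomery and Vaughan's fundamental lemma. Replacing the first two weights
   by the part of their convolution killed by [u] shortens the list, and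
   [lcm (gcd a b) L = lcm a (lcm b L)] makes the constants match exactly. *)
Theorem fundamental (s : seq weight) : weights_ok s -> admissible (unzip1 s) ->
  nconv (unzip2 s) 0 <= (lcms (unzip1 s))%:R^-1 * \prod_(w <- s) wnorm w.
Proof.
have [n] := ubnP (size s); elim: n s => // n IH [|w1 [|w2 s]] sz ok adm.
- by rewrite big_nil /= eqxx invr1 mulr1.
- have [/= [q1 p1 s1] _] := ok.
  (* A prime factor of the only order would divide exactly one entry of the list. *)
  have {}adm : w1.1 = 1%N.
    have := sqfree_gt0 q1; rewrite leq_eqVlt => /predU1P[//|g].
    by have := adm _ (pdiv_prime g); rewrite /= pdiv_dvd.
  rewrite big_seq1 /= /wnorm adm lcmn1 invr1 !mul1r.
  rewrite (bigD1 0) //= subr0 eqxx mulr1 big1 => [|x x0]; last first.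
    by rewrite sub0r oppr_eq0 (negPf x0) mulr0.
  rewrite addr0 -[w1.2 0]ger0_norm // -sqrtr_sqr ler_sqrt ?l2_ge0 //.
  by rewrite /l2 (bigD1 0) //= lerDl sumr_ge0 // => x _; apply: sqr_ge0.
have [/= ok1 [ok2 oks]] := ok.
set L := lcms (unzip1 s); set u := gcdn (lcmn w1.1 w2.1) L.
have [q1 p1 s1] := ok1; have [q2 p2 s2] := ok2.
have sL : sqfree L by apply: sqfree_lcms; apply: weights_ok_sqfree.
have L0 := sqfree_gt0 sL; have [a0 b0] := (sqfree_gt0 q1, sqfree_gt0 q2).
have eM : nconv [:: w1.2, w2.2 & unzip2 s] 0 = nconv (convH u w1.2 w2.2 :: unzip2 s) 0.
  exact: nconv_mergeH.
rewrite -[X in X <= _]/(nconv [:: w1.2, w2.2 & unzip2 s] 0) eM.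
have := IH ((u, convH u w1.2 w2.2) :: s) sz.
have okw : weights_ok ((u, convH u w1.2 w2.2) :: s).
  by split => //; apply: weight_ok_convH.
move=> /(_ okw (admissible_merge adm)) /le_trans; apply.
rewrite !big_cons /= -/L -(gcd_lcm_merge q1 q2 adm) -/L.
set P := \prod_(w <- s) _; have P0 : 0 <= P by apply: prodr_ge0 => w _; apply: sqrtr_ge0.
have -> : lcmn u L = L by apply/eqP; rewrite eqn_dvd dvdn_lcmr dvdn_lcm dvdnn dvdn_gcdr.
rewrite !mulrA ler_wpM2r //.
set d := gcdn w1.1 w2.1; set r := lcmn d L.
have d0 : (0 < d)%N by rewrite gcdn_gt0 a0.
have r0 : (0 < r)%N by rewrite lcmn_gt0 d0.
(* [r] is the lcm of the whole list. With [a], [b] the first two orders, [e1], [e2] and [e3] combine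
   to [r^2 u gcd(d, L) = L^2 a b], which is the comparison of the squared constants. *)
have e1 : (r * gcdn d L = d * L)%N by apply: muln_lcm_gcd.
have gu : gcdn u d = gcdn d L.
  rewrite /u gcdnAC [gcdn (lcmn _ _) d]gcdnC.
  by rewrite (_ : gcdn d (lcmn w1.1 w2.1) = d) //; apply/gcdn_idPl; apply: dvdn_trans (dvdn_gcdl _ _) (dvdn_lcml _ _).
have e2 : (r * u = lcmn w1.1 w2.1 * L)%N.
  by rewrite -[RHS]muln_lcm_gcd /r gcd_lcm_merge // lcmnA.
have e3 : (w1.1 * w2.1 = lcmn w1.1 w2.1 * d)%N by rewrite muln_lcm_gcd.
rewrite -mulrA /wnorm -sqrtrM ?mulr_ge0 ?ler0n ?l2_ge0 //=.
rewrite ler_pdivrMl ?ltr0n // mulrCA ler_pdivlMl ?ltr0n //.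
have sq (n0 : nat) (x : R) : n0%:R * Num.sqrt x = Num.sqrt (n0%:R ^+ 2 * x).
  by rewrite sqrtrM ?sqr_ge0 // sqrtr_sqr ger0_norm ?ler0n.
rewrite !sq ler_wsqrtr //.
have := l2_conv u a0 s1 s2; rewrite -/d gu => hc.
have -> : l2 (convH u w1.2 w2.2) = \sum_(z | killed u z) conv w1.2 w2.2 z ^+ 2.
  rewrite /l2 [RHS]big_mkcond; apply: eq_bigr => z _; rewrite /convH.
  by case: killed; rewrite ?mul1r // mul0r expr0n.
apply: le_trans (_ : r%:R ^+ 2 * (u%:R * ((gcdn d L)%:R * (l2 w1.2 * l2 w2.2))) <= _).
  by rewrite !ler_wpM2l ?sqr_ge0 ?ler0n.
rewrite le_eqVlt; apply/orP; left; apply/eqP.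
have := congr1 (fun n => n%:R : R) e1; have := congr1 (fun n => n%:R : R) e2.
have := congr1 (fun n => n%:R : R) e3; rewrite /= !natrM => E3 E2 E1.
transitivity ((r%:R * u%:R) * (r%:R * (gcdn d L)%:R) * (l2 w1.2 * l2 w2.2)); first by ring.
rewrite E1 E2.
transitivity (L%:R ^+ 2 * (w1.1%:R * w2.1%:R) * (l2 w1.2 * l2 w2.2)); last by ring.
by rewrite E3; ring.
Qed.

End Fundamental.

(** * Euler products and the sum over good order tuples *)

Lemma prod_primes n : sqfree n -> n = (\prod_(p <- primes n) p)%N.
Proof.
case/andP=> n0 /allP sq; rewrite {1}[n]prod_prime_decomp // prime_decompE big_map.
by apply: eq_big_seq => p /sq /= /eqP ->; rewrite expn1.
Qed.

Lemma sqfree_prodE a q : (0 < q)%N -> sqfree a -> (a %| q)%N ->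
  a = (\prod_(p <- primes q) (if p %| a then p else 1))%N.
Proof.
move=> q0 sa aq; rewrite {1}[a]prod_primes // -big_mkcond /= -[RHS]big_filter.
apply: perm_big; apply: uniq_perm; rewrite ?filter_uniq ?primes_uniq //.
move=> p; rewrite mem_filter !mem_primes q0 (sqfree_gt0 sa) /=.
case: (boolP (p %| a)%N) => pa; last by rewrite !andbF.
by rewrite (dvdn_trans pa aq) !andbT.
Qed.

Section EulerProduct.
Variable R : realFieldType.

Definition totratio (q : nat) : R := q%:R / (totient q)%:R.

Lemma totratioE q : (0 < q)%N -> totratio q = \prod_(p <- primes q) (p%:R / p.-1%:R).
Proof.
move=> q0; rewrite /totratio totientE // {1}[q]prod_prime_decomp // prime_decompE big_map.
rewrite !natr_prod -prodf_div; apply: eq_big_seq => p; rewrite mem_primes => /and3P[pp _ pq].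
have := prime_gt1 pp; have : (0 < logn p q)%N by rewrite logn_gt0 mem_primes pp q0.
case: (logn p q) => // m _ p1 /=.
rewrite expnS !natrM -mulf_div [X in _ * X = _]divff ?mulr1 //.
by rewrite pnatr_eq0 -lt0n expn_gt0 (ltnW p1).
Qed.

Lemma totratio_ge1_factor p : prime p -> 1 <= p%:R / p.-1%:R :> R.
Proof.
move=> pp; have p1 := prime_gt1 pp.
by rewrite ler_pdivlMr ?ltr0n -?subn1 ?subn_gt0 // mul1r ler_nat leq_subr.
Qed.

Lemma totratio_ge1 q : (0 < q)%N -> 1 <= totratio q.
Proof.
move=> q0; rewrite totratioE // big_seq; elim/big_rec: _ => // p x; rewrite mem_primes.
by case/and3P=> pp _ _ x1; apply: mulr_ege1 => //; apply: totratio_ge1_factor.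
Qed.

Lemma totratio_le r q : (0 < q)%N -> (r %| q)%N -> totratio r <= totratio q.
Proof.
move=> q0 rq; have r0 := dvdn_gt0 q0 rq.
rewrite !totratioE // [leRHS](bigID (fun p => p \in primes r)) /=.
have -> : \prod_(i <- primes q | i \in primes r) (i%:R / i.-1%:R)
        = \prod_(p <- primes r) (p%:R / p.-1%:R) :> R.
  rewrite -big_filter; apply: perm_big; apply: uniq_perm; rewrite ?filter_uniq ?primes_uniq //.
  move=> p; rewrite mem_filter !mem_primes r0 q0 /=.
  case: (boolP (prime p)) => // pp; case: (boolP (p %| r)%N) => // pr.
  by rewrite (dvdn_trans pr rq).
have F1 s (P : pred nat) : all prime s -> 1 <= \prod_(p <- s | P p) (p%:R / p.-1%:R) :> R.
  elim: s => [|p s IH] /=; first by rewrite big_nil.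
  case/andP=> pp /IH; rewrite big_cons; case: ifP => // _ h.
  by apply: mulr_ege1 => //; apply: totratio_ge1_factor.
rewrite -[leLHS]mulr1 ler_wpM2l //.
  by apply: prodr_ge0 => p _; rewrite divr_ge0 ?ler0n.
by apply: F1; apply/allP => p; rewrite mem_primes => /and3P[].
Qed.

Lemma bernoulli (x : R) m : 0 <= x -> 1 + m%:R * x <= (1 + x) ^+ m.
Proof.
move=> x0; elim: m => [|m IH]; first by rewrite mul0r addr0 expr0.
rewrite exprS -natr1; apply: le_trans (ler_wpM2l _ IH); last by rewrite addr_ge0.
have : 0 <= m%:R * x * x by rewrite !mulr_ge0.
by move=> h; nra.
Qed.

Lemma card_set_neq01 k :
  #|[pred S : {set 'I_k} | (#|S| != 1%N) && (S != finset.set0)]| = (2 ^ k - k - 1)%N.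
Proof.
have cT : #|[set: {set 'I_k}]| = (2 ^ k)%N.
  by rewrite -powersetT card_powerset cardsT card_ord.
have c1 : #|[set S : {set 'I_k} | #|S| == 1%N]| = k.
  by rewrite card_draws card_ord bin1.
have := cardsC [set S : {set 'I_k} | (#|S| == 1%N) || (S == finset.set0)].
have -> : #|[set S : {set 'I_k} | (#|S| == 1%N) || (S == finset.set0)]| = k.+1.
  have -> : [set S : {set 'I_k} | (#|S| == 1%N) || (S == finset.set0)]
          = finset.set0 |: [set S : {set 'I_k} | #|S| == 1%N].
    by apply/setP => S; rewrite !inE orbC.
  by rewrite cardsU1 c1 inE cards0.
rewrite -[#|{set 'I_k}|]cardsT cT => e.
rewrite (_ : (2 ^ k - k - 1 = 2 ^ k - k.+1)%N); last by rewrite -subnDA addn1.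
rewrite -e addKn; apply: eq_card => S; rewrite !inE.
by rewrite negb_or.
Qed.

(** Testing only the primes of the lcm makes admissibility a boolean, usable as a summation
    condition. *)
Definition admissibleb (s : seq nat) := all (fun p => count (dvdn p) s != 1%N) (primes (lcms s)).

Lemma admissibleP s : all sqfree s -> reflect (admissible s) (admissibleb s).
Proof.
move=> sq; have l0 := sqfree_gt0 (sqfree_lcms sq).
apply: (iffP allP) => [h p pp|h p]; last by rewrite mem_primes => /and3P[/h].
case: (boolP (p %| lcms s)%N) => ps; first by apply: h; rewrite mem_primes pp l0.
by move: ps; rewrite Euclid_dvdn_lcms // has_count; case: count.
Qed.

Definition good (q : nat) (s : seq nat) :=
  [&& all sqfree s, all (fun r => r %| q)%N s & admissibleb s].

Lemma lcms_dvdn q s : all (fun r => r %| q)%N s -> (lcms s %| q)%N.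
Proof. by elim: s => [|a s IH] //= /andP[aq /IH]; rewrite dvdn_lcm aq. Qed.

(* A good tuple is determined by the sets of indices [i] with [p %| r_i], one
   for each prime [p] dividing [q]; such a set is empty or has at least two
   elements, which leaves [2 ^ k - k - 1] nonempty choices, each of weight [1/p]. *)
Theorem sum_good (q k : nat) : (0 < q)%N ->
  \sum_(r : k.-tuple 'I_q.+1 | good q (map val r)) (lcms (map val r))%:R^-1
    <= totratio q ^+ (2 ^ k - k - 1).
Proof.
move=> q0; set n := size (primes q); pose p (i : 'I_n) := nth 0%N (primes q) i.
have pP i : [/\ prime (p i), (p i \in primes q) & (p i %| q)%N].
  have : p i \in primes q by apply: mem_nth.
  by move=> h; split=> //; move: h; rewrite mem_primes => /and3P[].
have bigp (T : comPzSemiRingType) (F : nat -> T) :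
    \prod_(p <- primes q) F p = \prod_(i < n) F (p i).
  by rewrite (big_nth 0%N) big_mkord.
pose w i (S : {set 'I_k}) : R := if S == finset.set0 then 1 else (p i)%:R^-1.
pose h (r : k.-tuple 'I_q.+1) : {ffun 'I_n -> {set 'I_k}} :=
  [ffun i => [set j | (p i %| tnth r j)%N]].
have w0 i S : 0 <= w i S by rewrite /w; case: ifP; rewrite ?invr_ge0 ?ler0n.
have gnth (r : k.-tuple 'I_q.+1) : good q (map val r) -> forall j : 'I_k,
    sqfree (tnth r j) /\ (tnth r j %| q)%N.
  case/and3P => /allP sq /allP dq _ j; split.
    by apply: sq; apply: map_f; apply: mem_tnth.
  by apply: (dq (val (tnth r j))); apply: map_f; apply: mem_tnth.
have cnt (r : k.-tuple 'I_q.+1) a :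
    count (dvdn a) (map val r) = #|[set j | (a %| tnth r j)%N]|.
  rewrite count_map cardsE -sum1_card -sum1_count.
  by rewrite big_tuple; apply: eq_bigl => j; rewrite inE.
(* Allowing every family of sets without singletons only enlarges the sum, which then factors over
   the primes. *)
apply: (@le_trans _ _ (\sum_(f in ffun_on [pred S : {set 'I_k} | #|S| != 1%N]) \prod_(i < n) w i (f i))).
  apply: (@ler_sum_inj _ _ _ _ _ h).
  - move=> r r' gr gr' e; apply: eq_from_tnth => j; apply/val_inj/eqP.
    have [sj dj] := gnth _ gr j; have [sj' dj'] := gnth _ gr' j.
    have key (s s' : k.-tuple 'I_q.+1) : h s = h s' -> sqfree (tnth s j) ->
       (tnth s j %| q)%N -> (tnth s j %| tnth s' j)%N.
      move=> ee ss ds; apply: sqfree_dvdP => // x px xs.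
      have xq : x \in primes q by rewrite mem_primes px q0 (dvdn_trans xs ds).
      have xi : (index x (primes q) < n)%N by rewrite index_mem.
      have := congr1 (fun f : {ffun 'I_n -> {set 'I_k}} => j \in f (Ordinal xi)) ee.
      by rewrite !ffunE !inE /p /= nth_index // xs => <-.
    by rewrite eqn_dvd key //= key.
  - move=> r gr; apply/ffun_onP => i; rewrite inE ffunE.
    have [pp pq pd] := pP i.
    case/and3P: gr => sq dq ad; rewrite -cnt.
    by move/(admissibleP sq): ad => /(_ _ pp).
  - move=> r gr; have /and3P[sq dq ad] := gr.
    rewrite {1}[lcms _](sqfree_prodE q0 (sqfree_lcms sq) (lcms_dvdn dq)).
    rewrite natr_prod bigp -prodfV le_eqVlt; apply/orP; left; apply/eqP.
    apply: eq_bigr => i _; have [pp pq pd] := pP i.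
    rewrite Euclid_dvdn_lcms // /w ffunE has_count cnt card_gt0.
    by case: eqP => _; rewrite ?invr1.
  by move=> f _; apply: prodr_ge0 => i _.
rewrite -(bigA_distr_big _ (fun i S => w i S)) totratioE // bigp -prodrXl.
apply: ler_prod => i _; rewrite sumr_ge0 //=.
rewrite (bigD1 finset.set0) /= ?cards0 // {1}/w eqxx.
have [pp pq pd] := pP i; have p1 := prime_gt1 pp; have p0 := ltnW p1.
rewrite (eq_bigr (fun=> (p i)%:R^-1)) => [|S /andP[_ /negPf]]; last by rewrite /w => ->.
rewrite sumr_const -[X in _ + X]mulr_natl.
rewrite (eq_card (B := [pred S : {set 'I_k} | (#|S| != 1%N) && (S != finset.set0)])) // card_set_neq01.
(* The local factor is [1 + N/p] with [N = 2^k - k - 1]; it is at most [(1 + 1/p)^N], and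
   [1 + 1/p <= p/(p - 1)]. *)
apply: le_trans (bernoulli _ _) _; first by rewrite invr_ge0 ler0n.
apply: lerXn2r; rewrite ?nnegrE ?addr_ge0 ?invr_ge0 ?divr_ge0 ?ler0n //.
rewrite ler_pdivlMr ?ltr0n -?subn1 ?subn_gt0 // natrB // mulrBr mulr1 mulrDl mul1r.
rewrite mulVf ?pnatr_eq0 -?lt0n // lerBlDr lerD2l addrC -subr_ge0.
by rewrite addrK invr_ge0 ler0n.
Qed.

End EulerProduct.

(** * The group Z/q: orders and distances to the nearest integer *)

Section Cyclic.
Variable q' : nat.
Notation q := q'.+1.
Notation A := 'I_q'.+1.
Implicit Types x y : A.

(** The additive order of [x]. Since [gcdn 0 q = q], the element 0 has order 1. *)
Definition ordA x := (q %/ gcdn x q)%N.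

Lemma killedE r x : killed r x = (q %| r * x)%N.
Proof.
rewrite /killed -val_eqE /= Zp_mulrn /=.
by rewrite mulnC.
Qed.

Lemma ordA_dvdn x : (ordA x %| q)%N.
Proof. exact: dvdn_div (dvdn_gcdr _ _). Qed.

Lemma ordA_gt0 x : (0 < ordA x)%N.
Proof. exact: dvdn_gt0 (ordA_dvdn x). Qed.

Lemma killed_ordA r x : killed r x = (ordA x %| r)%N.
Proof.
rewrite killedE /ordA; have g0 : (0 < gcdn x q)%N by rewrite gcdn_gt0 orbT.
have cop : coprime (q %/ gcdn x q) (x %/ gcdn x q).
  rewrite /coprime -(eqn_pmul2r g0) mul1n muln_gcdl !divnK ?dvdn_gcdl ?dvdn_gcdr //.
  by rewrite gcdnC.
rewrite -(Gauss_dvdl r cop) -[RHS](dvdn_pmul2r g0) divnK ?dvdn_gcdr // -mulnA.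
by rewrite divnK ?dvdn_gcdl.
Qed.

Lemma ordA_eq1 x : (ordA x == 1%N) = (x == 0).
Proof. by rewrite -dvdn1 -killed_ordA /killed mulr1n. Qed.

Lemma killed_divn r x : (r %| q)%N -> killed r x = (q %/ r %| x)%N.
Proof.
move=> rq; have r0 : (0 < r)%N by exact: dvdn_gt0 rq.
by rewrite killedE -{1}(divnK rq) mulnC dvdn_pmul2l.
Qed.

Lemma killed_gcdq r x : killed r x = killed (gcdn r q) x.
Proof. by rewrite !killed_ordA dvdn_gcd ordA_dvdn andbT. Qed.

(* [nrm x / q] is the distance from [x / q] to the nearest integer. *)
Definition nrm x := minn x (q - x).

Lemma nrmD x y : (nrm (x + y)%R <= nrm x + nrm y)%N.
Proof.
rewrite /nrm /=; have := ltn_ord x; have := ltn_ord y; move: (val x) (val y) => a b hb ha.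
case: (ltnP (a + b) q) => h; first by rewrite modn_small //; lia.
have -> : ((a + b) %% q = a + b - q)%N.
  by rewrite -{1}(subnK h) modnDr modn_small //; lia.
lia.
Qed.

Lemma nrm_eq0 x : (nrm x == 0%N) = (x == 0).
Proof.
by rewrite /nrm -val_eqE /=; have := ltn_ord x; move: (val x) => a; lia.
Qed.

Lemma val_gt0 x : (0 < (x : nat))%N = (x != 0).
Proof. by rewrite lt0n -val_eqE. Qed.

(** With [r] the order of [x], both [r x] and [r (q - x)] are positive multiples of [q]: a nonzero
    fraction of denominator [r] is at distance at least [1/r] from the integers. *)
Lemma ler_nrm_ordA x : x != 0 -> (q <= ordA x * nrm x)%N.
Proof.
move=> x0; have k1 : killed (ordA x) x by rewrite killed_ordA.
have k2 : killed (ordA x) (- x) by rewrite killedN.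
have nx : - x != 0 by rewrite oppr_eq0.
have b y : y != 0 -> killed (ordA x) y -> (q <= ordA x * y)%N.
  by move=> y0; rewrite killedE; apply: dvdn_leq; rewrite muln_gt0 ordA_gt0 val_gt0.
have := b _ x0 k1; have := b _ nx k2; rewrite /nrm /minn.
case: ifP => // _; suff -> : val (- x) = (q - x)%N by [].
by rewrite /= modn_small // ltn_subrL val_gt0 x0.
Qed.

(** Translated by [c], the elements lie in [[0, 2c]] and are congruent modulo [m = q/d], so their
    quotients by [m] tell them apart. *)
Lemma card_near_coset (X : pred A) d c : (d %| q)%N ->
  {in X &, forall x y, killed d (x - y)} -> {in X, forall x, (nrm x <= c)%N} ->
  (#|X| <= (2 * c * d) %/ q + 1)%N.
Proof.
move=> dq Xd Xc; have d0 : (0 < d)%N by exact: dvdn_gt0 dq.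
set m := (q %/ d)%N; have m0 : (0 < m)%N by rewrite divn_gt0 // dvdn_leq.
have mq : (m %| q)%N by apply: dvdn_div.
have qmd : (q = m * d)%N by rewrite divnK.
pose y x : nat := val (x + inZp c).
have ysmall x : x \in X -> (y x <= 2 * c)%N.
  move=> /Xc; rewrite /nrm /y /= modnDmr; have := ltn_ord x.
  move: (val x) => a ha hc; case: (ltnP (2 * c) q) => h2; last first.
    by apply: leq_trans h2; apply: ltnW; rewrite ltn_mod.
  case: (leqP a c) => ac; first by rewrite modn_small //; lia.
  have -> : ((a + c) %% q = a + c - q)%N.
    by rewrite -{1}(subnK (_ : (q <= a + c)%N)) ?modnDr ?modn_small //; lia.
  lia.
have ymod x x' : x \in X -> x' \in X -> y x = y x' %[mod m].
  move=> Xx Xx'; have := Xd _ _ Xx Xx'.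
  have -> : x - x' = (x + inZp c) - (x' + inZp c) by rewrite opprD addrACA subrr addr0.
  rewrite /y; move: (x + _) (x' + _) => a b; rewrite killed_divn // -/m => mab.
  rewrite -{1}[a](subrK b) /= modn_dvdm // -modnDml.
  by rewrite (eqP (mab : (a - b)%R %% m == 0)%N).
have -> : ((2 * c * d) %/ q = (2 * c) %/ m)%N by rewrite qmd divnMr.
rewrite addn1 -[X in (_ <= X)%N]card_ord.
pose h x : 'I_(2 * c %/ m).+1 := inord (y x %/ m).
have hE x : x \in X -> h x = (y x %/ m)%N :> nat.
  by move=> Xx; rewrite /h inordK // ltnS leq_div2r // ysmall.
rewrite -(fintype.card_in_image (f := h)); first exact: max_card.
move=> x x' Xx Xx' /(congr1 (@nat_of_ord _)); rewrite !hE // => e.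
have : y x = y x' by rewrite (divn_eq (y x) m) (divn_eq (y x') m) e (ymod x x').
by move/val_inj/addIr.
Qed.

Lemma card_killed_cyclic r : (0 < r)%N -> (#|[pred x : A | killed r x]| <= r)%N.
Proof.
move=> r0; have gq : (gcdn r q %| q)%N := dvdn_gcdr _ _.
have g0 : (0 < gcdn r q)%N by rewrite gcdn_gt0 r0.
apply: leq_trans (dvdn_leq r0 (dvdn_gcdl r q)).
set d := gcdn r q; set m := (q %/ d)%N.
have m0 : (0 < m)%N by rewrite divn_gt0 // dvdn_leq.
have qmd : (q = d * m)%N by rewrite mulnC divnK.
rewrite -[X in (_ <= X)%N]card_ord.
have lt (x : A) : (x %/ m < d)%N by rewrite ltn_divLR // -qmd.
rewrite -(fintype.card_in_image (f := fun x => Ordinal (lt x))); first exact: max_card.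
move=> x y; rewrite !inE => kx ky [e]; apply/ord_inj.
move: kx ky; rewrite !(killed_gcdq r) !killed_divn // -/d -/m => kx ky.
by rewrite -(divnK kx) -(divnK ky) e.
Qed.

(** Zero is killed by [d] and is always near; leaving it out removes the [+ 1] of the coset bound,
    so that the count is 0 when [2 c d < q]. *)
Lemma card_near_killed d c : (d %| q)%N ->
  (#|[pred x : A | [&& killed d x, x != 0%R & nrm x <= c]]| <= (2 * c * d) %/ q)%N.
Proof.
move=> dq; pose X := [pred x : A | killed d x && (nrm x <= c)%N].
have := @card_near_coset X d c dq.
have h1 : {in X &, forall x y, killed d (x - y)}.
  by move=> x y; rewrite !inE => /andP[kx _] /andP[ky _]; apply: killedB.
move=> /(_ h1); have h2 : {in X, forall x, (nrm x <= c)%N} by move=> x /andP[].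
have n0 : nrm (0 : A) = 0%N by apply/eqP; rewrite nrm_eq0.
move=> /(_ h2); rewrite (cardD1 0) inE killed0 n0 leq0n addnC leq_add2r.
apply: leq_trans; apply: subset_leq_card; apply/fintype.subsetP => x.
by rewrite !inE => /and3P[-> -> ->].
Qed.

End Cyclic.

Section NrmSum.
Variable (R : realFieldType) (q' : nat).
Notation q := q'.+1.
Notation A := 'I_q'.+1.

(** Telescoping replaces an integral: for consecutive denominators [a] and [b = a + 1/Y],
    [b^-2 <= 1/(a b) = Y (1/a - 1/b)]. *)
Lemma sum_inv_sqr_le (c Y : R) n : 0 < c -> 0 < Y ->
  \sum_(j < n) (c + j.+1%:R / Y) ^- 2 <= Y / c.
Proof.
move=> c0 Y0; pose u (j : nat) : R := (c + j%:R / Y)^-1.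
have p (j : nat) : 0 < c + j%:R / Y by rewrite ltr_pwDl // divr_ge0 // ltW.
have step j : (c + j.+1%:R / Y) ^- 2 <= Y * (u j - u j.+1).
  have e : c + j.+1%:R / Y = c + j%:R / Y + Y^-1 by rewrite -natr1 mulrDl mul1r addrA.
  have := p j; have := p j.+1; rewrite /u e; set a := c + _ => pa1 pa.
  have y0 : 0 < Y^-1 by rewrite invr_gt0.
  have -> : Y * (a^-1 - (a + Y^-1)^-1) = (a * (a + Y^-1))^-1.
    by field; rewrite !gt_eqF //= -/a; have := pa1; nra.
  rewrite expr2 lef_pV2 ?posrE ?mulr_gt0 // ler_pM2r // lerDl; exact: ltW.
apply: (@le_trans _ _ (Y * (u 0%N - u n))).
  rewrite -(big_mkord xpredT (fun j => (c + j.+1%:R / Y) ^- 2)).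
  apply: le_trans (ler_sum_nat (fun j _ => step j)) _.
  rewrite -mulr_sumr; have := telescope_sumr (fun j => - u j) (leq0n n).
  rewrite (eq_bigr (fun j => u j - u j.+1)); last by move=> j _; rewrite opprK addrC.
  by move=> ->; rewrite opprK addrC.
rewrite ler_pM2l // /u mul0r addr0 gerBl invr_ge0; exact: ltW.
Qed.

Lemma sum_nrm_le (c : R) r : 0 < c -> (r %| q)%N ->
  \sum_(x : A | killed r x && (x != 0)) (c + (nrm x)%:R / q%:R) ^- 2 <= 2 * r%:R / c.
Proof.
move=> c0 rq; have r0 : (0 < r)%N by exact: dvdn_gt0 rq.
set m := (q %/ r)%N; have m0 : (0 < m)%N by rewrite divn_gt0 // dvdn_leq.
have qmr : (q = m * r)%N by rewrite divnK.
pose s (n : nat) : R := (c + n%:R / r%:R) ^- 2.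
have s0 n : 0 <= s n by rewrite invr_ge0 sqr_ge0.
have lt (x : A) : (x %/ m < r)%N by rewrite ltn_divLR // mulnC -qmr.
(* The fraction [x/q] is [j/r] with [0 < j < r], at distance [min(j, r - j)/r]. Both candidates are
   kept; by the symmetry of [j] and [r - j] they have the same sum, whence the factor 2. *)
apply: (@le_trans _ _ (\sum_(j < r | (0 < j)%N) (s j + s (r - j)%N))).
  apply: (@ler_sum_inj _ _ _ _ _ (fun x => Ordinal (lt x))).
  - move=> x y /andP[kx _] /andP[ky _] [e]; apply/ord_inj.
    move: kx ky; rewrite !killed_divn // -/m => kx ky.
    by rewrite -(divnK kx) -(divnK ky) e.
  - move=> x /andP[kx x0] /=; by rewrite divn_gt0 // dvdn_leq ?val_gt0 // -killed_divn.
  - move=> x /andP[kx x0] /=; rewrite killed_divn // -/m in kx.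
    have e (n : nat) : (m * n)%:R / q%:R = n%:R / r%:R :> R.
      by rewrite qmr !natrM -mulf_div divff ?mul1r // pnatr_eq0 -lt0n.
    have ex : (x : nat) = (m * (x %/ m))%N by rewrite mulnC divnK.
    have -> : nrm x = minn (m * (x %/ m)) (m * (r - x %/ m)).
      by rewrite /nrm mulnBr -qmr -ex.
    rewrite /minn; case: ifP => _; rewrite e ?lerDl ?lerDr //; exact: s0.
  - by move=> j _; rewrite addr_ge0.
have half (F : nat -> R) : \sum_(j < r | (0 < j)%N) F j = \sum_(j < r.-1) F j.+1.
  rewrite -(big_mkord (fun j => 0 < j)%N F) -(big_mkord xpredT (fun j => F j.+1)).
  by rewrite -{1}(prednK r0) big_mkcond big_nat_recl //= add0r.
rewrite big_split /= half (half (fun j => s (r - j)%N)).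
have -> : \sum_(j < r.-1) s (r - j.+1)%N = \sum_(j < r.-1) s j.+1.
  rewrite (reindex_inj rev_ord_inj) /=; apply: eq_bigr => j _; congr s.
  by have := ltn_ord j; lia.
rewrite -mulr2n -mulrA mulr_natl lerMn2r /=.
by apply: sum_inv_sqr_le; rewrite ?ltr0n.
Qed.

End NrmSum.

(** * Splitting convolutions by the orders of the entries *)

Lemma sum_tuple_cons (V : nmodType) (T : finType) k (F : k.+1.-tuple T -> V) :
  \sum_t F t = \sum_x \sum_(t : k.-tuple T) F [tuple of x :: t].
Proof.
rewrite pair_big /= (reindex (fun p : T * k.-tuple T => [tuple of p.1 :: p.2])) /=.
  by apply: eq_bigr => -[x t].
exists (fun t => (thead t, [tuple of behead t])) => [[x t] _|t _] /=.
  by congr (_, _); apply/val_inj.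
by rewrite [RHS]tuple_eta; apply/val_inj.
Qed.

Lemma sum_tuple0 (V : nmodType) (T : finType) (F : 0.-tuple T -> V) :
  \sum_t F t = F [tuple].
Proof.
rewrite (eq_bigr (fun=> F [tuple])) => [|t _]; last by rewrite [t]tuple0.
by rewrite sumr_const card_tuple expn0 mulr1n.
Qed.

Section Orders.
Variables (R : rcfType) (q' : nat).
Notation q := q'.+1.
Notation A := 'I_q'.+1.
Notation Qq := (totratio R q).

Definition restr (w : nat * (A -> R)) : weight R A :=
  (w.1, fun x => w.2 x * (ordA x == w.1)%:R).

Definition zipr (rs : seq nat) (gs : seq (A -> R)) := [seq restr w | w <- zip rs gs].

Lemma sum_ordA (F : nat -> R) (x : A) :
  \sum_(r < q.+1) (ordA x == r)%:R * F r = F (ordA x).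
Proof.
have lt : (ordA x < q.+1)%N by rewrite ltnS dvdn_leq // ordA_dvdn.
rewrite (bigD1 (Ordinal lt)) //= eqxx mul1r big1 ?addr0 // => r.
by rewrite -val_eqE /= eq_sym => /negPf ->; rewrite mul0r.
Qed.

Lemma nconv_orders (gs : seq (A -> R)) k z : size gs = k ->
  nconv gs z = \sum_(r : k.-tuple 'I_q.+1) nconv (unzip2 (zipr (map val r) gs)) z.
Proof.
elim: gs k z => [|g gs IH] k z <- /=; first by rewrite sum_tuple0.
rewrite sum_tuple_cons /= exchange_big /=.
under [RHS]eq_bigr => t _ do rewrite exchange_big /=.
rewrite exchange_big /=; apply: eq_bigr => x _.
rewrite (IH (size gs)) // mulr_sumr; apply: eq_bigr => t _.
rewrite -(sum_ordA (fun=> g x * nconv (unzip2 (zipr (map val t) gs)) (z - x)) x).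
by apply: eq_bigr => r _; rewrite mulrCA mulrA.
Qed.

(** The first component is the cost of one coordinate: up to the factor [q/phi(q)], it bounds what
    the fundamental lemma charges for the part of the function on elements of order [r], uniformly
    in [r]. *)
Definition tame (p : R * (A -> R)) :=
  [/\ 0 <= p.1, forall x, 0 <= p.2 x, forall x, p.2 x != 0 -> sqfree (ordA x)
    & forall r, (r %| q)%N -> wnorm (restr (r, p.2)) <= p.1 * Qq].

Definition tames (s : seq (R * (A -> R))) := foldr (fun p P => tame p /\ P) True s.

Lemma restr_supp w x : (restr w).2 x != 0 -> ordA x = w.1 /\ w.2 x != 0.
Proof.
by rewrite /restr /=; case: (ordA x =P w.1) => [e|_] /=; rewrite ?mulr1 ?mulr0 ?eqxx // => h; split.
Qed.

Lemma restr_ok r p : tame p -> sqfree r -> weight_ok (restr (r, p.2)).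
Proof.
case=> _ p0 _ _ sr; split=> // [x|x /restr_supp /= [<- _]].
  by rewrite /= mulr_ge0 ?ler0n.
by rewrite killed_ordA.
Qed.

Lemma zipr_ok rs s : tames s -> all sqfree rs -> weights_ok (zipr rs (unzip2 s)).
Proof.
elim: s rs => [|p s IH] [|r rs] //= [tp ts] /andP[sr srs].
by split; [apply: restr_ok | apply: IH].
Qed.

Lemma unzip1_zipr rs gs : size rs = size gs -> unzip1 (zipr rs gs) = rs.
Proof. by elim: rs gs => [|r rs IH] [|g gs] //= [/IH ->]. Qed.

Lemma nconv_zipr_supp rs s z : size rs = size s -> tames s ->
  nconv (unzip2 (zipr rs (unzip2 s))) z != 0 ->
  exists xs : seq A, [/\ map (@ordA q') xs = rs, \sum_(x <- xs) x = z & all sqfree rs].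
Proof.
elim: rs s z => [|r rs IH] [|p s] z //=.
  move=> _ _ z0; exists [::]; split=> //; rewrite big_nil; apply/esym/eqP.
  by apply: contraNT z0 => /negPf->.
case=> sz [tp ts] /sum_neq0P[x]; rewrite mulf_eq0 negb_or => /andP[h].
have [/= ox px] := @restr_supp (r, p.2) x h.
case/(IH _ _ sz ts) => xs [oxs sxs sq]; exists (x :: xs); split=> /=.
- by rewrite ox oxs.
- by rewrite big_cons sxs addrC subrK.
- by rewrite sq andbT -ox; case: tp => _ _ + _; apply.
Qed.

Lemma sum_count1 (xs : seq A) (a : pred A) (F : A -> A) :
  count a xs = 1%N -> (forall x, ~~ a x -> x \in xs -> F x = 0) ->
  \sum_(x <- xs) F x = 0 -> exists2 x, x \in xs & a x /\ F x = 0.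
Proof.
rewrite -size_filter => sz F0; rewrite (bigID a) /= [X in _ + X]big1_seq ?addr0; last first.
  by move=> x /andP[]; exact: F0.
rewrite -big_filter; case: (seq.filter a xs) sz (mem_filter a ^~ xs) => [|x [|]] // _ mf.
rewrite big_seq1 => Fx; have := mf x; rewrite inE eqxx => /esym/andP[ax xxs].
by exists x.
Qed.

(** Suppose that [p] divides the order of a single entry [x], and let [l] be the lcm of the orders.
    Multiplying the sum by [l/p] kills every other entry, hence also [x]; then [p] divides [l/p],
    against the squarefreeness of [l]. *)
Lemma zero_sum_admissible (xs : seq A) : all sqfree (map (@ordA q') xs) ->
  \sum_(x <- xs) x = 0 -> admissible (map (@ordA q') xs).
Proof.
move=> sq s0 p pp; apply/negP => /eqP; rewrite count_map => c1.
set l := lcms (map (@ordA q') xs); have sl : sqfree l := sqfree_lcms sq.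
have pl : (p %| l)%N.
  by rewrite Euclid_dvdn_lcms // has_map has_count c1.
have dl x : x \in xs -> (ordA x %| l)%N.
  move=> xx; apply: sqfree_dvdP => [|r pr rx]; first by apply: (allP sq); apply: map_f.
  by rewrite Euclid_dvdn_lcms // has_map; apply/hasP; exists x.
have e : l = (l %/ p * p)%N by rewrite divnK.
have [||x xx [px kx]] := @sum_count1 xs (preim (@ordA q') (dvdn p)) (fun x => x *+ (l %/ p)) c1.
- move=> x /= npx xx; apply/eqP; rewrite -/(killed _ x) killed_ordA.
  have := dl x xx; rewrite {1}e Gauss_dvdl // coprime_sym prime_coprime //.
- by rewrite sumrMnl s0 mul0rn.
move/eqP: kx; rewrite -/(killed _ x) killed_ordA => od.
have := sqfreeP (sqfree_gt0 sl) sl p pp; rewrite e -mulnn dvdn_pmul2r ?prime_gt0 //.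
by rewrite (dvdn_trans px od).
Qed.

Lemma zipr_good rs s : size rs = size s -> tames s ->
  nconv (unzip2 (zipr rs (unzip2 s))) 0 != 0 -> good q rs.
Proof.
move=> sz ts /(nconv_zipr_supp sz ts)[xs [<- s0 sq]].
rewrite /good sq /=; apply/andP; split.
  by apply/allP => _ /mapP[x _ ->]; apply: ordA_dvdn.
by apply/(admissibleP sq); apply: zero_sum_admissible.
Qed.

Lemma prod_wnorm_le rs s : size rs = size s -> tames s -> all (fun r => r %| q)%N rs ->
  \prod_(w <- zipr rs (unzip2 s)) wnorm w <= \prod_(p <- s) p.1 * Qq ^+ size s.
Proof.
elim: rs s => [|r rs IH] [|p s] //=; first by rewrite !big_nil mulr1.
case=> sz [[p0 _ _ pr] ts] /andP[rq rsq]; rewrite !big_cons /= exprS mulrACA.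
apply: ler_pM; rewrite ?pr ?sqrtr_ge0 ?IH //.
by apply: prodr_ge0 => w _; apply: sqrtr_ge0.
Qed.

Lemma Qq_ge0 : 0 <= Qq. Proof. by rewrite (le_trans ler01) ?totratio_ge1. Qed.

Lemma tames_prod_ge0 s : tames s -> 0 <= \prod_(p <- s) p.1.
Proof. by elim: s => [|p s IH] /=; rewrite ?big_nil // big_cons => -[[p0 _ _ _] /IH]; apply: mulr_ge0. Qed.

(** With [n] the length of [s], the norms give one power of [Qq] per entry and [sum_good] gives
    [2^n - n - 1] more, in total [2^n - 1]. *)
Theorem nconv_bound s : tames s ->
  nconv (unzip2 s) 0 <= \prod_(p <- s) p.1 * Qq ^+ (size s + (2 ^ size s - size s - 1)).
Proof.
move=> ts; rewrite (@nconv_orders _ (size s)) ?size_map //.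
have P0 := tames_prod_ge0 ts.
rewrite exprD mulrA.
apply: (@le_trans _ _ (\sum_(r : (size s).-tuple 'I_q.+1 | good q (map val r))
   (\prod_(p <- s) p.1 * Qq ^+ size s) * (lcms (map val r))%:R^-1)); last first.
  by rewrite -mulr_sumr ler_wpM2l ?mulr_ge0 ?exprn_ge0 ?Qq_ge0 // sum_good.
rewrite big_mkcond [leRHS]big_mkcond /=; apply: ler_sum => r _.
have sz : size (map val r) = size s by rewrite size_map size_tuple.
case: (boolP (good q _)) => [|ng]; last first.
  rewrite le_eqVlt; apply/orP; left; apply: contraNT ng; exact: zipr_good.
case/and3P => sq dq ad; have ok := zipr_ok ts sq.
have u1 : unzip1 (zipr (map val r) (unzip2 s)) = map val r.
  by rewrite unzip1_zipr // sz [RHS]size_map.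
apply: le_trans (fundamental (@card_killed_cyclic q') ok _) _.
  by rewrite u1; apply/(admissibleP sq).
rewrite u1 mulrC ler_wpM2r ?invr_ge0 ?ler0n //; exact: prod_wnorm_le.
Qed.

End Orders.

(** * Zero-sum tuples and the recursion *)

Section TupleSums.
Variables (K : comNzRingType) (A : finZmodType).

Lemma big_tnth_cons (V : Type) (idx : V) (op : V -> V -> V) (T : Type) k
    (a : T) (x : k.-tuple T) (F : T -> V) :
  \big[op/idx]_(i < k.+1) F (tnth [tuple of a :: x] i)
  = op (F a) (\big[op/idx]_(i < k) F (tnth x i)).
Proof.
rewrite big_ord_recl tnth0; congr (op _ _); apply: eq_bigr => i _.
by rewrite tnthS.
Qed.

Lemma nconv_tuple (f : A -> K) k z :
  nconv (nseq k f) z = \sum_(x : k.-tuple A | \sum_i tnth x i == z) \prod_i f (tnth x i).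
Proof.
elim: k z => [|k IH] z; rewrite [RHS]big_mkcond /=.
  by rewrite sum_tuple0 !big_ord0 eq_sym; case: eqP.
rewrite sum_tuple_cons; apply: eq_bigr => a _.
rewrite IH big_mkcond mulr_sumr /=; apply: eq_bigr => x _.
rewrite (big_tnth_cons _ _ a x id) big_tnth_cons.
rewrite [_ == z - a]eq_sym subr_eq [z == _]eq_sym [_ + a]addrC.
by case: ifP; rewrite // mulr0.
Qed.

Definition tperm_tuple k (s : {perm 'I_k}) (x : k.-tuple A) : k.-tuple A :=
  [tuple tnth x (s i) | i < k].

Lemma sum_tuple_perm k (s : {perm 'I_k}) (f : A -> K) (P : pred (k.-tuple A)) :
  \sum_(x : k.-tuple A | (\sum_i tnth x i == 0) && P x) \prod_i f (tnth x i) =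
  \sum_(x : k.-tuple A | (\sum_i tnth x i == 0) && P (tperm_tuple s x)) \prod_i f (tnth x i).
Proof.
rewrite (reindex_inj (h := tperm_tuple s)) /=; last first.
  move=> x y e; apply: eq_from_tnth => i.
  by have := congr1 (fun t => tnth t (s^-1%g i)) e; rewrite !tnth_mktuple permKV.
have sE (V : Type) (idx : V) (op : Monoid.com_law idx) (F : A -> V) x :
    \big[op/idx]_i F (tnth (tperm_tuple s x) i) = \big[op/idx]_i F (tnth x i).
  rewrite [RHS](reindex_inj (@perm_inj _ s)) /=; apply: eq_bigr => i _.
  by rewrite tnth_mktuple.
by apply: eq_big => x; rewrite ?(sE _ _ _ id) // sE.
Qed.

End TupleSums.

Section TupleSums2.
Variables (K : comNzRingType) (A : finZmodType) (m : nat).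
Notation tup := (m.+2.-tuple A).

Definition ord1' : 'I_m.+2 := lift ord0 ord0.

Definition zsum (f : A -> K) (P : pred tup) :=
  \sum_(x : tup | (\sum_i tnth x i == 0) && P x) \prod_i f (tnth x i).

Lemma zsum_cons f P :
  zsum f P = \sum_a \sum_b f a * f b *
    \sum_(x : m.-tuple A | (\sum_i tnth x i == - (a + b)) && P [tuple of a :: [tuple of b :: x]])
       \prod_i f (tnth x i).
Proof.
rewrite /zsum big_mkcond sum_tuple_cons; apply: eq_bigr => a _.
rewrite sum_tuple_cons; apply: eq_bigr => b _.
rewrite [in RHS]big_mkcond mulr_sumr; apply: eq_bigr => x _.
rewrite !(big_tnth_cons _ _ _ _ id) !big_tnth_cons addrA [a + b + _]addrC addr_eq0.
by case: ifP; rewrite ?mulr0 // mulrA.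
Qed.

Lemma zsum_pair f (P : A -> A -> bool) :
  zsum f (fun x => P (tnth x ord0) (tnth x ord1')) =
  \sum_a \sum_b (P a b)%:R * (f a * f b) * nconv (nseq m f) (- (a + b)).
Proof.
rewrite zsum_cons; apply: eq_bigr => a _; apply: eq_bigr => b _.
rewrite nconv_tuple; case: (P a b); rewrite ?mul1r ?mul0r.
  by congr (_ * _); apply: eq_bigl => x; rewrite andbT.
by rewrite big_pred0 ?mulr0 // => x; rewrite andbF.
Qed.

(** The first two coordinates cancel, so the other [m] again sum to zero and the two sums
    separate. *)
Lemma zsum_opp f :
  zsum f (fun x => tnth x ord1' == - tnth x ord0) = nconv [:: f; f] 0 * nconv (nseq m f) 0.
Proof.
rewrite (zsum_pair f (fun a b => b == - a)) /= mulr_suml; apply: eq_bigr => a _.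
rewrite (bigD1 (- a)) //= eqxx mul1r subrr oppr0 big1 => [|b /negPf->]; last by rewrite !mul0r.
rewrite [X in _ = _ * X * _](bigD1 (- a)) //= sub0r subrr eqxx mulr1 big1 => [|b nb].
  by rewrite !addr0.
by rewrite subr_eq0 eq_sym (negPf nb) mulr0.
Qed.

Lemma zsum_perm (s : {perm 'I_m.+2}) f P : zsum f P = zsum f (fun x => P (tperm_tuple s x)).
Proof. exact: sum_tuple_perm. Qed.

Lemma zsum_tperm1 f (P : A -> A -> bool) j : j != ord0 ->
  zsum f (fun x => P (tnth x ord0) (tnth x j)) =
  zsum f (fun x => P (tnth x ord0) (tnth x ord1')).
Proof.
move=> j0; rewrite [RHS](zsum_perm (tperm ord1' j)); apply: eq_bigl => x.
by rewrite !tnth_mktuple tpermL tpermD // eq_sym.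
Qed.

End TupleSums2.

Local Open Scope complex_scope.

Section Recursion.
Variables (R : rcfType) (A : finZmodType) (m : nat).
Notation tup := (m.+2.-tuple A).
Notation o0 := (ord0 : 'I_m.+2).
Variables (g : A -> R) (M : R).
Hypotheses (g0 : forall x, 0 <= g x) (gM : forall x, g x <= M).

(* Summing over [j != 0] the tuples with [x_j = - x_0] gives [m + 1] times the
   same product of smaller sums, so the error of the recursion is the sum of
   [1 - opps x] over zero-sum tuples. *)
Definition opps (x : tup) := (\sum_(j | j != o0) (tnth x j == - tnth x o0))%N.

(** Once [x_j] is given, [x_0 = - x_j] and [x_i = x_j] are determined and cancel each other. The [m]
    coordinates other than these two still sum to zero, and the two factors that disappear cost [M]
    each. *)
Lemma zsum_opp_twice i j : i != o0 -> j != o0 -> i != j ->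
  zsum g (fun x => (tnth x i == - tnth x o0) && (tnth x j == - tnth x o0))
    <= M ^+ 2 * nconv (nseq m g) 0.
Proof.
move=> i0 j0 ij.
have M0 : 0 <= M by apply: le_trans (g0 0) (gM 0).
rewrite (zsum_perm (tperm (ord1' m) i)).
pose j' := tperm (ord1' m) i j.
have j'0 : j' != o0.
  by rewrite /j'; case: tpermP.
have j'1 : j' != ord1' m.
  rewrite /j'; case: tpermP => [je|je|]; last by move=> /eqP.
    by rewrite -je.
  by rewrite je eqxx in ij.
have e : zsum g (fun x => (tnth (tperm_tuple (tperm (ord1' m) i) x) i == - tnth (tperm_tuple (tperm (ord1' m) i) x) o0)
     && (tnth (tperm_tuple (tperm (ord1' m) i) x) j == - tnth (tperm_tuple (tperm (ord1' m) i) x) o0))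
  = zsum g (fun x => (tnth x (ord1' m) == - tnth x o0) && (tnth x j' == - tnth x o0)).
  apply: eq_bigl => x; rewrite !tnth_mktuple tpermR -/j'.
  by have -> : tperm (ord1' m) i o0 = o0 by rewrite tpermD.
rewrite e zsum_cons.
case: (unliftP o0 j') => [j2 ej|ej]; last by rewrite ej eqxx in j'0.
case: (unliftP ord0 j2) => [l el|el]; last first.
  by case/negP: j'1; apply/eqP/val_inj; rewrite /= ej el.
rewrite nconv_tuple mulr_sumr.
have cE a b (x : m.-tuple A) :
    [&& \sum_i tnth x i == - (a + b),
        tnth [tuple of a :: [tuple of b :: x]] (ord1' m) ==
          - tnth [tuple of a :: [tuple of b :: x]] o0
      & tnth [tuple of a :: [tuple of b :: x]] j' ==
          - tnth [tuple of a :: [tuple of b :: x]] o0]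
    = [&& \sum_i tnth x i == - (a + b), b == - a & tnth x l == - a].
  by rewrite ej el !tnthS.
under eq_bigr => a _ do under eq_bigr => b _ do
  rewrite (eq_bigl _ _ (cE a b)) big_mkcond mulr_sumr.
under eq_bigr => a _ do rewrite exchange_big.
rewrite exchange_big /= [leRHS]big_mkcond; apply: ler_sum => x _.
have P0 (y : m.-tuple A) : 0 <= \prod_i g (tnth y i) by apply: prodr_ge0.
rewrite (bigD1 (- tnth x l)) //= [X in _ + X]big1 ?addr0; last first.
  move=> a na; apply: big1 => b _; case: ifP => [/and3P[_ _ /eqP e1]|_]; last by rewrite mulr0.
  by rewrite e1 opprK eqxx in na.
rewrite (bigD1 (tnth x l)) //= [X in _ + X]big1 ?addr0; last first.
  move=> b nb; case: ifP => [/and3P[_ /eqP e1 _]|_]; last by rewrite mulr0.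
  by rewrite e1 opprK eqxx in nb.
rewrite addNr oppr0 opprK !eqxx !andbT; case: ifP => _; last by rewrite mulr0.
by rewrite ler_wpM2r // expr2 ler_pM.
Qed.

Lemma zsum_far (far : pred A) i :
  zsum g (fun x : tup => far (tnth x i)) = nconv ((fun a => (far a)%:R * g a) :: nseq m.+1 g) 0.
Proof.
rewrite (zsum_perm (tperm o0 i)).
have -> : zsum g (fun x : tup => far (tnth (tperm_tuple (tperm o0 i) x) i))
        = zsum g (fun x : tup => far (tnth x o0)).
  by apply: eq_bigl => x; rewrite !tnth_mktuple tpermR.
rewrite (zsum_pair m g (fun a _ => far a)) /=; apply: eq_bigr => a _.
rewrite mulr_sumr; apply: eq_bigr => b _.
by rewrite !mulrA; congr (_ * nconv _ _); rewrite sub0r opprD.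
Qed.

(** With [J = opps x], the double sum counts ordered pairs and equals [J (J - 1)], which is at least
    [J - 1]; the indicator takes care of [J = 0]. *)
Lemma opps_split (x : tup) : `|1 - (opps x)%:R| <= (opps x == 0%N)%:R +
  \sum_(i | i != o0) \sum_(j | (j != o0) && (i != j))
     ((tnth x i == - tnth x o0) && (tnth x j == - tnth x o0))%:R :> R.
Proof.
rewrite /opps; pose c i : bool := tnth x i == - tnth x o0.
have -> : \sum_(i | i != o0) \sum_(j | (j != o0) && (i != j)) (c i && c j)%:R
   = (\sum_(i | i != o0) \sum_(j | (j != o0) && (i != j)) c i && c j)%N%:R :> R.
  by rewrite natr_sum; apply: eq_bigr => i _; rewrite natr_sum.
have : (\sum_(j | j != o0) c j * (\sum_(j | j != o0) c j).-1 <=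
   \sum_(i | i != o0) \sum_(j | (j != o0) && (i != j)) c i && c j)%N.
  apply: leq_sum => i i0.
  case ci: (c i) => //=; rewrite mul1n.
  rewrite [X in X.-1](bigD1 i) //= ci add1n /=.
  by apply: eq_leq; apply: eq_big => [j|j _]; rewrite ?ci // [i == j]eq_sym.
rewrite -big_distrl /=; set J := (\sum_(j | j != o0) c j)%N => hJ.
apply: (@le_trans _ _ ((J == 0%N)%:R + (J * J.-1)%:R)); last by rewrite lerD2l ler_nat.
case: J {hJ} => [|J]; first by rewrite subr0 normr1 mul0n addr0.
rewrite add0r -natr1 opprD addrC addrNK normrN normr_nat /= ler_nat.
by rewrite mulSn leq_addr.
Qed.

(** The three terms are the tuples cancelled at least twice, those with a far entry, and those with
    a partner related to [x_0] by [P]. The factors bound the number of ordered pairs [(i, j)], of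
    places of the far entry, and of places of the partner. *)
Theorem recursion_bound (f : A -> R[i]) (far : pred A) (P : A -> A -> bool) :
  (forall x, `|f x| = (g x)%:C) ->
  (forall x : tup, \sum_i tnth x i = 0 -> \prod_i g (tnth x i) != 0 ->
     opps x = 0%N -> (exists i, far (tnth x i)) \/ exists2 j, j != o0 & P (tnth x o0) (tnth x j)) ->
  `|nconv (nseq m.+2 f) 0 - m.+1%:R * (nconv [:: f; f] 0 * nconv (nseq m f) 0)| <=
  (m.+1%:R ^+ 2 * (M ^+ 2 * nconv (nseq m g) 0) +
   m.+2%:R * nconv ((fun a => (far a)%:R * g a) :: nseq m.+1 g) 0 +
   m.+1%:R * \sum_a \sum_b (P a b)%:R * (g a * g b) * nconv (nseq m g) (- (a + b)))%:C.
Proof.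
move=> fg cover.
have cnt : #|[pred j : 'I_m.+2 | j != o0]| = m.+1.
  by have := cardC (pred1 o0); rewrite card1 card_ord add1n => /succn_inj e1; rewrite -[RHS]e1; apply: eq_card.
have sumc (W : nmodType) (c : W) : \sum_(j < m.+2 | j != o0) c = c *+ m.+1.
  by rewrite sumr_const cnt.
have -> : nconv (nseq m.+2 f) 0 - m.+1%:R * (nconv [:: f; f] 0 * nconv (nseq m f) 0)
  = \sum_(x : tup | \sum_i tnth x i == 0) (\prod_i f (tnth x i)) * (1 - (opps x)%:R).
  rewrite nconv_tuple -zsum_opp.
  have -> : m.+1%:R * zsum f (fun x : tup => tnth x (ord1' m) == - tnth x o0)
     = \sum_(j | j != o0) zsum f (fun x : tup => tnth x j == - tnth x o0).
    rewrite mulr_natl -sumc; apply: eq_bigr => j j0.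
    by rewrite (zsum_tperm1 f (fun a b => b == - a) j0).
  under [RHS]eq_bigr => x _ do rewrite mulrBr mulr1.
  rewrite sumrB; congr (_ - _).
  rewrite /zsum (exchange_big_dep (fun x : tup => \sum_i tnth x i == 0)) /=; last by move=> j x _ /andP[].
  apply: eq_bigr => x s0; rewrite /opps natr_sum mulr_sumr [RHS]big_mkcond /= big_mkcond.
  apply: eq_bigr => j _; rewrite s0 /=; case: (j != o0) => //=.
  by case: eqP => _; rewrite ?mulr1 ?mulr0.
apply: le_trans (ler_norm_sum _ _ _) _.
have -> : \sum_(x : tup | \sum_i tnth x i == 0) `|\prod_i f (tnth x i) * (1 - (opps x)%:R)|
  = (\sum_(x : tup | \sum_i tnth x i == 0) \prod_i g (tnth x i) * `|1 - (opps x)%:R|)%:C.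
  rewrite rmorph_sum; apply: eq_bigr => x _.
  rewrite normrM normr_prod rmorphM rmorph_prod /=; congr (_ * _).
    by apply: eq_bigr => i _; apply: fg.
  have -> : 1 - (opps x)%:R = (1 - (opps x)%:R)%:C :> R[i] by rewrite rmorphB rmorph1 rmorph_nat.
  by rewrite normc_def /= expr0n /= addr0 sqrtr_sqr.
rewrite lecR.
have pg0 (x : tup) : 0 <= \prod_i g (tnth x i) by apply: prodr_ge0.
apply: le_trans (ler_sum _ (fun x _ => ler_wpM2l (pg0 x) (opps_split x))) _.
under eq_bigr => x _ do rewrite mulrDr.
rewrite big_split /= addrC -addrA lerD //.
  under eq_bigr => x _ do rewrite mulr_sumr.
  rewrite exchange_big /= expr2 -mulrA mulr_natl -sumc; apply: ler_sum => i i0.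
  under eq_bigr => x _ do rewrite mulr_sumr.
  rewrite exchange_big /=.
  apply: (@le_trans _ _ (\sum_(j | (j != o0) && (i != j)) M ^+ 2 * nconv (nseq m g) 0)).
    apply: ler_sum => j /andP[j0 ij]; apply: le_trans (zsum_opp_twice i0 j0 ij).
    rewrite /zsum big_mkcondr /=; apply: ler_sum => x _.
    by case: (_ && _); rewrite ?mulr1 ?mulr0.
  rewrite mulr_natl -sumc [leRHS]big_mkcond [leLHS]big_mkcond /=; apply: ler_sum => j _.
  case: (j != o0) => //=; case: (i != j) => //.
  by rewrite mulr_ge0 ?sqr_ge0 // nconv_tuple; apply: sumr_ge0 => x _; apply: prodr_ge0.
apply: (@le_trans _ _ (\sum_i zsum g (fun x : tup => far (tnth x i)) +
   \sum_(j | j != o0) zsum g (fun x : tup => P (tnth x o0) (tnth x j)))); last first.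
  rewrite lerD //.
    rewrite (eq_bigr _ (fun i _ => zsum_far far i)) sumr_const card_ord mulr_natl //.
  rewrite (eq_bigr _ (fun j j0 => zsum_tperm1 g P j0)) zsum_pair.
  by rewrite sumc mulr_natl.
rewrite /zsum (exchange_big_dep (fun x : tup => \sum_i tnth x i == 0)) /=; last by move=> j x _ /andP[].
rewrite [X in _ + X](exchange_big_dep (fun x : tup => \sum_i tnth x i == 0)) /=; last by move=> j x _ /andP[].
rewrite -big_split /=; apply: ler_sum => x s0.
have nn (Q : pred 'I_m.+2) : 0 <= \sum_(i | Q i) \prod_i g (tnth x i) by apply: sumr_ge0.
have [->|pn0] := eqVneq (\prod_i g (tnth x i)) 0; first by rewrite mul0r addr_ge0 // sumr_ge0.
case: eqP => [J0|_]; last by rewrite mulr0 addr_ge0.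
rewrite mulr1; case: (cover x (eqP s0) pn0 J0) => [[i fi]|[j j0 Pj]].
  rewrite [X in _ <= X + _](bigD1 i) /=; last by rewrite s0.
  by rewrite -addrA lerDl addr_ge0 // sumr_ge0.
rewrite addrC [X in _ <= X + _](bigD1 j) /=; last by rewrite j0 s0.
by rewrite -addrA lerDl addr_ge0 // sumr_ge0.
Qed.

End Recursion.

(** * Weights with decay, and the factor shared by two orders *)

Section Weights.
Variables (R : rcfType) (q' : nat).
Notation q := q'.+1.
Notation A := 'I_q'.+1.
Notation Qq := (totratio R q).

(** By [sum_nrm_le], [r] times the sum of [p^2] over the elements of order [r] is at most
    [(2 B^2/c) (r/phi(r))^2]. The choice [c = 1/h] yields the size [sqrt h] of a general coordinate,
    [c = eta] the saving of a far one. *)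
Lemma tame_decay (B c : R) (p : A -> R) : 0 <= B -> 0 < c ->
  (forall x, 0 <= p x) -> (forall x, p x != 0 -> sqfree (ordA x)) -> p 0 = 0 ->
  (forall x, p x * (totient (ordA x))%:R * (c + (nrm x)%:R / q%:R) <= B) ->
  tame (Num.sqrt (2 * B ^+ 2 / c), p).
Proof.
move=> B0 c0 p0 psq pz pB; split=> /= [|x|x|r rq]; [exact: sqrtr_ge0 | exact: p0 | exact: psq |].
have r0 : (0 < r)%N by exact: dvdn_gt0 rq.
have Q0 := Qq_ge0 R q'.
have fr : 0 < (totient r)%:R :> R by rewrite ltr0n totient_gt0.
have s0 : 0 <= 2 * B ^+ 2 / c by rewrite divr_ge0 ?mulr_ge0 ?sqr_ge0 // ltW.
rewrite -[Qq]ger0_norm // -sqrtr_sqr -sqrtrM // /wnorm ler_wsqrtr //=.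
have le1 : l2 (restr (r, p)).2 <= (B / (totient r)%:R) ^+ 2 * (2 * r%:R / c).
  apply: le_trans (ler_wpM2l (sqr_ge0 _) (sum_nrm_le c0 rq)).
  rewrite mulr_sumr [leRHS]big_mkcond; apply: ler_sum => x _ /=.
  case: (ordA x =P r) => [ox|_]; last first.
    rewrite mulr0 expr0n /=; case: ifP => // _.
    by rewrite mulr_ge0 ?sqr_ge0 ?invr_ge0 ?sqr_ge0.
  rewrite mulr1 killed_ordA ox dvdnn /=.
  have [->|x0 /=] := eqVneq x 0; first by rewrite pz expr0n.
  rewrite -exprVn -exprMn; apply: lerXn2r; rewrite ?nnegrE //.
    rewrite mulr_ge0 ?divr_ge0 ?invr_ge0 ?addr_ge0 ?divr_ge0 ?ler0n //; exact: ltW.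
  have d0 : 0 < c + (nrm x)%:R / q%:R by rewrite ltr_pwDl // divr_ge0.
  by rewrite ler_pdivlMr // ler_pdivlMr // mulrAC -ox.
have rQ : r%:R / (totient r)%:R <= Qq by exact: totratio_le.
apply: le_trans (ler_wpM2l (ler0n _ r) le1) _.
have -> : r%:R * ((B / (totient r)%:R) ^+ 2 * (2 * r%:R / c))
  = 2 * B ^+ 2 / c * (r%:R / (totient r)%:R) ^+ 2 by field; rewrite !gt_eqF.
by rewrite ler_wpM2l // lerXn2r // nnegrE divr_ge0.
Qed.

Lemma tame_le c c' (p : A -> R) : c <= c' -> tame (c, p) -> tame (c', p).
Proof.
move=> cc [/= c0 p0 psq pr]; split=> //=; first exact: le_trans cc.
by move=> r rq; apply: le_trans (pr r rq) _; rewrite ler_wpM2r // Qq_ge0.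
Qed.

Lemma tames_nseq n (p : R * (A -> R)) : tame p -> tames (nseq n p).
Proof. by move=> tp; elim: n => //= n IH. Qed.

Lemma prod_nseq n (p : R * (A -> R)) : \prod_(w <- nseq n p) w.1 = p.1 ^+ n.
Proof. by elim: n => [|n IH] /=; rewrite ?big_nil // big_cons IH exprS. Qed.

Lemma unzip2_nseq n (p : R * (A -> R)) : unzip2 (nseq n p) = nseq n p.2.
Proof. exact: map_nseq. Qed.

Lemma nconv_nseq_bound n c (p : A -> R) : tame (c, p) ->
  nconv (nseq n p) 0 <= c ^+ n * Qq ^+ (2 ^ n - 1).
Proof.
move=> tp; have /= := nconv_bound (tames_nseq n tp).
rewrite unzip2_nseq prod_nseq size_nseq /=.
by rewrite (_ : (n + (2 ^ n - n - 1) = 2 ^ n - 1)%N) //; have := ltn_expl n (ltnSn 1); lia.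
Qed.

Lemma nconv_cons_bound n c c' (p p' : A -> R) : tame (c, p) -> tame (c', p') ->
  nconv (p' :: nseq n p) 0 <= c' * c ^+ n * Qq ^+ (2 ^ n.+1 - 1).
Proof.
move=> tp tp'; have /= := @nconv_bound _ _ ((c', p') :: nseq n (c, p)) (conj tp' (tames_nseq n tp)).
rewrite unzip2_nseq big_cons prod_nseq size_nseq /=.
by rewrite (_ : (n.+1 + (2 ^ n.+1 - n.+1 - 1) = 2 ^ n.+1 - 1)%N) //; have := ltn_expl n.+1 (ltnSn 1); lia.
Qed.

(* The order of [x_0] divides the product over [j != 0] of its gcds with the
   orders of the [x_j]. *)
Lemma gcd_large m (x : m.+2.-tuple A) :
  (forall i, sqfree (ordA (tnth x i))) -> \sum_i tnth x i = 0 ->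
  exists2 j, j != ord0 &
    (ordA (tnth x ord0) <= gcdn (ordA (tnth x ord0)) (ordA (tnth x j)) ^ m.+1)%N.
Proof.
move=> sq s0; set o := ordA (tnth x ord0).
have sqx : all sqfree (map (@ordA q') x) by apply/allP => _ /mapP[y /tnthP[i ->] ->].
have adm : admissible (map (@ordA q') x) by apply: zero_sum_admissible => //; rewrite big_tuple.
have od : (o %| \prod_(j | j != ord0) gcdn o (ordA (tnth x j)))%N.
  apply: sqfree_dvdP => [|p pp po]; first exact: sq.
  have := adm p pp; rewrite count_map -sum1_count big_tuple (bigD1 ord0) //= => c1.
  case: (pickP (fun j : 'I_m.+2 => (p %| ordA (tnth x j))%N && (j != ord0))) => [j|e].
    case/andP=> pj j0; rewrite (bigD1 j) //=; apply: dvdn_mulr.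
    by rewrite dvdn_gcd po.
  by move: c1; rewrite (big_pred0 _ _ _ _ e).
case: (pickP (fun j : 'I_m.+2 => (j != ord0) && (o <= gcdn o (ordA (tnth x j)) ^ m.+1)%N)) => [j|e].
  by case/andP=> j0 oj; exists j.
have o0 : (0 < o)%N := ordA_gt0 _.
have g0 j : (0 < gcdn o (ordA (tnth x j)))%N by rewrite gcdn_gt0 o0.
(* Otherwise each of the [m + 1] gcds has [(m + 1)]-th power at most [o - 1], while their product is
   at least [o]. Comparing powers avoids real roots. *)
have : (o ^ m.+1 <= o.-1 ^ m.+1)%N.
  apply: (@leq_trans ((\prod_(j | j != ord0) gcdn o (ordA (tnth x j))) ^ m.+1)).
    by rewrite leq_exp2r // dvdn_leq // prodn_gt0.
  have cnt : #|[pred j : 'I_m.+2 | j != ord0]| = m.+1.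
    by have := cardC (pred1 (ord0 : 'I_m.+2)); rewrite card1 card_ord add1n => /succn_inj e1; rewrite -[RHS]e1; apply: eq_card.
  rewrite -[X in (_ <= _ ^ X)%N]cnt -prod_nat_const (big_morph (fun a => a ^ m.+1)%N (fun a b => expnMn a b m.+1) (exp1n m.+1)); apply: leq_prod => j j0.
  by have := e j; rewrite j0 /= => /negbT; rewrite -ltnNge => lt; rewrite -ltnS prednK.
by rewrite leq_exp2r // leqNgt ltn_predL o0.
Qed.

End Weights.

(** * Pair sums split by orders *)

Section PairSum.
Variables (R : rcfType) (q' m : nat).
Notation q := q'.+1.
Notation A := 'I_q'.+1.
Notation Qq := (totratio R q).
Variables (g : A -> R) (c : R) (h : nat) (P : A -> A -> bool).
Hypotheses (tg : tame (c, g)) (gh : forall x, g x * (totient (ordA x))%:R <= h%:R).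

Notation gr r := (restr (r, g)).2.

Definition Tsum (r1 r2 : nat) (rest : seq nat) : R :=
  \sum_a \sum_b (P a b)%:R * (gr r1 a * gr r2 b) *
     nconv (unzip2 (zipr rest (nseq m g))) (- (a + b)).

Lemma pair_sum_orders :
  \sum_a \sum_b (P a b)%:R * (g a * g b) * nconv (nseq m g) (- (a + b)) =
  \sum_(r1 < q.+1) \sum_(r2 < q.+1) \sum_(r : m.-tuple 'I_q.+1) Tsum r1 r2 (map val r).
Proof.
rewrite /Tsum; symmetry.
under eq_bigr => r1 _ do under eq_bigr => r2 _ do rewrite exchange_big.
under eq_bigr => r1 _ do rewrite exchange_big.
rewrite exchange_big; apply: eq_bigr => a _ /=.
under eq_bigr => r1 _ do under eq_bigr => r2 _ do rewrite exchange_big.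
under eq_bigr => r1 _ do rewrite exchange_big.
rewrite exchange_big; apply: eq_bigr => b _ /=.
rewrite [in RHS](@nconv_orders _ _ _ m) ?size_nseq //.
under eq_bigr => r1 _ do under eq_bigr => r2 _ do rewrite -mulr_sumr.
set Z := \sum_(r : m.-tuple _) _.
have shuffle (p x y u v w : R) : p * ((u * x) * (v * y)) * w = x * (y * (p * (u * v) * w)).
  by ring.
under eq_bigr => r1 _ do under eq_bigr => r2 _ do rewrite shuffle.
under eq_bigr => r1 _ do rewrite -mulr_sumr.
rewrite -[RHS](sum_ordA (fun=> (P a b)%:R * (g a * g b) * Z) b).
by rewrite -[RHS](sum_ordA (fun=> \sum_(r < q.+1) (ordA b == r)%:R * ((P a b)%:R * (g a * g b) * Z)) a).
Qed.

Definition cnt r1 r2 z :=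
  #|[pred a : A | [&& P a (z - a), ordA a == r1 & ordA (z - a) == r2]]|.

(** The second moment of the number of representations of [z] as the sum of a [P]-pair of given
    orders; the norm of the merged first two weights reduces to it. *)
Definition cnt2 u r1 r2 : R := \sum_(z : A | killed u z) (cnt r1 r2 z)%:R ^+ 2.

Lemma cnt2_ge0 u r1 r2 : 0 <= cnt2 u r1 r2.
Proof. by apply: sumr_ge0 => z _; apply: sqr_ge0. Qed.

Lemma gr_ge0 r x : 0 <= gr r x.
Proof. by case: tg => _ g0 _ _; rewrite /= mulr_ge0 ?ler0n. Qed.

Lemma gr_le r x : (0 < r)%N -> gr r x <= (ordA x == r)%:R * (h%:R / (totient r)%:R).
Proof.
move=> r0 /=; case: (ordA x =P r) => [<-|_] /=; last by rewrite mulr0 mul0r.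
by rewrite mulr1 mul1r ler_pdivlMr ?ltr0n ?totient_gt0 ?ordA_gt0.
Qed.

Lemma Zrest_ge0 rest z : all sqfree rest -> 0 <= nconv (unzip2 (zipr rest (nseq m g))) z.
Proof.
move=> sq; apply: nconv_ge0; rewrite -[g]/((c, g).2) -unzip2_nseq.
by apply: zipr_ok sq; apply: tames_nseq.
Qed.

Lemma Tsum_le_nconv r1 r2 rest : all sqfree rest ->
  Tsum r1 r2 rest <= nconv (unzip2 (zipr [:: r1, r2 & rest] (nseq m.+2 g))) 0.
Proof.
move=> sq /=; apply: ler_sum => a _; rewrite mulr_sumr; apply: ler_sum => b _.
rewrite sub0r -opprD [leRHS]mulrA ler_wpM2r ?Zrest_ge0 //.
rewrite ler_piMl ?lern1 ?leq_b1 // mulr_ge0 //; [exact: (gr_ge0 r1)|exact: (gr_ge0 r2)].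
Qed.

Lemma Tsum_bad r1 r2 rest : size rest = m -> ~~ good q [:: r1, r2 & rest] ->
  Tsum r1 r2 rest <= 0.
Proof.
move=> sz ng; case: (boolP (all sqfree rest)) => [sq|nsq].
  apply: le_trans (Tsum_le_nconv r1 r2 sq) _.
  have e : nseq m.+2 g = unzip2 (nseq m.+2 (c, g)) by rewrite unzip2_nseq.
  rewrite e le_eqVlt; apply/orP; left; apply: contraNT ng; apply: zipr_good.
    by rewrite size_nseq /= sz.
  exact: tames_nseq.
rewrite /Tsum big1 // => a _; apply: big1 => b _.
apply/eqP; apply: contraNT nsq; rewrite mulf_eq0 negb_or => /andP[_].
rewrite -[g]/((c, g).2) -unzip2_nseq => /nconv_zipr_supp[|| xs [_ _]] //.
  by rewrite size_nseq.
exact: tames_nseq.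
Qed.

(** The first two coordinates are merged by hand into one weight on the [u]-torsion, and the
    fundamental lemma is applied to the shorter list. Since [g] is at most [h/phi(r)] on order [r],
    the norm of the merged weight is a count, in which the restriction to [P] is kept; [l2_conv]
    would lose it. *)
Lemma Tsum_le r1 r2 rest : size rest = m -> good q [:: r1, r2 & rest] ->
  Tsum r1 r2 rest <= (lcms rest)%:R^-1 *
    Num.sqrt ((gcdn (lcmn r1 r2) (lcms rest))%:R * cnt2 (gcdn (lcmn r1 r2) (lcms rest)) r1 r2) *
    (h%:R ^+ 2 / ((totient r1)%:R * (totient r2)%:R)) * (c * Qq) ^+ m.
Proof.
move=> sz gd; set L := lcms rest; set u := gcdn _ L; have /and3P[sq dq ad] := gd.
have /and3P[s1 s2 srest] := sq; have /and3P[d1 d2 drest] := dq.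
have r10 := sqfree_gt0 s1; have r20 := sqfree_gt0 s2.
have adm : admissible [:: r1, r2 & rest] by apply/(admissibleP sq).
have [c0 g0 gsq gw] := tg.
have sL : sqfree L := sqfree_lcms srest.
pose G z := \sum_a (P a (z - a))%:R * (gr r1 a * gr r2 (z - a)).
pose G1 z := (killed u z)%:R * G z.
set zr := zipr rest (nseq m g).
have okz : weights_ok zr.
  by rewrite /zr -[g]/((c, g).2) -unzip2_nseq; apply: zipr_ok srest; apply: tames_nseq.
have u1 : unzip1 zr = rest by rewrite unzip1_zipr // size_nseq.
have ok1 : weight_ok (restr (r1, g)) := restr_ok tg s1.
have ok2 : weight_ok (restr (r2, g)) := restr_ok tg s2.
have G0 z : 0 <= G z.
  by apply: sumr_ge0 => a _; rewrite mulr_ge0 ?ler0n // mulr_ge0 //; [exact: (gr_ge0 r1)|exact: (gr_ge0 r2)].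
have e1 : Tsum r1 r2 rest = nconv (G1 :: unzip2 zr) 0.
  transitivity (\sum_z G z * nconv (unzip2 zr) (- z)).
    rewrite /Tsum /G; under [RHS]eq_bigr => z _ do rewrite mulr_suml.
    rewrite [RHS]exchange_big /=; apply: eq_bigr => a _.
    rewrite [RHS](reindex_inj (addrI a)) /=; apply: eq_bigr => b _.
    by rewrite [a + b - a]addrAC subrr add0r.
  rewrite /=; apply: eq_bigr => z _; rewrite sub0r /G1.
  case: (boolP (killed u z)) => [|nk]; first by rewrite mul1r.
  rewrite !mul0r; apply/eqP; apply: contraNT nk; rewrite mulf_eq0 negb_or => /andP[Gz Zz].
  apply: killed_gcd; last by have := nconv_supp okz Zz; rewrite u1 killedN.
  have [_ _ k1] := ok1; have [_ _ k2] := ok2.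
  apply: (conv_supp k1 k2); apply: contraNneq Gz => cz.
  rewrite eq_le G0 andbT -cz; apply: ler_sum => a _.
  by rewrite ler_piMl ?lern1 ?leq_b1 // mulr_ge0 //; [exact: (gr_ge0 r1)|exact: (gr_ge0 r2)].
have uL : lcmn u L = L by apply/eqP; rewrite eqn_dvd dvdn_lcmr dvdn_lcm dvdnn dvdn_gcdr.
rewrite e1.
have okG : weights_ok ((u, G1) :: zr).
  split=> //; split=> [|z|z] /=; first by rewrite sqfree_gcd // sqfree_lcm.
    by rewrite mulr_ge0 ?ler0n.
  by rewrite /G1; case: killed; rewrite ?mul0r ?eqxx.
have := fundamental (@card_killed_cyclic q') okG.
rewrite /= u1 uL big_cons => /(_ (admissible_merge adm)) /le_trans; apply.
have pw : \prod_(w <- zr) wnorm w <= (c * Qq) ^+ m.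
  have := @prod_wnorm_le _ _ rest (nseq m (c, g)).
  rewrite unzip2_nseq prod_nseq size_nseq -exprMn; apply => //; exact: tames_nseq.
have wG : wnorm (u, G1) <= Num.sqrt (u%:R * cnt2 u r1 r2) * (h%:R ^+ 2 / ((totient r1)%:R * (totient r2)%:R)).
  set K := h%:R ^+ 2 / _.
  have K0 : 0 <= K by rewrite divr_ge0 ?sqr_ge0 ?mulr_ge0.
  rewrite -[K]ger0_norm // -sqrtr_sqr -sqrtrM ?mulr_ge0 ?cnt2_ge0 // /wnorm ler_wsqrtr //=.
  rewrite -mulrA ler_wpM2l ?ler0n // /l2 /cnt2 mulr_suml [leRHS]big_mkcond; apply: ler_sum => z _.
  rewrite /G1; case: killed; last by rewrite mul0r expr0n.
  rewrite mul1r -exprMn; apply: lerXn2r; rewrite ?nnegrE ?(mulr_ge0 (ler0n _ _) K0) //.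
  rewrite /G /cnt -sum1_card natr_sum mulr_suml.
  rewrite [leRHS]big_mkcond; apply: ler_sum => a _; rewrite inE.
  have := ler_pM (gr_ge0 r1 a) (gr_ge0 r2 (z - a)) (gr_le a r10) (gr_le (z - a) r20).
  rewrite -/(gr r1) -/(gr r2).
  case: (P a (z - a)); last by rewrite mul0r.
  rewrite mul1r => /le_trans; apply.
  case: (ordA a == r1); rewrite ?mul0r //; case: (ordA (z - a) == r2); rewrite ?mul0r ?mulr0 //.
  by rewrite !mul1r /K expr2 invfM mulrACA.
rewrite -[_ * _ * (h%:R ^+ 2 / _)]mulrA -[leRHS]mulrA ler_wpM2l ?invr_ge0 // ler_pM //.
- exact: sqrtr_ge0.
- by apply: prodr_ge0 => w _; apply: sqrtr_ge0.
Qed.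

End PairSum.

(** * Counting near elements *)

Section NearCount.
Variables (R : rcfType) (q' : nat).
Notation q := q'.+1.
Notation A := 'I_q'.+1.

Definition near (eta : R) (x : A) := (nrm x)%:R <= eta * q%:R.

(** Turns the real cutoff into an integer one: [c] is the largest [nrm] of a near element. *)
Lemma near_max eta : 0 <= eta ->
  exists2 c : nat, c%:R <= eta * q%:R & forall x, near eta x -> (nrm x <= c)%N.
Proof.
move=> e0; exists (\max_(x | near eta x) nrm x)%N => [|x nx].
  elim/big_ind: _ => [|a b ha hb|x] //; first by rewrite mulr_ge0.
  by rewrite /maxn; case: ifP.
exact: (leq_bigmax_cond (F := @nrm q')).
Qed.

Lemma nat_div_le (a b : nat) (x : R) : (a <= b %/ q)%N -> b%:R <= x * q%:R -> a%:R <= x.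
Proof.
move=> ab bx; rewrite -(ler_pM2r (_ : 0 < q%:R)) ?ltr0n //; apply: le_trans bx.
by rewrite -natrM ler_nat; apply: leq_trans (leq_trunc_div b q); rewrite leq_mul2r ab orbT.
Qed.

Lemma card_near_cosetR eta (X : pred A) d : 0 <= eta -> (d %| q)%N ->
  {in X &, forall x y, killed d (x - y)} -> {in X, forall x, near eta x} ->
  #|X|%:R <= 2 * eta * d%:R + 1.
Proof.
move=> e0 dq Xd Xn; have [c cE nc] := near_max e0.
have Xc : {in X, forall x, (nrm x <= c)%N} by move=> x /Xn; apply: nc.
have h := card_near_coset dq Xd Xc.
rewrite -lerBlDr; apply: le_trans (_ : (#|X| - 1)%:R <= _).
  by case: #|X| => [|n]; rewrite ?sub0n ?subr_le0 ?ler01 // subn1 -natr1 addrK.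
apply: (@nat_div_le _ (2 * c * d)); first by rewrite leq_subLR addnC.
by rewrite !natrM [leRHS]mulrAC ler_wpM2r // -mulrA ler_wpM2l.
Qed.

Lemma card_near_killedR eta d : 0 <= eta -> (d %| q)%N ->
  #|[pred x : A | [&& killed d x, x != 0%R & near eta x]]|%:R <= 2 * eta * d%:R.
Proof.
move=> e0 dq; have [c cE nc] := near_max e0.
apply: (@nat_div_le _ (2 * c * d)); last first.
  by rewrite !natrM [leRHS]mulrAC ler_wpM2r // -mulrA ler_wpM2l.
apply: leq_trans (card_near_killed c dq); apply: subset_leq_card; apply/fintype.subsetP => x.
by rewrite !inE => /and3P[-> -> /nc].
Qed.

End NearCount.

(** * Arithmetic of the first two orders *)

Section PairArith.
Variables (a b : nat) (s : seq nat).
Hypotheses (adm : admissible [:: a, b & s]) (sq : all sqfree [:: a, b & s]).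
Let L := lcms s.
Let d := gcdn a b.
Let t := (d %/ gcdn d L)%N.
Let u := gcdn (lcmn a b) L.

Let sa : sqfree a. Proof. by case/and3P: sq. Qed.
Let sb : sqfree b. Proof. by case/and3P: sq. Qed.
Let L0 : (0 < L)%N. Proof. by case/and3P: sq => _ _ h; apply: sqfree_gt0 (sqfree_lcms h). Qed.
Let d0 : (0 < d)%N. Proof. by rewrite gcdn_gt0 (sqfree_gt0 sa). Qed.

Let g0 : (0 < gcdn d L)%N. Proof. by rewrite gcdn_gt0 d0. Qed.

Lemma pair_t_gt0 : (0 < t)%N.
Proof.
by rewrite /t (divn_gt0 d g0); exact: dvdn_leq d0 (dvdn_gcdl d L).
Qed.

Lemma pair_lcms : lcms [:: a, b & s] = (t * L)%N.
Proof.
rewrite /= -(gcd_lcm_merge sa sb adm) -/d -/L; apply/eqP.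
rewrite -(eqn_pmul2r g0).
by rewrite muln_lcm_gcd /t mulnAC divnK ?dvdn_gcdl.
Qed.

Lemma pair_lcm : lcmn a b = (t * u)%N.
Proof.
apply/eqP; rewrite -(eqn_pmul2r L0); apply/eqP.
rewrite -muln_lcm_gcd -/u -lcmnA -[lcmn a _]/(lcms [:: a, b & s]) pair_lcms.
by rewrite mulnAC.
Qed.

Lemma pair_mul : (a * b = d * u * t)%N.
Proof. by rewrite -muln_lcm_gcd pair_lcm -/d; ring. Qed.

Lemma pair_coprime : coprime t u.
Proof.
have sl : sqfree (t * u) by rewrite -pair_lcm; apply: sqfree_lcm.
have tu0 := sqfree_gt0 sl.
rewrite /coprime eqn_leq gcdn_gt0 pair_t_gt0 andbT leqNgt; apply/negP => g1.
have pp := pdiv_prime g1; have := pdiv_dvd (gcdn t u).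
rewrite dvdn_gcd => /andP[h1 h2]; have /negP := sqfreeP tu0 sl _ pp; apply.
by rewrite -mulnn dvdn_mul.
Qed.

(** Since [t] and [u] are coprime, so are [t] and [gcdn u r]; hence [gcdn u r] is at most [r/t], a
    gain needed in [sigma2_I]. *)
Lemma pair_gcd_u r : (t %| r)%N -> (gcdn u r * t %| r)%N.
Proof.
move=> tr; rewrite Gauss_dvd ?dvdn_gcdr //.
by rewrite coprime_sym; apply: coprime_dvdr pair_coprime; apply: dvdn_gcdl.
Qed.

End PairArith.

(** * Counting close pairs *)

Section PairCases.
Variables (R : rcfType) (q' m : nat).
Notation q := q'.+1.
Notation A := 'I_q'.+1.
Notation Qq := (totratio R q).
Variables (g : A -> R) (c : R) (h : nat) (eta D : R).
Hypotheses (tg : tame (c, g)) (gh : forall x, g x * (totient (ordA x))%:R <= h%:R).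
Hypotheses (h0 : (0 < h)%N) (eta0 : 0 < eta) (D0 : 0 < D).

Definition close (a b : A) :=
  [&& near eta a, near eta b, a != 0, b != 0, a + b != 0
    & D <= (gcdn (ordA a) (ordA b))%:R].

Notation cnt := (cnt close).
Notation cnt2 := (cnt2 R close).

Definition pairs u r1 r2 := #|[pred w : A * A |
  [&& close w.1 w.2, ordA w.1 == r1, ordA w.2 == r2 & killed u (w.1 + w.2)]]|.

Lemma pairsE u r1 r2 : pairs u r1 r2 = (\sum_(z : A | killed u z) cnt r1 r2 z)%N.
Proof.
rewrite /pairs -sum1_card big_mkcond /=.
rewrite -(pair_bigA _ (fun a b => if [&& close a b, ordA a == r1, ordA b == r2 & killed u (a + b)%R] then 1 else 0)%N) /=.
under eq_bigr => a _ do rewrite (reindex_inj (addIr (- a))) /=.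
rewrite exchange_big [RHS]big_mkcond; apply: eq_bigr => z _ /=.
rewrite /cnt -sum1_card.
case kz: (killed u z).
  rewrite [RHS]big_mkcond; apply: eq_bigr => a _; rewrite inE.
  by have -> : a + (z - a) = z; rewrite ?kz ?andbT // addrC subrK.
by apply: big1 => a _; have -> : a + (z - a) = z; rewrite ?kz ?andbF // addrC subrK.
Qed.

(** Two solutions differ by an element killed by both [r1] and [r2]. *)
Lemma cnt_le r1 r2 z : (r1 %| q)%N ->
  (cnt r1 r2 z)%:R <= 2 * eta * (gcdn r1 r2)%:R + 1.
Proof.
move=> r1q; apply: card_near_cosetR => [||x y|x]; first exact: ltW.
- exact: dvdn_trans (dvdn_gcdl _ _) r1q.
- rewrite !inE => /and3P[_ /eqP ox /eqP ozx] /and3P[_ /eqP oy /eqP ozy].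
  apply: killed_gcd; first by apply: killedB; rewrite killed_ordA ?ox ?oy.
  have -> : x - y = (z - y) - (z - x) by rewrite opprB [RHS]addrC addrA subrK.
  by apply: killedB; rewrite killed_ordA ?ozx ?ozy.
- by rewrite inE => /and3P[/and5P[]].
Qed.

Lemma cnt_eq0 r1 r2 z : ~~ (near (2 * eta) z && (z != 0)) -> cnt r1 r2 z = 0%N.
Proof.
move=> nz; apply: eq_card0 => a; rewrite !inE; apply: contraNF nz.
case/and3P => /and5P[na nb _ _ /andP[s0 _]] _ _.
rewrite [a + _]addrC subrK in s0; rewrite s0 andbT /near.
rewrite -[z](subrK a); apply: le_trans (_ : (nrm (z - a) + nrm a)%:R <= _).
  by rewrite ler_nat nrmD.
by rewrite natrD -mulrA mulr_natl mulr2n lerD.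
Qed.

(** With [d] the gcd, each count is at most [2 eta d + 1 <= 3 eta d], and [z], being nonzero and
    within [2 eta], takes at most [4 eta u] values: [36 = 3^2 * 4]. *)
Lemma cnt2_case1 u r1 r2 : (r1 %| q)%N -> (u %| q)%N ->
  1 <= eta * (gcdn r1 r2)%:R ->
  cnt2 u r1 r2 <= 36 * eta ^+ 3 * (gcdn r1 r2)%:R ^+ 2 * u%:R.
Proof.
move=> r1q uq hd; have e0 := ltW eta0; set d : R := (gcdn r1 r2)%:R.
have d0 : 0 <= d by rewrite ler0n.
apply: (@le_trans _ _ (\sum_(z : A | [&& killed u z, z != 0 & near (2 * eta) z]) (3 * eta * d) ^+ 2)).
  rewrite /cnt2 big_mkcond [leRHS]big_mkcond; apply: ler_sum => z _.
  case: (killed u z) => //=; case: (boolP (near (2 * eta) z && (z != 0))) => [/andP[-> ->]|nz].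
    apply: lerXn2r; rewrite ?nnegrE ?mulr_ge0 //.
    apply: le_trans (cnt_le r2 z r1q) _; rewrite -/d; move: hd; rewrite -/d; lra.
  rewrite (cnt_eq0 r1 r2 nz) expr0n /=; case: ifP => // _; exact: sqr_ge0.
rewrite sumr_const -[X in X <= _]mulr_natl.
have := @card_near_killedR _ q' (2 * eta) u _ uq; rewrite mulr_ge0 // => /(_ isT) hc.
apply: le_trans (ler_wpM2r (sqr_ge0 _) hc) _.
by rewrite le_eqVlt; apply/orP; left; apply/eqP; rewrite -/d; ring.
Qed.

(** In this range each count is at most 3, so the second moment is controlled by the first, which is
    the number of pairs. *)
Lemma cnt2_pairs u r1 r2 : (r1 %| q)%N -> eta * (gcdn r1 r2)%:R <= 1 ->
  cnt2 u r1 r2 <= 3 * (pairs u r1 r2)%:R.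
Proof.
move=> r1q hd; rewrite pairsE natr_sum mulr_sumr; apply: ler_sum => z _.
rewrite expr2 ler_wpM2r //; apply: le_trans (cnt_le r2 z r1q) _; lra.
Qed.

Lemma pairsC u r1 r2 : pairs u r1 r2 = pairs u r2 r1.
Proof.
rewrite /pairs -(fintype.card_image (f := fun w : A * A => (w.2, w.1))); last by case=> a b [a' b'] [-> ->].
apply: eq_card => -[a b]; apply/fintype.imageP/idP => [[[a' b']]|].
  rewrite !inE /close /= => hh [-> ->]; move: hh.
  by case/and4P => /and5P[-> -> -> -> /andP[]]; rewrite addrC gcdnC => -> -> -> -> ->.
rewrite !inE /close /= => hh; exists (b, a) => //; move: hh; rewrite !inE /close /=.
by case/and4P => /and5P[-> -> -> -> /andP[]]; rewrite addrC gcdnC => -> -> -> -> ->.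
Qed.

(** There are at most [2 eta r2] choices of [b], nonzero and near. For each of them [a] runs through
    one coset of the torsion of [gcdn u r1], because [a] is killed by [r1] and [a + b] by [u]. *)
Lemma pairs_le u r1 r2 : (r1 %| q)%N -> (r2 %| q)%N ->
  (pairs u r1 r2)%:R <= 2 * eta * r2%:R * (2 * eta * (gcdn u r1)%:R + 1).
Proof.
move=> r1q r2q; have e0 := ltW eta0.
apply: (@le_trans _ _ (\sum_(b : A | [&& killed r2 b, b != 0 & near eta b])
    (2 * eta * (gcdn u r1)%:R + 1))); last first.
  rewrite sumr_const -[X in X <= _]mulr_natl; apply: ler_wpM2r.
    by rewrite addr_ge0 ?mulr_ge0.
  exact: card_near_killedR.
rewrite /pairs -sum1_card big_mkcond /=.
rewrite -(pair_bigA _ (fun a b => if [&& close a b, ordA a == r1, ordA b == r2 & killed u (a + b)%R] then 1 else 0)%N) /=.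
rewrite exchange_big natr_sum [leRHS]big_mkcond; apply: ler_sum => b _ /=.
case: ifP => [/and3P[kb b0 nb]|nb]; last first.
  rewrite big1 // => a _; case: ifP => // /and4P[/and5P[_ na _ b0 _] _ /eqP ob _].
  by move: nb; rewrite killed_ordA ob dvdnn b0 na.
rewrite -big_mkcond sum1_card; apply: card_near_cosetR => // [|x y|x].
- exact: dvdn_trans (dvdn_gcdr _ _) r1q.
- move=> hx hy.
  have /and4P[_ /eqP ox _ kx] : [&& close x b, ordA x == r1, ordA b == r2 & killed u (x + b)] := hx.
  have /and4P[_ /eqP oy _ ky] : [&& close y b, ordA y == r1, ordA b == r2 & killed u (y + b)] := hy.
  apply: killed_gcd; last by apply: killedB; rewrite killed_ordA ?ox ?oy.
  have -> : x - y = (x + b) - (y + b) by rewrite opprD addrACA subrr addr0.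
  exact: killedB.
- move=> hx.
  by have /and4P[/and5P[]] : [&& close x b, ordA x == r1, ordA b == r2 & killed u (x + b)] := hx.
Qed.

End PairCases.

(** * Signed numerators and the average over [t] *)

Lemma card_sqfree_dvd n T : (0 < n)%N ->
  (#|[pred t : 'I_T.+1 | sqfree t && (t %| n)]| <= 2 ^ size (primes n))%N.
Proof.
move=> n0; set k := size (primes n).
have -> : (2 ^ k = #|{set 'I_k}|)%N by rewrite -cardsT -powersetT card_powerset cardsT card_ord.
pose F (t : 'I_T.+1) := [set i : 'I_k | (nth 0%N (primes n) i %| t)%N].
rewrite -(fintype.card_in_image (f := F)); first exact: max_card.
move=> x y; rewrite !inE => /andP[sx xn] /andP[sy yn] e; apply/ord_inj.
have key (s s' : 'I_T.+1) : F s = F s' -> sqfree s -> (s %| n)%N -> (s %| s')%N.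
  move=> ee ss sn; apply: sqfree_dvdP => // p pp ps.
  have pn : p \in primes n by rewrite mem_primes pp n0 (dvdn_trans ps sn).
  have pi : (index p (primes n) < k)%N by rewrite index_mem.
  have := congr1 (fun S : {set 'I_k} => Ordinal pi \in S) ee.
  by rewrite !inE /= nth_index // ps => <-.
by apply/eqP; rewrite eqn_dvd key //= key.
Qed.

Section Signed.
Variable q' : nat.
Notation q := q'.+1.
Notation A := 'I_q'.+1.

Definition neg (x : A) : bool := (q - x < x)%N.

(** The representative of [x] of least absolute value, so that near elements become fractions with
    small numerators whose sum can be taken in the integers. *)
Definition signed (x : A) : int := (-1) ^+ neg x * (nrm x)%:Z.

Lemma signed_mod x : exists k : int, signed x = (x : nat)%:Z - k * q%:Z.
Proof.
rewrite /signed /neg /nrm; have := ltn_ord x; move: (val x) => a ha.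
case: ltnP => h; [exists 1; rewrite expr1|exists 0; rewrite expr0]; lia.
Qed.

Lemma signed_inj : injective signed.
Proof.
move=> x y; have [k ->] := signed_mod x; have [l ->] := signed_mod y => e.
apply/ord_inj; have := ltn_ord x; have := ltn_ord y.
have : ((x : nat)%:Z = y%:Z %[mod q%:Z])%Z.
  have -> : (x : nat)%:Z = (k - l) * q%:Z + y%:Z by move: e; lia.
  by rewrite modzMDl.
by rewrite !modz_nat => -[]; move=> + hy hx; rewrite !modn_small.
Qed.

Lemma signed_add x y : exists k : int, (nat_of_ord (x + y))%:Z = signed x + signed y + k * q%:Z.
Proof.
have [k ->] := signed_mod x; have [l ->] := signed_mod y.
exists (k + l - ((x + y) %/ q)%N%:Z) => /=.
have := divn_eq (x + y) q; move: ((x + y) %/ q)%N ((x + y) %% q)%N => c r e.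
have : (x : nat)%:Z + y%:Z = c%:Z * q%:Z + r%:Z by rewrite -PoszM -!PoszD e.
by move=> e2; rewrite (_ : r%:Z = (x : nat)%:Z + y%:Z - c%:Z * q%:Z); [ring | rewrite e2; ring].
Qed.

Lemma dvdn_nrm r (x : A) : (r %| q)%N -> killed r x -> (q %/ r %| nrm x)%N.
Proof.
move=> rq; rewrite killed_divn // /nrm => kx; rewrite /minn; case: ifP => // _.
by apply: dvdn_sub => //; apply: dvdn_div.
Qed.

(* When [r] kills [x], [signed x / q] is the fraction with denominator [r] and
   numerator [level r x] up to sign. *)
Definition level (r : nat) (x : A) := (nrm x %/ (q %/ r))%N.

(** The numerator of [± i/(t p1) ± j/(t p2)] over the common denominator [t lcm(p1, p2)]; it does
    not depend on [t]. *)
Definition comb (p1 p2 : nat) (b1 b2 : bool) (i j : nat) : int :=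
  (-1) ^+ b1 * (p2 %/ gcdn p1 p2 * i)%N%:Z + (-1) ^+ b2 * (p1 %/ gcdn p1 p2 * j)%N%:Z.

Lemma comb_le p1 p2 b1 b2 i j : (`|comb p1 p2 b1 b2 i j| <= p2 * i + p1 * j)%N.
Proof.
rewrite /comb; apply: (@leq_trans (p2 %/ gcdn p1 p2 * i + p1 %/ gcdn p1 p2 * j)); last first.
  by rewrite leq_add // leq_mul2r leq_div orbT.
move: (p2 %/ _ * i)%N (p1 %/ _ * j)%N => a b.
case: b1; case: b2; rewrite /= ?expr1 ?expr0; lia.
Qed.

(** Modulo 1, [(x + y)/q] is the fraction with numerator [n] and denominator [t lcm(p1, p2)]. As
    [lcm(p1, p2)] kills [x + y], the factor [t] of the denominator cancels, so [t] divides [n]; and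
    [n = 0] would force [x + y = 0]. *)
Lemma comb_sval t p1 p2 (x y : A) : (0 < p1)%N -> (0 < p2)%N ->
  ordA x = (t * p1)%N -> ordA y = (t * p2)%N ->
  killed (lcmn p1 p2) (x + y) -> x + y != 0 ->
  let n := comb p1 p2 (neg x) (neg y) (level (t * p1) x) (level (t * p2) y) in
  n != 0 /\ (t %| `|n|)%N.
Proof.
move=> p10 p20 ox oy kxy xy0.
set i := level _ x; set j := level _ y => n.
set s := gcdn p1 p2; set a := (p1 %/ s)%N; set b := (p2 %/ s)%N.
have s0 : (0 < s)%N by rewrite gcdn_gt0 p10.
have e1 : p1 = (a * s)%N by rewrite divnK ?dvdn_gcdl.
have e2 : p2 = (b * s)%N by rewrite divnK ?dvdn_gcdr.
set u := lcmn p1 p2.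
have uE : u = (s * a * b)%N.
  apply/eqP; rewrite -(eqn_pmul2r s0) muln_lcm_gcd e1 e2; apply/eqP; ring.
have a0 : (0 < a)%N by move: p10; rewrite e1 muln_gt0 => /andP[].
have b0 : (0 < b)%N by move: p20; rewrite e2 muln_gt0 => /andP[].
have xq : (t * p1 %| q)%N by rewrite -ox ordA_dvdn.
have yq : (t * p2 %| q)%N by rewrite -oy ordA_dvdn.
have t0 : (0 < t)%N by have := dvdn_gt0 (ltn0Sn q') xq; rewrite muln_gt0 => /andP[].
have u0 : (0 < u)%N by rewrite uE !muln_gt0 s0 a0.
have tuq : (t * u %| q)%N.
  rewrite (_ : t * u = lcmn (t * p1) (t * p2))%N; first by rewrite dvdn_lcm xq yq.
  by rewrite muln_lcmr.
set mm := (q %/ (t * u))%N; have qE : q = (mm * (t * u))%N by rewrite divnK.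
have m0 : (0 < mm)%N by move: (ltn0Sn q'); rewrite {1}qE muln_gt0 => /andP[].
have qx : (q %/ (t * p1) = mm * b)%N.
  by rewrite qE (_ : mm * (t * u) = (mm * b) * (t * p1))%N ?mulnK ?muln_gt0 ?t0 // uE [in RHS]e1; ring.
have qy : (q %/ (t * p2) = mm * a)%N.
  by rewrite qE (_ : mm * (t * u) = (mm * a) * (t * p2))%N ?mulnK ?muln_gt0 ?t0 // uE [in RHS]e2; ring.
have nx : nrm x = (i * (mm * b))%N.
  by rewrite /i /level -qx divnK // dvdn_nrm // killed_ordA ox.
have ny : nrm y = (j * (mm * a))%N.
  by rewrite /j /level -qy divnK // dvdn_nrm // killed_ordA oy.
have sE : signed x + signed y = mm%:Z * n.
  rewrite /signed nx ny /n /comb -/s -/a -/b !PoszM; ring.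
have [k vk] := signed_add x y; rewrite sE in vk.
split.
  apply: contraNneq xy0 => n0; rewrite n0 mulr0 add0r in vk.
  have : (q %| nat_of_ord (x + y)%R)%N.
    have : (q%:Z %| (nat_of_ord (x + y))%:Z)%Z by rewrite vk dvdz_mull.
    by rewrite dvdzE.
  move=> dv; apply/eqP/ord_inj; rewrite -[RHS]/0%N; apply/eqP; rewrite -leqn0 leqNgt.
  by apply/negP => v0; have := dvdn_leq v0 dv; rewrite leqNgt ltn_ord.
have : (q %| u * nat_of_ord (x + y)%R)%N by rewrite -killedE.
case/dvdnP => c /(congr1 Posz); rewrite !PoszM vk => e.
have : u%:Z * mm%:Z * n = u%:Z * mm%:Z * ((c%:Z - u%:Z * k) * t%:Z).
  have qZ : q%:Z = mm%:Z * (t%:Z * u%:Z) by rewrite {1}qE !PoszM.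
  have -> : u%:Z * mm%:Z * n = c%:Z * q%:Z - u%:Z * (k * q%:Z) by rewrite -e; ring.
  by rewrite qZ; ring.
have nz : u%:Z * mm%:Z != 0 by rewrite mulf_neq0 // -lt0n.
move/(mulfI nz) ->; have : (t%:Z %| (c%:Z - u%:Z * k) * t%:Z)%Z by rewrite dvdz_mull.
by rewrite dvdzE.
Qed.

Lemma level_inj r (x y : A) : (r %| q)%N -> killed r x -> killed r y ->
  neg x = neg y -> level r x = level r y -> x = y.
Proof.
move=> rq kx ky nxy lxy; apply: signed_inj; rewrite /signed nxy.
by rewrite -(divnK (dvdn_nrm rq kx)) -(divnK (dvdn_nrm rq ky)) -/(level r x) lxy.
Qed.

End Signed.

Section TAverage.
Variables (R : rcfType) (q' h : nat) (eta D Hb Db : R).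
Notation q := q'.+1.
Notation A := 'I_q'.+1.
Hypotheses (eta0 : 0 < eta) (D0 : 0 < D) (etah : 1 <= eta * h%:R).
Hypothesis Hdiv : forall n, (0 < n)%N -> (n <= 2 * h ^ 2)%N -> (2 ^ size (primes n))%:R <= Db.
Hypothesis Hharm : \sum_(i < h.+1 | (0 < i)%N) i%:R^-1 <= Hb.

Let code := (bool * 'I_h.+1)%type.

Lemma level_gt0 r (x : A) : (r %| q)%N -> killed r x -> x != 0 -> (0 < level r x)%N.
Proof.
move=> rq kx x0; have r0 : (0 < r)%N by exact: dvdn_gt0 rq.
rewrite /level divn_gt0 ?divn_gt0 ?(dvdn_leq _ rq) // dvdn_leq ?dvdn_nrm //.
by rewrite lt0n nrm_eq0.
Qed.

Lemma level_le r (x : A) : (r %| q)%N -> killed r x -> near eta x ->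
  (level r x)%:R <= eta * r%:R.
Proof.
move=> rq kx; have r0 : (0 < r)%N by exact: dvdn_gt0 rq.
have m0 : (0 < q %/ r)%N by rewrite divn_gt0 // dvdn_leq.
rewrite /near /level -{1}(divnK (dvdn_nrm rq kx)) -{3}(divnK rq) !natrM.
by rewrite [_ * (_ * r%:R)]mulrCA [_ * (eta * _)]mulrC ler_pM2r ?ltr0n.
Qed.

(* A pair counted for [t] yields numerators [i], [j] such that [t] divides a fixed
   nonzero combination of them, so that each [(i, j)] is met by few [t]. *)
Lemma t_average p1 p2 : (0 < p1)%N -> (0 < p2)%N ->
  eta * p1%:R < 1 -> eta * p2%:R < 1 ->
  \sum_(t < h.+1 | sqfree t)
     (pairs q' eta D (lcmn p1 p2) (t * p1)%N (t * p2)%N)%:R / t%:R ^+ 3 <=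
  4 * (eta ^+ 2 * p1%:R * p2%:R * (gcdn p1 p2)%:R / D) * Hb ^+ 2 * Db.
Proof.
move=> p10 p20 ep1 ep2; set s := gcdn p1 p2.
have s0 : (0 < s)%N by rewrite gcdn_gt0 p10.
set K := eta ^+ 2 * p1%:R * p2%:R * s%:R / D.
have K0 : 0 <= K by rewrite divr_ge0 ?mulr_ge0 ?sqr_ge0 // ltW.
have ph p : eta * p%:R < 1 -> (p <= h)%N.
  move=> /lt_le_trans/(_ etah); rewrite ltr_pM2l // ltr_nat; exact: ltnW.
pose nn (w : code * code) := `|comb p1 p2 w.1.1 w.2.1 w.1.2 w.2.2|%N.
pose ok (w : code * code) := [&& (0 < w.1.2)%N, (0 < w.2.2)%N, (0 < nn w)%N & (nn w <= 2 * h ^ 2)%N].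
(* A pair is coded by two signs and two numerators [i], [j]. The weight [K/(i j)] will dominate
   [1/t^3] for every [t] producing the code, and [ok] records the range in which the divisor bound
   applies to [nn w]. *)
pose wg (w : code * code) : R := K * (w.1.2%:R^-1 * w.2.2%:R^-1).
have wg0 w : 0 <= wg w by rewrite mulr_ge0 // mulr_ge0 ?invr_ge0.
have Db0 : 0 <= Db.
  have h1 : (0 < h)%N by rewrite lt0n; apply: contraTneq etah => ->; rewrite mulr0 ler10.
  by apply: le_trans (Hdiv (ltn0Sn 0) _); rewrite // muln_gt0 expn_gt0 h1.
apply: (@le_trans _ _ (\sum_(t < h.+1 | sqfree t) \sum_(w | ok w && (t %| nn w)%N) wg w)).
  apply: ler_sum => t st; have t0 := sqfree_gt0 st.
  rewrite /pairs -sum1_card natr_sum mulr_suml.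
  pose cd (w : A * A) : code * code :=
    ((neg w.1, inord (level (t * p1)%N w.1)), (neg w.2, inord (level (t * p2)%N w.2))).
  have facts (p : nat) (x : A) : near eta x -> x != 0 -> ordA x = (t * p)%N -> eta * p%:R < 1 ->
     [/\ (t * p %| q)%N, killed (t * p)%N x, (0 < level (t * p)%N x)%N,
         (level (t * p)%N x)%:R <= eta * (t * p)%:R & (level (t * p)%N x < h.+1)%N].
    move=> nx x0 ox ep; have pq : (t * p %| q)%N by rewrite -ox ordA_dvdn.
    have kx : killed (t * p)%N x by rewrite killed_ordA ox.
    have le := level_le pq kx nx; split=> //; first exact: level_gt0.
    (* As [eta p < 1], the numerator is at most [eta t p < t <= h], so it fits into ['I_h.+1]. *)
    have lt : (level (t * p)%N x < t)%N.
      rewrite -(ltr_nat R); apply: le_lt_trans le _.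
      by rewrite natrM mulrCA gtr_pMr ?ltr0n.
    by apply: ltn_trans lt (ltn_ord t).
  apply: (@ler_sum_inj _ _ _ _ _ cd).
  - move=> [a b] [a' b']; rewrite !inE /=.
    move=> /and4P[/and5P[na nb a0 b0 _] /eqP oa /eqP ob _].
    move=> /and4P[/and5P[na' nb' a0' b0' _] /eqP oa' /eqP ob' _].
    have [d1 k1 _ _ l1] := facts _ _ na a0 oa ep1; have [_ k1' _ _ l1'] := facts _ _ na' a0' oa' ep1.
    have [d2 k2 _ _ l2] := facts _ _ nb b0 ob ep2; have [_ k2' _ _ l2'] := facts _ _ nb' b0' ob' ep2.
    case=> ea /(congr1 (@nat_of_ord _)); rewrite !inordK // => ela eb /(congr1 (@nat_of_ord _)).
    rewrite !inordK // => elb.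
    by rewrite (level_inj d1 k1 k1' ea ela) (level_inj d2 k2 k2' eb elb).
  - move=> [a b]; rewrite !inE /= => /and4P[/and5P[na nb a0 b0 /andP[ab0 _]] /eqP oa /eqP ob kab].
    have [d1 k1 g1 _ l1] := facts _ _ na a0 oa ep1.
    have [d2 k2 g2 _ l2] := facts _ _ nb b0 ob ep2.
    have [n0 tn] := comb_sval p10 p20 oa ob kab ab0.
    rewrite /ok /nn /cd /= !inordK // g1 g2 tn andbT absz_gt0 n0 /=.
    apply: leq_trans (comb_le _ _ _ _ _ _) _.
    rewrite mulSn mul1n expnS expn1 leq_add // leq_mul // ?ph //.
  - move=> [a b]; rewrite !inE /= => /and4P[/and5P[na nb a0 b0 /andP[ab0 Dg]] /eqP oa /eqP ob kab].
    have [d1 k1 g1 le1 l1] := facts _ _ na a0 oa ep1.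
    have [d2 k2 g2 le2 l2] := facts _ _ nb b0 ob ep2.
    rewrite /wg /= !inordK // mul1r.
    move: g1 g2 le1 le2; move: (level _ a) (level _ b) => i j i0 j0.
    rewrite !natrM => le1 le2.
    rewrite oa ob -muln_gcdr natrM -/s in Dg.
    have T0 : 0 < t%:R :> R by rewrite ltr0n.
    have I0 : 0 < i%:R :> R by rewrite ltr0n.
    have J0 : 0 < j%:R :> R by rewrite ltr0n.
    (* The three factors [1/t] are paid separately: one by [D <= t s], the other two by
       [i <= eta t p1] and [j <= eta t p2]. *)
    have x1 : t%:R^-1 <= s%:R / D by rewrite ler_pdivlMr // mulrC ler_pdivrMr // mulrC.
    have x2 : t%:R^-1 <= eta * p1%:R / i%:R.
      by rewrite ler_pdivlMr // mulrC ler_pdivrMr // -mulrA [p1%:R * _]mulrC.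
    have x3 : t%:R^-1 <= eta * p2%:R / j%:R.
      by rewrite ler_pdivlMr // mulrC ler_pdivrMr // -mulrA [p2%:R * _]mulrC.
    have t1 : 0 <= t%:R^-1 :> R by rewrite invr_ge0.
    have := ler_pM t1 (mulr_ge0 t1 t1) x1 (ler_pM t1 t1 x2 x3).
    have -> : t%:R^-1 * (t%:R^-1 * t%:R^-1) = (t%:R ^+ 3)^-1 :> R by rewrite -exprVn; ring.
    move/le_trans; apply; rewrite le_eqVlt; apply/orP; left; apply/eqP.
    by rewrite /K; field; rewrite !gt_eqF.
  - by move=> w _.
rewrite (exchange_big_dep ok) /=; last by move=> t w _ /andP[].
apply: (@le_trans _ _ (\sum_(w | ok w) wg w * Db)).
  apply: ler_sum => w okw; have /and4P[_ _ n0 nle] := okw.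
  rewrite sumr_const -[X in X <= _]mulr_natl mulrC ler_wpM2l //.
  apply: le_trans (Hdiv n0 nle); rewrite ler_nat.
  apply: leq_trans (card_sqfree_dvd h n0); apply: subset_leq_card; apply/fintype.subsetP => t.
  by rewrite !unfold_in okw.
rewrite -mulr_suml ler_wpM2r //.
apply: (@le_trans _ _ (\sum_(w : code * code | (0 < w.1.2)%N && (0 < w.2.2)%N) wg w)).
  rewrite big_mkcond [leRHS]big_mkcond; apply: ler_sum => w _; rewrite /ok.
  by case: (0 < w.1.2)%N; case: (0 < w.2.2)%N => //=; case: ifP.
rewrite -mulr_sumr.
have -> : \sum_(w : code * code | (0 < w.1.2)%N && (0 < w.2.2)%N) (w.1.2%:R^-1 * w.2.2%:R^-1)
   = (\sum_(c : code | (0 < c.2)%N) c.2%:R^-1) * (\sum_(c : code | (0 < c.2)%N) c.2%:R^-1) :> R.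
  rewrite mulr_suml; under [RHS]eq_bigr => c _ do rewrite mulr_sumr.
  by rewrite [RHS]pair_big.
(* Each sign doubles a harmonic sum, whence the factor 4 in the bound. *)
have -> : \sum_(c : code | (0 < c.2)%N) c.2%:R^-1 = 2 * \sum_(i < h.+1 | (0 < i)%N) i%:R^-1 :> R.
  rewrite -(pair_big xpredT (fun i : 'I_h.+1 => 0 < i)%N (fun _ i => i%:R^-1)) /=.
  by rewrite big_bool /= mulr_natl mulr2n.
rewrite -/K [4 * K]mulrC -[leRHS]mulrA ler_wpM2l //.
set S := \sum_(i < _ | _) _; have S0 : 0 <= S by apply: sumr_ge0 => i _; rewrite invr_ge0.
have -> : 2 * S * (2 * S) = 4 * S ^+ 2 by ring.
by rewrite ler_pM2l // lerXn2r // nnegrE ?(le_trans S0).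
Qed.

End TAverage.

(* For squarefree [a], [b] and [s]: the product of the primes dividing [a] and
   [b] but no entry of [s]. *)
Definition tpart (a b : nat) (s : seq nat) := (gcdn a b %/ gcdn (gcdn a b) (lcms s))%N.

(** * Dividing out the primes private to two orders *)

Section Reduced.
Variables (q a b : nat) (s : seq nat).
Hypothesis gd : good q [:: a, b & s].
Let t := tpart a b s.
Let L := lcms s.
Let d := gcdn a b.

Let sq : all sqfree [:: a, b & s]. Proof. by case/and3P: gd. Qed.
Let adm : admissible [:: a, b & s]. Proof. by case/and3P: gd => ? _ ?; apply/(admissibleP sq). Qed.
Let sa : sqfree a. Proof. by case/and3P: sq. Qed.
Let sb : sqfree b. Proof. by case/and3P: sq. Qed.
Let ss : all sqfree s. Proof. by case/and3P: sq. Qed.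
Let t0 : (0 < t)%N. Proof. exact: pair_t_gt0 sq. Qed.
Let td : (t %| d)%N. Proof. by rewrite /t /tpart; apply: dvdn_div; apply: dvdn_gcdl. Qed.
Let ta : (t %| a)%N. Proof. exact: dvdn_trans td (dvdn_gcdl _ _). Qed.
Let tb : (t %| b)%N. Proof. exact: dvdn_trans td (dvdn_gcdr _ _). Qed.

Lemma tpart_sqfree : sqfree t. Proof. exact: sqfree_dvdn sa ta. Qed.

Lemma tpart_le : (t <= d)%N.
Proof. by rewrite dvdn_leq // gcdn_gt0 (sqfree_gt0 sa). Qed.

Lemma reduced_mul : (t * (a %/ t) = a)%N /\ (t * (b %/ t) = b)%N.
Proof. by rewrite !(mulnC t) !divnK. Qed.

Let prime_div r p : sqfree r -> (t %| r)%N -> prime p ->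
  (p %| r %/ t)%N = (p %| r)%N && ~~ (p %| t)%N.
Proof.
move=> sr tr pp; have e : r = (r %/ t * t)%N by rewrite divnK.
have := sqfreeP (sqfree_gt0 sr) sr p pp; rewrite {1 3}e => np.
rewrite Euclid_dvdM //; case p1: (p %| r %/ t)%N; case p2: (p %| t)%N => //=.
by rewrite -mulnn dvdn_mul in np.
Qed.

Let t_lcms p : prime p -> (p %| t)%N -> (p %| L)%N = false.
Proof.
move=> pp pt; apply/negP => pL.
have d0 : (0 < d)%N by rewrite gcdn_gt0 (sqfree_gt0 sa).
have sd : sqfree d by apply: sqfree_gcd.
have /negP := sqfreeP d0 sd p pp; apply.
have -> : d = (t * gcdn d L)%N by rewrite /t /tpart divnK ?dvdn_gcdl.
by rewrite -mulnn dvdn_mul // dvdn_gcd pL (dvdn_trans pt td).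
Qed.

(** The primes of [t] disappear from both [a] and [b], and they divide no entry of [s]; every other
    prime keeps its count. *)
Lemma reduced_good : good q [:: a %/ t, b %/ t & s]%N.
Proof.
have /and3P[_ /and3P[aq bq qs] _] := gd; have sqq : all (fun r => r %| q)%N s := qs.
have sq' : all sqfree [:: a %/ t, b %/ t & s]%N.
  by rewrite /= ss (sqfree_dvdn sa (dvdn_div ta)) (sqfree_dvdn sb (dvdn_div tb)).
rewrite /good sq' /= sqq (dvdn_trans (dvdn_div ta) aq) (dvdn_trans (dvdn_div tb) bq) /=.
apply/(admissibleP sq') => p pp; rewrite /= !prime_div //.
case pt: (p %| t)%N; rewrite ?andbT ?andbF /=; last exact: (adm pp).
by have := t_lcms pp pt; rewrite /L Euclid_dvdn_lcms // has_count; case: count.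
Qed.

(** A prime of [a] or [b] dividing no entry of [s] divides both, by admissibility, hence divides [t]
    and is removed. *)
Lemma reduced_lcms : lcms [:: a %/ t, b %/ t & s]%N = L.
Proof.
have h r : sqfree r -> (t %| r)%N ->
    (forall p, prime p -> (p %| r)%N -> ~~ (p %| L)%N -> (p %| d)%N) -> (r %/ t %| L)%N.
  move=> sr tr H; apply: sqfree_dvdP; first exact: sqfree_dvdn sr (dvdn_div tr).
  move=> p pp; rewrite prime_div // => /andP[pr npt].
  case: (boolP (p %| L)%N) => // pL; have := H p pp pr pL.
  have -> : d = (t * gcdn d L)%N by rewrite /t /tpart divnK ?dvdn_gcdl.
  by rewrite Euclid_dvdM // (negPf npt) dvdn_gcd (negPf pL) andbF.
rewrite /= -/L; apply/eqP; rewrite eqn_dvd !dvdn_lcm dvdnn !h //.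
- by rewrite /= (dvdn_trans (dvdn_lcmr (b %/ t) L) (dvdn_lcmr _ _)).
- move=> p pp pb; rewrite Euclid_dvdn_lcms // has_count => c0; have := adm pp.
  by rewrite /= pb dvdn_gcd pb andbT; move: c0; case: (count _ _) => //; case: (p %| a)%N.
- move=> p pp pa; rewrite Euclid_dvdn_lcms // has_count => c0; have := adm pp.
  by rewrite /= pa dvdn_gcd pa /=; move: c0; case: (count _ _) => //; case: (p %| b)%N.
Qed.

(** So [u] is determined by the reduced orders and stays fixed while [t] varies, as [t_average]
    requires. *)
Lemma reduced_lcm : lcmn (a %/ t) (b %/ t) = gcdn (lcmn a b) L.
Proof.
apply/eqP; rewrite -(eqn_pmul2l t0) muln_lcmr; have [-> ->] := reduced_mul.
by apply/eqP; exact: pair_lcm adm sq.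
Qed.

Lemma reduced_gcd : (t * gcdn (a %/ t) (b %/ t) = d)%N.
Proof. by rewrite muln_gcdr; have [-> ->] := reduced_mul. Qed.

End Reduced.

(** * The bound for close pairs *)

Section PairBound.
Variables (R : rcfType) (q' m : nat).
Notation q := q'.+1.
Notation A := 'I_q'.+1.
Notation Qq := (totratio R q).
Variables (g : A -> R) (c : R) (h : nat) (eta D Hb Db lam : R).
Hypotheses (tg : tame (c, g)) (gh : forall x, g x * (totient (ordA x))%:R <= h%:R).
Hypotheses (eta0 : 0 < eta) (D0 : 0 < D) (etah : 1 <= eta * h%:R) (lam0 : 0 < lam).
Hypothesis Hdiv : forall n, (0 < n)%N -> (n <= 2 * h ^ 2)%N -> (2 ^ size (primes n))%:R <= Db.
Hypothesis Hharm : \sum_(i < h.+1 | (0 < i)%N) i%:R^-1 <= Hb.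

Notation P := (@close R q' eta D).
Notation pairsP := (pairs q' eta D).

Let h0 : (0 < h)%N.
Proof. by rewrite lt0n; apply: contraTneq etah => ->; rewrite mulr0 ler10. Qed.

(* Square of the factor by which the bound on [Tsum a b s] improves on the
   trivial one. *)
Definition sigma2 a b s : R :=
  let t := tpart a b s in let u := gcdn (lcmn a b) (lcms s) in
  h%:R ^+ 2 * t%:R ^+ 2 * u%:R * cnt2 R P u a b / (a%:R * b%:R) ^+ 2.

(** Linearises the square root so that the counts can be summed over [t]; [lam] is chosen at the
    very end. *)
Lemma amgm_sqrt (x : R) : 0 <= x -> Num.sqrt x <= (lam * x + lam^-1) / 2.
Proof.
move=> x0; have s0 := sqrtr_ge0 x; rewrite -{2}(sqr_sqrtr x0); set y := Num.sqrt x.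
rewrite ler_pdivlMr // -subr_ge0.
have -> : lam * y ^+ 2 + lam^-1 - y * 2 = lam * (y - lam^-1) ^+ 2.
  by field; rewrite gt_eqF.
by rewrite mulr_ge0 ?sqr_ge0 // ltW.
Qed.

Lemma good_nat_gt0 a b s : good q [:: a, b & s] ->
  [/\ (0 < a)%N, (0 < b)%N, (0 < lcms s)%N & (0 < tpart a b s)%N].
Proof.
move=> gd; have /and3P[sq _ _] := gd; have /and3P[sa sb ss] := sq.
by rewrite !sqfree_gt0 ?sqfree_lcms // (tpart_sqfree gd).
Qed.

Lemma sigma2_ge0 a b s : 0 <= sigma2 a b s.
Proof.
by rewrite /sigma2 divr_ge0 ?sqr_ge0 // mulr_ge0 ?cnt2_ge0 // mulr_ge0 // mulr_ge0 ?sqr_ge0.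
Qed.

(** The prefactor is that of the trivial bound: two coordinates of size [sqrt h] give [h], and the
    ratios [a/phi(a)] and [b/phi(b)] complete the power of [Qq]. *)
Lemma Tsum_sigma2 a b s : size s = m -> good q [:: a, b & s] ->
  Tsum m g P a b s <= c ^+ m * h%:R * Qq ^+ m.+2 *
    ((lcms [:: a, b & s])%:R^-1 * ((lam * sigma2 a b s + lam^-1) / 2)).
Proof.
move=> sz gd; have [a0 b0 L0 t0] := good_nat_gt0 gd.
have /and3P[sq dq ad] := gd; have adm : admissible [:: a, b & s] by apply/(admissibleP sq).
have [c0 _ _ _] := tg; have Q0 := Qq_ge0 R q'.
apply: le_trans (Tsum_le P tg gh sz gd) _.
rewrite (pair_lcms adm sq) -/(tpart a b s).
set t := tpart a b s; set L := lcms s; set u := gcdn _ L; set N := cnt2 _ _ _ _ _.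
have N0 : 0 <= N := cnt2_ge0 _ _ _ _ _.
have A0 : 0 < a%:R :> R by rewrite ltr0n.
have B0 : 0 < b%:R :> R by rewrite ltr0n.
have T0 : 0 < t%:R :> R by rewrite ltr0n.
have H0 : 0 < h%:R :> R by rewrite ltr0n.
have LL0 : 0 < L%:R :> R by rewrite ltr0n.
have fa : 0 < (totient a)%:R :> R by rewrite ltr0n totient_gt0.
have fb : 0 < (totient b)%:R :> R by rewrite ltr0n totient_gt0.
have -> : Num.sqrt (u%:R * N) = Num.sqrt (sigma2 a b s) * (a%:R * b%:R / (h%:R * t%:R)).
  have e : 0 <= a%:R * b%:R / (h%:R * t%:R) :> R by rewrite divr_ge0 ?mulr_ge0.
  rewrite -[_ / (h%:R * _)]ger0_norm // -sqrtr_sqr -sqrtrM ?sigma2_ge0 //; congr Num.sqrt.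
  by rewrite /sigma2 -/t -/u -/N; field; rewrite !gt_eqF.
have ha : a%:R / (totient a)%:R <= Qq by apply: totratio_le => //; case/and3P: dq.
have hb : b%:R / (totient b)%:R <= Qq by apply: totratio_le => //; case/and3P: dq.
have hab : (a%:R / (totient a)%:R) * (b%:R / (totient b)%:R) <= Qq ^+ 2.
  by rewrite expr2 ler_pM // divr_ge0 // ltW.
have := amgm_sqrt (sigma2_ge0 a b s); set S := Num.sqrt _; set V := _ / 2 => SV.
have S0 : 0 <= S := sqrtr_ge0 _.
have V0 : 0 <= V := le_trans S0 SV.
have -> : L%:R^-1 * (S * (a%:R * b%:R / (h%:R * t%:R))) *
   (h%:R ^+ 2 / ((totient a)%:R * (totient b)%:R)) * (c * Qq) ^+ m
  = c ^+ m * h%:R * Qq ^+ m * (t * L)%:R^-1 * (((a%:R / (totient a)%:R) * (b%:R / (totient b)%:R)) * S).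
  by rewrite exprMn natrM; field; rewrite !gt_eqF.
have -> : c ^+ m * h%:R * Qq ^+ m.+2 * ((t * L)%:R^-1 * V)
  = c ^+ m * h%:R * Qq ^+ m * (t * L)%:R^-1 * (Qq ^+ 2 * V).
  by rewrite -addn2 exprD; ring.
apply: ler_wpM2l; first by rewrite !mulr_ge0 ?exprn_ge0 ?invr_ge0.
by apply: ler_pM => //; rewrite mulr_ge0 // divr_ge0 // ltW.
Qed.

(** The first term comes from [cnt2_case1], when [eta gcd(a, b) >= 1]. The second, with
    [18 = 3 * 6], comes from counting pairs when [t <= eta a] or [t <= eta b]; there a factor
    [1/gcd(a, b)] is replaced by [1/D]. *)
Definition sig_large : R := 36 * h%:R ^+ 2 * eta ^+ 3 + 18 * h%:R ^+ 2 * eta ^+ 2 / D.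

(** Combines [cnt2_pairs] with the identity [a b = d u t], where [d] is the gcd of [a] and [b]. *)
Lemma sigma2_reduced a b s : good q [:: a, b & s] -> eta * (gcdn a b)%:R <= 1 ->
  sigma2 a b s <= 3 * h%:R ^+ 2 *
   ((pairsP (gcdn (lcmn a b) (lcms s)) a b)%:R * (tpart a b s)%:R / ((gcdn a b)%:R * (a%:R * b%:R))).
Proof.
move=> gd hd; have [a0 b0 L0] := good_nat_gt0 gd; set t := tpart a b s => t0.
have /and3P[sq dq ad] := gd; have adm : admissible [:: a, b & s] by apply/(admissibleP sq).
have aq : (a %| q)%N by case/and3P: dq.
have := congr1 (fun n => n%:R : R) (pair_mul adm sq); rewrite /= !natrM => E.
rewrite /sigma2 -/t; set u := gcdn (lcmn a b) _.
move: E; rewrite -/(tpart a b s) -/t -/u => E.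
have := cnt2_pairs D eta0 u aq hd; set N := cnt2 _ _ _ _ _ => hN.
set d := gcdn a b; have d0 : (0 < d)%N by rewrite gcdn_gt0 a0.
rewrite -/d in E.
have A0 : 0 < a%:R :> R by rewrite ltr0n.
have B0 : 0 < b%:R :> R by rewrite ltr0n.
have DD0 : 0 < d%:R :> R by rewrite ltr0n.
have u0 : (0 < u)%N by rewrite gcdn_gt0 lcmn_gt0 a0 b0.
have U0 : 0 < u%:R :> R by rewrite ltr0n.
have T0 : 0 < t%:R :> R by rewrite ltr0n.
rewrite {1}E.
have -> : h%:R ^+ 2 * t%:R ^+ 2 * u%:R * N / (d%:R * u%:R * t%:R) ^+ 2
  = h%:R ^+ 2 * t%:R * N / (d%:R * (d%:R * u%:R * t%:R)) by field; rewrite !gt_eqF.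
rewrite E.
have -> : 3 * h%:R ^+ 2 * ((pairsP u a b)%:R * t%:R / (d%:R * (d%:R * u%:R * t%:R)))
 = h%:R ^+ 2 * t%:R * (3 * (pairsP u a b)%:R) / (d%:R * (d%:R * u%:R * t%:R)) :> R by ring.
by rewrite ler_wpM2r ?invr_ge0 ?mulr_ge0 // ler_wpM2l ?mulr_ge0 ?sqr_ge0.
Qed.

Lemma sigma2_I a b s : good q [:: a, b & s] ->
  (1 <= eta * (gcdn a b)%:R) || ((tpart a b s)%:R <= eta * a%:R)
     || ((tpart a b s)%:R <= eta * b%:R) ->
  sigma2 a b s <= sig_large.
Proof.
move=> gd hyp; have [a0 b0 L0 t0] := good_nat_gt0 gd.
have /and3P[sq dq ad] := gd; have adm : admissible [:: a, b & s] by apply/(admissibleP sq).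
have aq : (a %| q)%N by case/and3P: dq.
have bq : (b %| q)%N by case/and3P: dq.
have e0 := ltW eta0; have x1 : 0 <= 36 * h%:R ^+ 2 * eta ^+ 3 by rewrite !mulr_ge0 ?exprn_ge0.
have x2 : 0 <= 18 * h%:R ^+ 2 * eta ^+ 2 / D.
  by rewrite divr_ge0 ?(ltW D0) // !mulr_ge0 ?exprn_ge0.
set d := gcdn a b; have d0 : (0 < d)%N by rewrite gcdn_gt0 a0.
have E := congr1 (fun n => n%:R : R) (pair_mul adm sq); rewrite /= !natrM in E.
have A0 : 0 < a%:R :> R by rewrite ltr0n.
have B0 : 0 < b%:R :> R by rewrite ltr0n.
have DD0 : 0 < d%:R :> R by rewrite ltr0n.
set t := tpart a b s; set u := gcdn (lcmn a b) (lcms s).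
rewrite -/(tpart a b s) -/t -/u -/d in E.
have u0 : (0 < u)%N by rewrite gcdn_gt0 lcmn_gt0 a0 b0.
have U0 : 0 < u%:R :> R by rewrite ltr0n.
have T0 : 0 < t%:R :> R by rewrite ltr0n.
have uq : (u %| q)%N.
  by apply: dvdn_trans (dvdn_gcdl _ _) _; rewrite dvdn_lcm aq.
case: (lerP 1 (eta * d%:R)) => hd.
  apply: le_trans (_ : 36 * h%:R ^+ 2 * eta ^+ 3 <= _); last by rewrite lerDl.
  rewrite /sigma2 -/t -/u E; apply: le_trans (_ : h%:R ^+ 2 * t%:R ^+ 2 * u%:R *
     (36 * eta ^+ 3 * d%:R ^+ 2 * u%:R) / (d%:R * u%:R * t%:R) ^+ 2 <= _).
    rewrite ler_wpM2r ?invr_ge0 ?sqr_ge0 // ler_wpM2l ?mulr_ge0 ?sqr_ge0 //.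
    exact: cnt2_case1.
  by rewrite le_eqVlt; apply/orP; left; apply/eqP; field; rewrite !gt_eqF.
apply: le_trans (_ : 18 * h%:R ^+ 2 * eta ^+ 2 / D <= _); last by rewrite lerDr.
apply: le_trans (sigma2_reduced gd (ltW hd)) _; rewrite -/t -/u -/d.
(* If a pair exists, its orders are [a] and [b], and closeness gives [D <= d]; otherwise the left
   side vanishes. *)
have [->|pn] := posnP (pairsP u a b); first by rewrite !mul0r mulr0.
have Dd : D <= d%:R.
  have /card_gt0P[w] := pn; rewrite !inE.
  by case/and4P => /and5P[_ _ _ _ /andP[_ Dg]] /eqP e1 /eqP e2 _; rewrite e1 e2 in Dg.
(* By [pairs_le] and [gcd(u, x) t <= x], the product of [t] and [2 eta gcd(u, x) + 1] is at most
   [3 eta x] as soon as [t <= eta x]; with the factor [2 eta y] this gives the constant 6. General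
   [x], [y] allow the roles of [a] and [b] to be exchanged. *)
have bound x y : (t%:R <= eta * x%:R :> R) -> (0 < x)%N -> (t %| x)%N -> (x %| q)%N -> (y %| q)%N ->
    (pairsP u x y)%:R * t%:R <= 6 * eta ^+ 2 * (x%:R * y%:R).
  move=> tx x0 tdx xq yq.
  have := pair_gcd_u adm sq tdx; rewrite -/(tpart a b s) -/t -/u => /(dvdn_leq x0).
  rewrite -(ler_nat R) natrM => gx.
  have h1 := pairs_le D eta0 u xq yq.
  apply: le_trans (ler_wpM2r (ltW T0) h1) _.
  have : 2 * eta * y%:R * (2 * eta * ((gcdn u x)%:R * t%:R) + t%:R) <= 2 * eta * y%:R * (3 * eta * x%:R).
    rewrite ler_wpM2l ?mulr_ge0 //; have := ler_wpM2l e0 gx; move: tx; lra.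
  by move=> h2; lra.
have [rab rba] := reduced_mul a b s; rewrite -/t in rab rba.
have pb : (pairsP u a b)%:R * t%:R <= 6 * eta ^+ 2 * (a%:R * b%:R).
  have ta : (t %| a)%N by rewrite -rab dvdn_mulr.
  have tb : (t %| b)%N by rewrite -rba dvdn_mulr.
  case/orP: hyp => [/orP[]|] hh; first by move: hd; rewrite ltNge -/d hh.
    exact: bound.
  by rewrite pairsC (mulrC a%:R); apply: bound.
apply: le_trans (_ : 3 * h%:R ^+ 2 * (6 * eta ^+ 2 * (a%:R * b%:R) / (d%:R * (a%:R * b%:R))) <= _).
  by rewrite ler_wpM2l ?mulr_ge0 ?sqr_ge0 // ler_wpM2r // invr_ge0 !mulr_ge0.
have -> : 3 * h%:R ^+ 2 * (6 * eta ^+ 2 * (a%:R * b%:R) / (d%:R * (a%:R * b%:R)))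
  = 18 * h%:R ^+ 2 * eta ^+ 2 / d%:R by field; rewrite !gt_eqF.
rewrite ler_wpM2l ?mulr_ge0 ?sqr_ge0 // lef_pV2 ?posrE //.
Qed.

End PairBound.

Lemma pow2_split n : (2 ^ n - 1 = n + (2 ^ n - n - 1))%N.
Proof. by have := ltn_expl n (ltnSn 1); lia. Qed.

Section PairBound2.
Variables (R : rcfType) (q' m : nat).
Notation q := q'.+1.
Notation A := 'I_q'.+1.
Notation Qq := (totratio R q).
Variables (g : A -> R) (c : R) (h : nat) (eta D Hb Db lam : R).
Hypotheses (tg : tame (c, g)) (gh : forall x, g x * (totient (ordA x))%:R <= h%:R).
Hypotheses (eta0 : 0 < eta) (D0 : 0 < D) (etah : 1 <= eta * h%:R) (lam0 : 0 < lam).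
Hypothesis Hdiv : forall n, (0 < n)%N -> (n <= 2 * h ^ 2)%N -> (2 ^ size (primes n))%:R <= Db.
Hypothesis Hharm : \sum_(i < h.+1 | (0 < i)%N) i%:R^-1 <= Hb.

Notation P := (@close R q' eta D).
Notation pairsP := (pairs q' eta D).
Notation sig_large := (sig_large h eta D).
Notation sigma2 := (@sigma2 R q' h eta D).

(** The constant is [3 * 4], from [sigma2_reduced] and [t_average]. *)
Definition sig_small : R := 12 * h%:R ^+ 2 * eta ^+ 2 / D * Hb ^+ 2 * Db.

Let TT (s : seq nat) : R := if s is a :: b :: s' then Tsum m g P a b s' else 0.

Let small (s : seq nat) : bool :=
  if s is a :: b :: s' then [&& eta * (gcdn a b)%:R < 1,
    eta * a%:R < (tpart a b s')%:R & eta * b%:R < (tpart a b s')%:R] else false.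

Let FF (s : seq nat) : R :=
  if s is a :: b :: s' then (lcms s)%:R^-1 * ((lam * sigma2 a b s' + lam^-1) / 2) else 0.

Let GG (s : seq nat) (t : nat) : R :=
  if s is a :: b :: s' then (lcms s)%:R^-1 *
    ((lam * (3 * h%:R ^+ 2 / (a%:R * b%:R * (gcdn a b)%:R) *
       ((pairsP (lcmn a b) (t * a)%N (t * b)%N)%:R / t%:R ^+ 3)) + lam^-1 * t%:R^-1) / 2) else 0.

Let red (s : seq nat) : bool :=
  if s is a :: b :: s' then (eta * a%:R < 1) && (eta * b%:R < 1) else false.

Let h0 : (0 < h)%N.
Proof. by rewrite lt0n; apply: contraTneq etah => ->; rewrite mulr0 ler10. Qed.

Let H0 : 0 < h%:R :> R. Proof. by rewrite ltr0n. Qed.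

Let Hb0 : 0 <= Hb.
Proof. by apply: le_trans Hharm; apply: sumr_ge0 => i _; rewrite invr_ge0. Qed.

Let Db0 : 0 <= Db.
Proof. by apply: le_trans (Hdiv (ltn0Sn 0) _); rewrite // muln_gt0 expn_gt0 h0. Qed.

Let sig_large_ge0 : 0 <= sig_large.
Proof.
by rewrite addr_ge0 ?divr_ge0 ?(ltW D0) // !mulr_ge0 ?exprn_ge0 // ltW.
Qed.

(** The code of a tuple is its reduced form together with [t]. The quotients stay at most [q], and
    [tpart_small] bounds [t] by [h] for small tuples, so [inord] changes no value there. *)
Let cd (r : m.+2.-tuple 'I_q.+1) : m.+2.-tuple 'I_q.+1 * 'I_h.+1 :=
  let a := tnth r ord0 in let b := tnth r (ord1' m) in
  let s := behead (behead r) in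
  let t := tpart a b (map val s) in
  ([tuple of inord (a %/ t) :: [tuple of inord (b %/ t) :: [tuple of behead [tuple of behead r]]]],
   inord t).

Lemma tpart_small a b s : good q [:: a, b & s] -> eta * (gcdn a b)%:R < 1 -> (tpart a b s < h.+1)%N.
Proof.
move=> gd hd; rewrite ltnS; apply: leq_trans (tpart_le gd) _.
rewrite -(ler_nat R); have := lt_le_trans hd etah; rewrite ltr_pM2l //; exact: ltW.
Qed.

(* Write [a = t a'], [b = t b'] with [t = tpart a b s] and let [t] range over all
   squarefree integers up to [h] for each fixed [(a', b', s)]. *)
Lemma small_sum :
  \sum_(r : m.+2.-tuple 'I_q.+1 | good q (map val r) && small (map val r)) FF (map val r)
  <= \sum_(w : m.+2.-tuple 'I_q.+1 * 'I_h.+1 |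
        (good q (map val w.1) && red (map val w.1)) && sqfree w.2) GG (map val w.1) w.2.
Proof.
have cdE (a b : 'I_q.+1) (r : m.-tuple 'I_q.+1) :
    good q [:: val a, val b & map val r] -> eta * (gcdn a b)%:R < 1 ->
    let t := tpart a b (map val r) in
    map val (cd [tuple of a :: [tuple of b :: r]]).1 = [:: (a %/ t)%N, (b %/ t)%N & map val r]
    /\ (cd [tuple of a :: [tuple of b :: r]]).2 = t :> nat.
  move=> gd hd t; split; last by rewrite /= inordK // (tpart_small gd hd).
  rewrite /cd /=; congr [:: _, _ & _].
    by rewrite inordK //; apply: leq_ltn_trans (leq_div _ _) (ltn_ord a).
  by rewrite inordK //; apply: leq_ltn_trans (leq_div _ _) (ltn_ord b).
apply: (@ler_sum_inj _ _ _ _ _ cd).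
- move=> r r'; case/tupleP: r => a r; case/tupleP: r => b r.
  case/tupleP: r' => a' r'; case/tupleP: r' => b' r'.
  move=> /andP[gd /and3P[hd _ _]] /andP[gd' /and3P[hd' _ _]] e.
  have [e1 e2] := cdE _ _ _ gd hd; have [e1' e2'] := cdE _ _ _ gd' hd'.
  move: e1 e2; rewrite e e1' e2' => -[qa qb qr] qt.
  have [ra rb] := reduced_mul a b (map val r); have [ra' rb'] := reduced_mul a' b' (map val r').
  have ea : a = a' by apply/ord_inj; rewrite -ra -ra' -qa -qt.
  have eb : b = b' by apply/ord_inj; rewrite -rb -rb' -qb -qt.
  have er : r = r' by apply/val_inj/(inj_map val_inj).
  by rewrite ea eb er.
- move=> r; case/tupleP: r => a r; case/tupleP: r => b r /andP[gd /and3P[hd ha hb]].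
  have {}gd : good q [:: val a, val b & map val r] := gd.
  have [e1 e2] := cdE _ _ _ gd hd; rewrite e1 e2 (reduced_good gd) (tpart_sqfree gd) /= andbT.
  have [ra rb] := reduced_mul a b (map val r); set t := tpart _ _ _ in ra rb ha hb *.
  have [_ _ _ t0] := good_nat_gt0 gd.
  have T0 : 0 < t%:R :> R by rewrite ltr0n.
  have k x p : (t * p)%N = x -> eta * x%:R < t%:R -> eta * p%:R < 1.
    by move=> <-; rewrite natrM mulrCA gtr_pMr.
  by rewrite (k _ _ ra ha) (k _ _ rb hb).
- move=> r; case/tupleP: r => a r; case/tupleP: r => b r /andP[gd /and3P[hd ha hb]].
  have {}gd : good q [:: val a, val b & map val r] := gd.
  have [e1 e2] := cdE _ _ _ gd hd; rewrite e1 e2.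
  rewrite -[map val _]/[:: val a, val b & map val r] /FF /GG; set s := map val r.
  have /and3P[sq dq ad] := gd; have adm : admissible [:: val a, val b & s] by apply/(admissibleP sq).
  rewrite (pair_lcms adm sq) (reduced_lcms gd) (reduced_lcm gd) -/(tpart a b s).
  have [ra rb] := reduced_mul a b s; rewrite ra rb.
  have rg := reduced_gcd a b s.
  have [a0 b0 L0 t0] := good_nat_gt0 gd.
  have ub := sigma2_reduced h D eta0 gd (ltW hd).
  set t := tpart a b s in ub ra rb rg t0 *; set u := gcdn (lcmn a b) _ in ub *.
  set p1 := (a %/ t)%N in ra rg *; set p2 := (b %/ t)%N in rb rg *; set e := gcdn p1 p2 in rg *.
  have T0 : 0 < t%:R :> R by rewrite ltr0n.
  have p10 : 0 < p1%:R :> R by rewrite ltr0n; have : (0 < t * p1)%N; [rewrite ra | rewrite muln_gt0 => /andP[]].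
  have p20 : 0 < p2%:R :> R by rewrite ltr0n; have : (0 < t * p2)%N; [rewrite rb | rewrite muln_gt0 => /andP[]].
  have e0 : 0 < e%:R :> R by rewrite ltr0n gcdn_gt0 -(ltr0n R) p10.
  have L0' : 0 < (lcms s)%:R :> R by rewrite ltr0n.
  have Ea : a%:R = t%:R * p1%:R :> R by rewrite -natrM ra.
  have Eb : b%:R = t%:R * p2%:R :> R by rewrite -natrM rb.
  have Ed : (gcdn a b)%:R = t%:R * e%:R :> R by rewrite -natrM rg.
  rewrite Ed Ea Eb in ub.
  rewrite natrM invfM -[leLHS]mulrA [leLHS]mulrCA ler_wpM2l ?invr_ge0 ?(ltW L0') //.
  rewrite [leLHS]mulrA ler_wpM2r ?invr_ge0 // mulrDr [t%:R^-1 * lam^-1]mulrC lerD2r [leLHS]mulrCA.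
  rewrite ler_wpM2l ?(ltW lam0) //.
  apply: le_trans (ler_wpM2l _ ub) _; first by rewrite invr_ge0 ltW.
  by rewrite le_eqVlt; apply/orP; left; apply/eqP; field; rewrite !gt_eqF.
- move=> [w t] _ /=; rewrite /GG; case: (map val w) => [|a [|b s]] //.
  rewrite mulr_ge0 ?invr_ge0 // divr_ge0 // addr_ge0 ?mulr_ge0 ?invr_ge0 ?exprn_ge0 ?(ltW lam0) //; rewrite !mulr_ge0.
Qed.

Theorem pair_bound :
  \sum_a \sum_b (P a b)%:R * (g a * g b) * nconv (nseq m g) (- (a + b)) <=
  c ^+ m * h%:R * Qq ^+ (2 ^ m.+2 - 1) *
   ((lam * sig_large + lam^-1) / 2 + (lam * sig_small + lam^-1 * Hb) / 2).
Proof.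
have [/= c0 _ _ _] := tg; have Q0 := Qq_ge0 R q'.
set B1 := (lam * sig_large + lam^-1) / 2; set B3 := (lam * sig_small + _) / 2.
have l0 := ltW lam0; have li0 : 0 <= lam^-1 by rewrite invr_ge0.
have B10 : 0 <= B1 by rewrite divr_ge0 // addr_ge0 // mulr_ge0 // sig_large_ge0.
have sig_small0 : 0 <= sig_small.
  by rewrite !mulr_ge0 ?exprn_ge0 ?invr_ge0 ?(ltW D0) ?(ltW eta0) ?Hb0 ?Db0.
have B30 : 0 <= B3 by rewrite divr_ge0 // addr_ge0 // mulr_ge0 // Hb0.
set C0 := c ^+ m * h%:R * Qq ^+ m.+2.
have C00 : 0 <= C0.
  rewrite /C0 mulr_ge0 ?(mulr_ge0 (exprn_ge0 _ c0) (ler0n _ _)) //; exact: exprn_ge0.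
rewrite pair_sum_orders.
have -> : \sum_(r1 < q.+1) \sum_(r2 < q.+1) \sum_(r : m.-tuple 'I_q.+1) Tsum m g P r1 r2 (map val r)
   = \sum_(r : m.+2.-tuple 'I_q.+1) TT (map val r).
  by rewrite [RHS]sum_tuple_cons; apply: eq_bigr => a _; rewrite sum_tuple_cons.
(* Every good tuple is charged [B1], which suffices where [sigma2_I] applies. The small tuples are
   charged [FF] in addition and are averaged over [t] afterwards. *)
apply: (@le_trans _ _ (C0 * (\sum_(r : m.+2.-tuple 'I_q.+1 | good q (map val r)) (lcms (map val r))%:R^-1 * B1
   + \sum_(r : m.+2.-tuple 'I_q.+1 | good q (map val r) && small (map val r)) FF (map val r)))).
  rewrite [X in _ * (_ + X)]big_mkcondr /= -big_split /= mulr_sumr [leRHS]big_mkcond; apply: ler_sum => r _.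
  case/tupleP: r => a r; case/tupleP: r => b r.
  rewrite -[map val _]/[:: val a, val b & map val r].
  have sz : size (map val r) = m by rewrite size_map size_tuple.
  case: (boolP (good q _)) => [gd|ng]; last exact: (Tsum_bad P tg sz ng).
  have hT := Tsum_sigma2 D tg gh etah lam0 sz gd.
  apply: le_trans hT _; rewrite -/C0 ler_wpM2l //.
  case: (boolP (small _)) => [_|ns]; last first.
    rewrite addr0 ler_wpM2l ?invr_ge0 // /B1 ler_wpM2r ?invr_ge0 // lerD2r ler_wpM2l //.
    apply: (sigma2_I h eta0 D0 gd); move: ns; rewrite /small !negb_and -!leNgt.
    by case/or3P=> ->; rewrite ?orbT.
  by rewrite lerDr mulr_ge0 ?invr_ge0.
have qe : c ^+ m * h%:R * Qq ^+ (2 ^ m.+2 - 1) = C0 * Qq ^+ (2 ^ m.+2 - m.+2 - 1).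
  rewrite /C0 -[RHS]mulrA -exprD; congr (_ * Qq ^+ _).
  exact: pow2_split.
rewrite qe -mulrA ler_wpM2l // mulrDr; apply: lerD.
  by rewrite -mulr_suml ler_wpM2r // sum_good.
apply: le_trans small_sum _.
rewrite -(pair_big (fun w : m.+2.-tuple 'I_q.+1 => good q (map val w) && red (map val w))
   (fun t : 'I_h.+1 => sqfree t) (fun w t => GG (map val w) t)) /=.
apply: (@le_trans _ _ (\sum_(r : m.+2.-tuple 'I_q.+1 | good q (map val r)) (lcms (map val r))%:R^-1 * B3));
  last by rewrite -mulr_suml ler_wpM2r // sum_good.
rewrite big_mkcondr; apply: ler_sum => r.
case/tupleP: r => a r; case/tupleP: r => b r; rewrite -[map val _]/[:: val a, val b & map val r] => gd.
have [a0 b0 L0 t0] := good_nat_gt0 gd.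
case: ifP => [/andP[ha hb]|_]; last by rewrite mulr_ge0 ?invr_ge0.
rewrite /GG -mulr_sumr ler_wpM2l ?invr_ge0 // -mulr_suml /B3 ler_wpM2r ?invr_ge0 //.
rewrite big_split /= -!mulr_sumr; apply: lerD; rewrite ler_wpM2l //.
  have := t_average q' eta0 D0 etah Hdiv Hharm a0 b0 ha hb.
  have A0 : 0 < a%:R :> R by rewrite ltr0n.
  have Bb0 : 0 < b%:R :> R by rewrite ltr0n.
  have G0 : 0 < (gcdn a b)%:R :> R by rewrite ltr0n gcdn_gt0 a0.
  set K := 3 * h%:R ^+ 2 / _ => hK.
  have K0 : 0 <= K by rewrite divr_ge0 ?mulr_ge0 ?sqr_ge0 // ltW.
  apply: le_trans (ler_wpM2l K0 hK) _.
  rewrite le_eqVlt; apply/orP; left; apply/eqP; rewrite /K /sig_small.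
  by field; rewrite !gt_eqF.
(* The factor [1/t] split off from the inverse lcm makes the [lam^-1] terms a harmonic sum. *)
apply: le_trans Hharm; rewrite big_mkcond [leRHS]big_mkcond; apply: ler_sum => t _.
by case: (boolP (sqfree t)) => [/sqfree_gt0 ->|_] //; case: ifP => //; rewrite invr_ge0.
Qed.

End PairBound2.

(** * One step of the recursion *)

Lemma leq_expn2_pred m : (2 + (2 ^ m - 1) <= 2 ^ m.+2 - 1)%N.
Proof.
have : (0 < 2 ^ m)%N by rewrite expn_gt0.
by rewrite (expnD 2 2 m : 2 ^ m.+2 = _)%N; move: (2 ^ m)%N => z; lia.
Qed.

Lemma exponent_budget1 m : (36 + 5 <= 35 * m.+2)%N. Proof. lia. Qed.
Lemma exponent_budget2 m : (5 <= 35 * m.+2)%N. Proof. lia. Qed.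
Lemma exponent_budget3 m : (10 + 35 * m.+1 <= 35 * m.+2)%N. Proof. lia. Qed.

(** The two bounds on [g] add up to [B = 1 + 3/2 = 5/2] for [tame_decay] with [c = 1/h], and
    [2 (5/2)^2 <= 4^2]. *)
Lemma tame_weight (R : rcfType) (q' h : nat) (g : 'I_q'.+1 -> R) : (0 < h)%N ->
  (forall x, 0 <= g x) -> g 0 = 0 -> (forall x, g x != 0 -> sqfree (ordA x)) ->
  (forall x, g x * (totient (ordA x))%:R <= h%:R) ->
  (forall x, g x * (totient (ordA x))%:R * (nrm x)%:R <= 3 / 2 * q'.+1%:R) ->
  tame (4 * Num.sqrt h%:R, g).
Proof.
move=> h0 g0 gz gsq gh gn; have H0 : 0 < h%:R :> R by rewrite ltr0n.
apply: (@tame_le _ _ (Num.sqrt (2 * (5 / 2) ^+ 2 / h%:R^-1))).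
  rewrite -[4]ger0_norm // -sqrtr_sqr -sqrtrM ?sqr_ge0 // ler_wsqrtr // invrK ler_wpM2r ?(ltW H0) //; lra.
have b52 : 0 <= 5 / 2 :> R by lra.
have hi : 0 < h%:R^-1 :> R by rewrite invr_gt0.
apply: (tame_decay b52 hi) => // x.
rewrite mulrDr (_ : 5 / 2 = 1 + 3 / 2); last by lra.
apply: lerD; first by rewrite ler_pdivrMr // mul1r.
by rewrite mulrA ler_pdivrMr ?ltr0n.
Qed.


Section Step.
Local Open Scope complex_scope.
Variables (R : rcfType) (q' m : nat).
Notation q := q'.+1.
Notation A := 'I_q'.+1.
Notation Qq := (totratio R q).
Variables (f : A -> R[i]) (g : A -> R) (h : nat) (w Ch Cd : R).
Hypotheses (fg : forall x, `|f x| = (g x)%:C) (g0 : forall x, 0 <= g x) (gz : g 0 = 0).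
Hypothesis gsq : forall x, g x != 0 -> sqfree (ordA x).
Hypothesis gh : forall x, g x * (totient (ordA x))%:R <= h%:R.
Hypothesis gn : forall x, g x * (totient (ordA x))%:R * (nrm x)%:R <= 3 / 2 * q%:R.
Hypotheses (w1 : 1 <= w) (wh : w ^+ (35 * m.+2) = h%:R).
Hypothesis Hdiv : forall n, (0 < n)%N -> (n <= 2 * h ^ 2)%N -> (2 ^ size (primes n))%:R <= Cd * w ^+ 2.
Hypothesis Hharm : \sum_(i < h.+1 | (0 < i)%N) i%:R^-1 <= Ch * w.

Let w0 : 0 < w. Proof. exact: lt_le_trans w1. Qed.
Let H0 : 0 < h%:R :> R. Proof. by rewrite -wh exprn_gt0. Qed.
(* [w = h ^ (1 / (35 k))] with [k = m + 2]; the cutoff for small fractions is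
   [eta], the lower bound on the gcd of the first two orders is
   [D = h ^ (1 / k)], and the saving is [w ^- 5 = h ^ (- 1 / (7 k))]. *)
Let eta := w ^+ 10 / h%:R.
Let D := w ^+ 35.
Let eta0 : 0 < eta. Proof. by rewrite divr_gt0 ?exprn_gt0. Qed.
Let far (x : A) := ~~ near eta x.
Let c : R := 4 * Num.sqrt h%:R.
Let c' : R := 5 * Num.sqrt h%:R * w ^- 5.

Let sqh : Num.sqrt h%:R ^+ 2 = h%:R :> R. Proof. by rewrite sqr_sqrtr // ltW. Qed.

Let tg : tame (c, g).
Proof. by apply: tame_weight => //; rewrite -(ltr0n R). Qed.

(** On far elements [nrm x / q] exceeds [eta], so both halves of the decay condition are bounded by
    3/2 and [B = 3]. The cost is [sqrt (18/eta)], and [18 <= 5^2]. *)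
Let tfar : tame (c', fun a => (far a)%:R * g a).
Proof.
apply: (@tame_le _ _ (Num.sqrt (2 * 3 ^+ 2 / eta))).
  have c0 : 0 <= c' by rewrite !mulr_ge0 ?sqrtr_ge0 ?invr_ge0 ?exprn_ge0 // ltW.
  rewrite -[c']ger0_norm // -sqrtr_sqr ler_wsqrtr // /c' /eta !exprMn sqh invf_div.
  have -> : (w ^- 5) ^+ 2 = (w ^+ 10)^-1 by rewrite -exprVn -exprM -exprVn.
  rewrite -[leRHS]mulrA ler_wpM2r //; last by lra.
  by rewrite mulr_ge0 ?invr_ge0 ?exprn_ge0 // ltW.
apply: (tame_decay (ler0n _ 3) eta0) => [x|x||].
- by rewrite mulr_ge0.
- by rewrite mulf_eq0 negb_or => /andP[_]; apply: gsq.
- by rewrite gz mulr0.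
- move=> x; rewrite /far /near; case: (lerP (nrm x)%:R (eta * q%:R)) => /= hx; first by rewrite !mul0r.
  rewrite mul1r mulrDr (_ : 3 = 3 / 2 + 3 / 2); last by lra.
  set G := g x * _; have G0 : 0 <= G by rewrite mulr_ge0.
  have G2 : G * ((nrm x)%:R / q%:R) <= 3 / 2 by rewrite mulrA ler_pdivrMr ?ltr0n // gn.
  apply: lerD => //; apply: le_trans G2; rewrite ler_wpM2l // ler_pdivlMr ?ltr0n //.
  exact: ltW.
Qed.

(** Since [nrm x >= q/r] for [x] nonzero of order [r], the decay of [g] leaves at most
    [(3/2) r/phi(r)], a bound free of [h]. *)
Let gM x : g x <= 3 / 2 * Qq.
Proof.
have p32 : 0 <= 3 / 2 :> R by lra.
have [->|x0] := eqVneq x 0; first by rewrite gz mulr_ge0 // Qq_ge0.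
have n0 : 0 < (nrm x)%:R :> R by rewrite ltr0n lt0n nrm_eq0.
have ph : 0 < (totient (ordA x))%:R :> R by rewrite ltr0n totient_gt0 ordA_gt0.
have hQ : (ordA x)%:R / (totient (ordA x))%:R <= Qq by apply: totratio_le => //; apply: ordA_dvdn.
apply: le_trans (_ : 3 / 2 * ((ordA x)%:R / (totient (ordA x))%:R) <= _); last by rewrite ler_wpM2l.
rewrite mulrA ler_pdivlMr // -(ler_pM2r n0); apply: le_trans (gn x) _.
by rewrite -[leRHS]mulrA ler_wpM2l // -natrM ler_nat ler_nrm_ordA.
Qed.

Let D0 : 0 < D. Proof. by rewrite exprn_gt0. Qed.
Let etah : 1 <= eta * h%:R. Proof. by rewrite /eta divfK ?gt_eqF // exprn_ege1. Qed.

(** A near nonzero entry has order at least [1/eta], so [gcd_large] provides a gcd whose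
    [(m + 1)]-th power is at least [h w^-10]. This is at least [D^(m + 1)] because
    [10 + 35 (m + 1) <= 35 (m + 2)]. The sum [x_0 + x_j] is nonzero because [opps x = 0]. *)
Let cover (x : m.+2.-tuple A) : \sum_i tnth x i = 0 -> \prod_i g (tnth x i) != 0 ->
  opps x = 0%N -> (exists i, far (tnth x i)) \/
     exists2 j, j != ord0 & close eta D (tnth x ord0) (tnth x j).
Proof.
move=> s0 pn J0; case: (boolP [exists i, far (tnth x i)]) => [/existsP ?|]; first by left.
rewrite negb_exists => /forallP nf; right.
have gi i : g (tnth x i) != 0 by move: pn => /prodf_neq0; apply.
have xi i : tnth x i != 0 by apply: contraNneq (gi i) => ->; rewrite gz.
have ni i : near eta (tnth x i) by have := nf i; rewrite negbK.
have [j j0 hj] := gcd_large (fun i => gsq (gi i)) s0.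
exists j => //; rewrite /close !ni !xi /=; apply/andP; split.
  rewrite addrC addr_eq0; apply/negP => e.
  have : (0 < opps x)%N by rewrite /opps (bigD1 j) //= e.
  by rewrite J0.
rewrite -(ler_pXn2r (_ : 0 < m.+1)%N) ?nnegrE ?(ltW D0) // -natrX.
apply: le_trans (_ : (ordA (tnth x ord0))%:R <= _); last by rewrite ler_nat.
have le1 : 1 <= eta * (ordA (tnth x ord0))%:R.
  rewrite -(ler_pM2r (_ : 0 < q%:R)) ?ltr0n // mul1r.
  apply: le_trans (_ : (ordA (tnth x ord0) * nrm (tnth x ord0))%:R <= _).
    by rewrite ler_nat ler_nrm_ordA.
  by rewrite natrM mulrAC [leRHS]mulrC ler_wpM2l //; apply: ni.
rewrite /D -(ler_pM2l eta0); apply: le_trans le1.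
rewrite /eta mulrAC ler_pdivrMr // mul1r -wh -!exprM -exprD.
by rewrite ler_weXn2l // exponent_budget3.
Qed.

(** The terms follow those of [recursion_bound], with [9/4 = (3/2)^2] from [gM] and 5 from [tfar].
    In the last one [55 = 36 + 18 + 1], from the two terms of [sig_large] and from [lam^-1]. *)
Definition step_const : R :=
  m.+1%:R ^+ 2 * (9 / 4 * 4 ^+ m) + m.+2%:R * (5 * 4 ^+ m.+1) +
  m.+1%:R * (4 ^+ m * ((55 + 12 * Ch ^+ 2 * Cd + Ch) / 2)).

Theorem step_bound :
  `|nconv (nseq m.+2 f) 0 - m.+1%:R * (nconv [:: f; f] 0 * nconv (nseq m f) 0)| <=
  (step_const * (Num.sqrt h%:R ^+ m.+2 * w ^- 5) * Qq ^+ (2 ^ m.+2 - 1))%:C.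
Proof.
apply: le_trans (recursion_bound g0 gM fg cover) _; rewrite lecR.
set r := Num.sqrt h%:R; have r0 : 0 < r by rewrite sqrtr_gt0.
have Q1 : 1 <= Qq by apply: totratio_ge1.
have Q0 : 0 <= Qq := le_trans ler01 Q1.
set X := r ^+ m.+2 * w ^- 5; set Y := Qq ^+ _.
have X0 : 0 <= X by rewrite mulr_ge0 ?invr_ge0 ?exprn_ge0 // ltW.
have Y0 : 0 <= Y by rewrite exprn_ge0.
have wpow n n' : (n <= n')%N -> w ^+ n <= w ^+ n' by move=> nn; rewrite ler_weXn2l.
(* Double cancellation removes two coordinates of size [sqrt h] at a cost free of [h]; the factor
   [h] saved is more than [w^5]. *)
have rX : r ^+ m <= X.
  rewrite /X ler_pdivlMr ?exprn_gt0 // -[m.+2]addn2 exprD ler_wpM2l ?exprn_ge0 ?(ltW r0) //.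
  by rewrite sqh -wh wpow // exponent_budget2.
have Y1 : Qq ^+ (2 + (2 ^ m - 1)) <= Y by rewrite /Y ler_weXn2l // leq_expn2_pred.
have I1 : (3 / 2 * Qq) ^+ 2 * nconv (nseq m g) 0 <= 9 / 4 * 4 ^+ m * (X * Y).
  have := nconv_nseq_bound m tg; rewrite /c exprMn -/r => hT.
  apply: le_trans (ler_wpM2l (sqr_ge0 _) hT) _.
  have -> : (3 / 2 * Qq) ^+ 2 * (4 ^+ m * r ^+ m * Qq ^+ (2 ^ m - 1))
    = 9 / 4 * 4 ^+ m * (r ^+ m * Qq ^+ (2 + (2 ^ m - 1))) by rewrite exprD; field.
  apply: ler_wpM2l; first by rewrite mulr_ge0 ?exprn_ge0 //; lra.
  by apply: ler_pM => //; rewrite exprn_ge0 // ltW.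
have I2 : nconv ((fun a => (far a)%:R * g a) :: nseq m.+1 g) 0 <= 5 * 4 ^+ m.+1 * (X * Y).
  apply: le_trans (nconv_cons_bound m.+1 tg tfar) _; rewrite -/Y /c /c' exprMn -/r.
  by rewrite le_eqVlt; apply/orP; left; apply/eqP; rewrite /X [r ^+ m.+2]exprS; ring.
have nz n : w ^+ n != 0 by rewrite expf_neq0 // gt_eqF.
(* The choice [lam = w^6]: it makes [lam^-1] times the harmonic bound [Ch w] equal to [Ch w^-5], and
   [lam * sig_small] has exponent [6 + 20 - 35 + 2 + 2 = -5]. *)
have l0 : 0 < w ^+ 6 by rewrite exprn_gt0.
have e1 : w ^+ 6 * sig_large h eta D = 36 * (w ^+ 36 / h%:R) + 18 * (w ^- 9).
  by rewrite /sig_large /eta /D; field; rewrite !gt_eqF.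
have e3 : w ^+ 6 * sig_small h eta D (Ch * w) (Cd * w ^+ 2) = 12 * Ch ^+ 2 * Cd * w ^- 5.
  by rewrite /sig_small /eta /D; field; rewrite !gt_eqF.
have e4 : (w ^+ 6)^-1 * (Ch * w) = Ch * w ^- 5 by field; rewrite gt_eqF.
have b n : (5 <= n)%N -> w ^- n <= w ^- 5.
  by move=> n5; rewrite lef_pV2 ?posrE ?exprn_gt0 // wpow.
have b1 : w ^+ 36 / h%:R <= w ^- 5.
  rewrite ler_pdivrMr // mulrC ler_pdivlMr ?exprn_gt0 // -exprD -wh wpow //.
  exact: exponent_budget1.
have b2 := b 9 isT; have b3 := b 6 isT.
have I3 : \sum_a \sum_b (close eta D a b)%:R * (g a * g b) * nconv (nseq m g) (- (a + b))
    <= 4 ^+ m * ((55 + 12 * Ch ^+ 2 * Cd + Ch) / 2) * (X * Y).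
  apply: le_trans (pair_bound m tg gh eta0 D0 etah l0 Hdiv Hharm) _.
  rewrite -/Y e1 e3 e4; set B := _ / 2 + _ / 2.
  have hB : B <= (55 + 12 * Ch ^+ 2 * Cd + Ch) / 2 * w ^- 5.
    rewrite /B; set u := w ^- 5 in b1 b2 b3 *; lra.
  have -> : c ^+ m * h%:R * Y * B = 4 ^+ m * r ^+ m.+2 * Y * B.
    by rewrite /c exprMn -/r -[in LHS]sqh -/r -[m.+2]addn2 exprD; ring.
  have -> : 4 ^+ m * ((55 + 12 * Ch ^+ 2 * Cd + Ch) / 2) * (X * Y)
     = 4 ^+ m * r ^+ m.+2 * Y * ((55 + 12 * Ch ^+ 2 * Cd + Ch) / 2 * w ^- 5).
    by rewrite /X; ring.
  by rewrite ler_wpM2l // mulr_ge0 // mulr_ge0 // exprn_ge0 // ltW.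
rewrite /step_const -[leRHS]mulrA [leRHS]mulrDl [in leRHS]mulrDl.
by apply: lerD; [apply: lerD|]; rewrite -[leRHS]mulrA ler_wpM2l ?sqr_ge0.
Qed.

End Step.

(** * Exponential sums over an interval *)

Section Exponential.
Variable R : realType.

Lemma eD (s t : R) : e (s + t) = e s * e t.
Proof.
by rewrite /e mulrDr cosD sinD; simpc; congr (_ +i* _); rewrite addrC.
Qed.

Lemma e0 : e (0 : R) = 1.
Proof. by rewrite /e mulr0 cos0 sin0. Qed.

Lemma e1 : e (1 : R) = 1.
Proof. by rewrite /e mulr1 mulrC mulr_natr cos2pi sin2pi. Qed.

Lemma eX (t : R) n : e (n%:R * t) = e t ^+ n.
Proof.
elim: n => [|n IH]; first by rewrite mul0r e0 expr0.
by rewrite -natr1 mulrDl mul1r eD IH exprSr.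
Qed.

Lemma e_nat n : e (n%:R : R) = 1.
Proof. by rewrite -[n%:R]mulr1 eX e1 expr1n. Qed.

Lemma norm_e (t : R) : `|e t| = 1.
Proof. by rewrite normc_def /= cos2Dsin2 sqrtr1. Qed.

Lemma eN (t : R) : e (- t) = (e t)^*%C.
Proof. by rewrite /e mulrN cosN sinN. Qed.

Lemma cos_quarter_le0 (s : R) : 1 / 4 <= s <= 3 / 4 -> cos (2 * pi * s) <= 0.
Proof.
move=> /andP[s1 s2]; have -> : 2 * pi * s = (2 * pi * s - pi) + pi by rewrite subrK.
rewrite cosDpi oppr_le0; apply: cos_ge0_pihalf; have p0 := pi_gt0 R.
have h1 : pi * (1 / 4) <= pi * s by rewrite ler_pM2l.
have h2 : pi * s <= pi * (3 / 4) by rewrite ler_pM2l.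
by apply/andP; split; lra.
Qed.

Lemma norm_1Bexp (z : R[i]) n : `|z| = 1 -> `|1 - z ^+ n| <= n%:R * `|1 - z|.
Proof.
move=> z1; rewrite -{1}(expr1n _ n) subrXX normrM mulrC ler_wpM2r //.
apply: le_trans (ler_norm_sum _ _ _) _.
rewrite (eq_bigr (fun=> 1)) ?sumr_const ?card_ord // => i _.
by rewrite normrM !normrX z1 normr1 !expr1n mulr1.
Qed.

Variables (q' h : nat).
Notation q := q'.+1.
Notation A := 'I_q'.+1.

Definition Esum (x : A) : R[i] := \sum_(d < h.+1 | (0 < d)%N) e (d%:R * (x%:R / q%:R)).

Lemma norm_Esum_le x : `|Esum x| <= h%:R.
Proof.
apply: le_trans (ler_norm_sum _ _ _) _.
rewrite (eq_bigr (fun=> 1)) => [|d _]; last by rewrite norm_e.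
rewrite big_mkcond big_ord_recl /= add0r sumr_const card_ord //.
Qed.

Lemma norm_1Be (x : A) : `|1 - e (x%:R / q%:R : R)| = `|1 - e ((nrm x)%:R / q%:R : R)|.
Proof.
rewrite /nrm /minn; case: ifP => // _; rewrite natrB ?(ltnW (ltn_ord x)) // mulrBl divff //.
by rewrite eD e1 mul1r eN -[in LHS]normcJ rmorphB rmorph1.
Qed.

(** The geometric series gives [|E| <= 2/|1 - z|], and [1 <= |1 - z^n| <= n |1 - z|] for some [n]
    with [4 n nrm x <= 3 q]. Hence [|E| <= 2 n], and the constant is 3/2. *)
Lemma norm_Esum_nrm x : x != 0 -> `|Esum x| * (nrm x)%:R <= (3 / 2 * q%:R)%:C.
Proof.
move=> x0; set z := e (x%:R / q%:R : R); have z1 : `|z| = 1 by apply: norm_e.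
have n0 : (0 < nrm x)%N by rewrite lt0n nrm_eq0.
have n2 : (2 * nrm x <= q)%N by rewrite /nrm; have := ltn_ord x; move: (val x) => a; lia.
(* [n] times the fraction [nrm x / q] lies between [1/4] and [3/4], so that
   [1 - z ^+ n] has real part at least [1]. *)
pose n := ((q + 4 * nrm x - 1) %/ (4 * nrm x))%N.
have [na nb] : (q <= 4 * nrm x * n)%N /\ (4 * nrm x * n <= q + 4 * nrm x)%N.
  rewrite /n; have := divn_eq (q + 4 * nrm x - 1) (4 * nrm x).
  have := ltn_pmod (q + 4 * nrm x - 1) (_ : 0 < 4 * nrm x)%N; rewrite muln_gt0 n0 => /(_ isT).
  move: (_ %/ _)%N (_ %% _)%N => u v; nia.
have n3 : (4 * nrm x * n <= 3 * q)%N by lia.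
have le1 : 1 <= n%:R * `|1 - z|.
  rewrite /z norm_1Be; apply: le_trans (norm_1Bexp n (norm_e _)).
  rewrite -eX; apply: le_trans (normc_ge_Re _); rewrite lecR /=.
  apply: le_trans (ler_norm _); rewrite -[leLHS]addr0 lerD2l oppr_ge0.
  apply: cos_quarter_le0; have q0 : 0 < q%:R :> R by rewrite ltr0n.
  have := na; have := n3; rewrite -!(ler_nat R) !natrM => h3 ha.
  have -> : n%:R * ((nrm x)%:R / q%:R) = n%:R * (nrm x)%:R / q%:R :> R by rewrite mulrA.
  by apply/andP; split; rewrite -(ler_pM2r q0) divfK ?gt_eqF //; lra.
have le2 : `|1 - z| * `|Esum x| <= 2.
  have -> : Esum x = z * \sum_(i < h) z ^+ i.
    rewrite /Esum big_mkcond big_ord_recl /= add0r mulr_sumr; apply: eq_bigr => i _.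
    by rewrite eX exprS.
  have geo : (1 - z) * (\sum_(i < h) z ^+ i) = 1 - z ^+ h.
    rewrite -[in RHS](expr1n _ h) subrXX; congr (_ * _); apply: eq_bigr => i _.
    by rewrite expr1n mul1r.
  rewrite normrM z1 mul1r -normrM geo.
  apply: le_trans (ler_normB _ _) _; rewrite normr1 normrX z1 expr1n.
  by rewrite -[2]/(1 + 1)%R.
have Hq : (4 * nrm x * n)%:R <= (3 * q)%:R :> R[i] by rewrite ler_nat.
have h4 : 4 * (`|Esum x| * (nrm x)%:R) <= 4 * (3 / 2 * q%:R)%:C.
  apply: (@le_trans _ _ ((`|1 - z| * `|Esum x|) * (4 * nrm x * n)%:R)).
    have -> : `|1 - z| * `|Esum x| * (4 * nrm x * n)%:R
       = (4 * (`|Esum x| * (nrm x)%:R)) * (n%:R * `|1 - z|) by rewrite !natrM; ring.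
    by rewrite ler_peMr // !mulr_ge0.
  apply: le_trans (ler_pM _ _ le2 Hq) _ => //.
  rewrite le_eqVlt; apply/orP; left; apply/eqP.
  rewrite natrM -[4]/(4%:R) -(rmorph_nat (real_complex R) 4) -(rmorph_nat (real_complex R) q).
  rewrite -[2]/(2%:R) -(rmorph_nat (real_complex R) 2) -[3%:R](rmorph_nat (real_complex R) 3).
  by rewrite -!rmorphM /=; congr (_%:C); field.
by rewrite ler_pM2l // ltr0n in h4.
Qed.

(** The value at 0, the element of order 1, is set to 0 because [V] only involves divisors greater
    than 1. *)
Definition fV (x : A) : R[i] :=
  if x == 0 then 0 else (mobius (ordA x))%:~R / (totient (ordA x))%:R * Esum x.

Definition gV (x : A) : R := complex.Re `|fV x|.

Lemma norm_fV x : `|fV x| = (gV x)%:C.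
Proof. by rewrite /gV !normc_def /=. Qed.

Lemma gV_ge0 x : 0 <= gV x.
Proof. by have := normr_ge0 (fV x); rewrite norm_fV -[0]/(0%:C) lecR. Qed.

Lemma gV0 : gV 0 = 0.
Proof. by rewrite /gV /fV eqxx normr0. Qed.

Lemma mobius_sqfree n : (0 < n)%N -> mobius n != 0 -> sqfree n.
Proof.
move=> n0; rewrite /mobius; case: ifP => // /forallP sqn _; apply/(sqfreeP n0) => p pp.
apply/negP => pn; have pl : (p < n.+1)%N.
  rewrite ltnS; apply: dvdn_leq => //; apply: dvdn_trans pn; exact: dvdn_mulr.
by have /implyP := sqn (Ordinal pl); rewrite pn => /(_ pp).
Qed.

Lemma mobius_norm n : `|(mobius n)%:~R| <= 1 :> R[i].
Proof.
rewrite /mobius; case: ifP => _; last by rewrite mulr0z normr0 ler01.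
by rewrite rmorphXn /= normrX rmorphN1 normrN1 expr1n.
Qed.

Lemma gV_sqfree x : gV x != 0 -> sqfree (ordA x).
Proof.
move=> gx; apply: mobius_sqfree; first exact: ordA_gt0.
apply: contraNneq gx => m0; rewrite /gV /fV m0; case: ifP => _; first by rewrite normr0.
by rewrite !mul0r normr0.
Qed.

Lemma gV_totient x : (gV x * (totient (ordA x))%:R)%:C <= `|Esum x|.
Proof.
rewrite rmorphM /= -norm_fV /fV.
have ph : 0 < (totient (ordA x))%:R :> R[i] by rewrite ltr0n totient_gt0 ordA_gt0.
case: ifP => _; first by rewrite normr0 mul0r.
rewrite !normrM normfV -[_%:C](_ : `|(totient (ordA x))%:R| = _); last first.
  by rewrite normr_nat rmorph_nat.
rewrite mulrAC divfK ?normr_eq0 ?gt_eqF //; apply: ler_piMl => //; exact: mobius_norm.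
Qed.

Lemma gV_h x : gV x * (totient (ordA x))%:R <= h%:R.
Proof.
rewrite -lecR; apply: le_trans (gV_totient x) _.
by apply: le_trans (norm_Esum_le x) _; rewrite rmorph_nat.
Qed.

Lemma gV_nrm x : gV x * (totient (ordA x))%:R * (nrm x)%:R <= 3 / 2 * q%:R.
Proof.
have [->|x0] := eqVneq x 0; first by rewrite gV0 !mul0r mulr_ge0 // divr_ge0.
rewrite -lecR; apply: le_trans (norm_Esum_nrm x0); rewrite rmorphM rmorph_nat ler_wpM2r //.
exact: gV_totient.
Qed.

End Exponential.

(** * From [V] to zero-sum tuples in Z/q *)

Section Conversion.
Variables (R : realType) (q' h : nat).
Notation q := q'.+1.
Notation A := 'I_q'.+1.

Lemma val_sum k (x : 'I_k -> A) : nat_of_ord (\sum_i x i)%R = ((\sum_i x i) %% q)%N.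
Proof.
elim: k x => [|k IH] x; first by rewrite !big_ord0 mod0n.
by rewrite !big_ord_recl /= IH modnDmr.
Qed.

Lemma int_frac (N : nat) : ((N%:R / q%:R : rat) \is a Num.int) = (q %| N)%N.
Proof.
have q0 : (q%:R : rat) != 0 by rewrite pnatr_eq0.
apply/idP/idP => [/intrP[z ez]|/dvdnP[n ->]]; last by rewrite natrM mulfK // intr_nat.
have : (N%:Z)%:~R = (z * q%:Z)%:~R :> rat by rewrite intrM -ez -!pmulrn divfK.
move/intr_inj => e; have : (q%:Z %| N%:Z)%Z by rewrite e dvdz_mull.
by rewrite dvdzE.
Qed.

Lemma frac_facts (x : A) : x != 0 ->
  let r := ordA x in let a := (x %/ (q %/ r))%N in
  [/\ (1 < r <= q)%N, (1 <= a <= r)%N, coprime a r & (a * (q %/ r) = x)%N].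
Proof.
move=> x0 r a; have r0 : (0 < r)%N := ordA_gt0 x.
have rq : (r %| q)%N := ordA_dvdn x.
have kx : (q %/ r %| x)%N by rewrite -killed_divn // killed_ordA.
have ex : (a * (q %/ r) = x)%N by rewrite divnK.
have m0 : (0 < q %/ r)%N by rewrite divn_gt0 // dvdn_leq.
have g0 : (0 < gcdn x q)%N by rewrite gcdn_gt0 orbT.
have qr : (q %/ r = gcdn x q)%N.
  by rewrite /r /ordA -{1}(divnK (dvdn_gcdr x q)) mulKn // divn_gt0 // dvdn_leq // dvdn_gcdr.
have a0 : (0 < a)%N by rewrite lt0n; apply: contraNneq x0 => a0; rewrite -val_eqE /= -ex a0.
split=> //.
- by rewrite (dvdn_leq _ rq) // andbT ltn_neqAle eq_sym ordA_eq1 x0 r0.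
- by rewrite a0 -(leq_pmul2r m0) ex mulnC divnK // ltnW.
- rewrite /coprime -(eqn_pmul2r m0) mul1n muln_gcdl ex [(r * _)%N]mulnC divnK //.
  by rewrite qr.
Qed.

Lemma frac_inv (r a : nat) : (1 < r)%N -> (r %| q)%N -> (1 <= a <= r)%N -> coprime a r ->
  (a * (q %/ r) < q)%N /\ (forall x : A, x = (a * (q %/ r))%N :> nat ->
     [/\ x != 0, ordA x = r & (x %/ (q %/ r))%N = a]).
Proof.
move=> r1 rq /andP[a0 ar] cop; have r0 := ltnW r1.
have m0 : (0 < q %/ r)%N by rewrite divn_gt0 // dvdn_leq.
have eq : q = (r * (q %/ r))%N by rewrite mulnC divnK.
have lt : (a < r)%N.
  rewrite ltn_neqAle ar andbT; apply: contraTneq cop => ->.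
  by rewrite /coprime gcdnn neq_ltn r1 orbT.
split; first by rewrite [X in (_ < X)%N]eq ltn_pmul2r.
move=> x ex; split.
- by rewrite -val_gt0 ex muln_gt0 a0.
- rewrite /ordA ex; have -> : gcdn (a * (q %/ r)) q = (q %/ r)%N.
    by rewrite [X in gcdn _ X]eq -muln_gcdl (eqP cop) mul1n.
  by rewrite [X in (X %/ _)%N]eq mulnK.
- by rewrite ex mulnK.
Qed.

Lemma frac_natr (F : fieldType) (x : A) (r : nat) : [pchar F] =i pred0 -> (r %| q)%N -> (q %/ r %| x)%N ->
  (x %/ (q %/ r))%N%:R / r%:R = x%:R / q%:R :> F.
Proof.
move=> chF rq mx; have r0 : (0 < r)%N by exact: dvdn_gt0 rq.
have m0 : (0 < q %/ r)%N by rewrite divn_gt0 // dvdn_leq.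
have nz n : (0 < n)%N -> n%:R != 0 :> F by move=> n0; rewrite ((pcharf0P F).1 chF) -lt0n.
have e1 : x = (x %/ (q %/ r) * (q %/ r))%N :> nat by rewrite divnK.
have e2 : q = (r * (q %/ r))%N by rewrite mulnC divnK.
have -> : x%:R / q%:R = (x %/ (q %/ r) * (q %/ r))%N%:R / (r * (q %/ r))%N%:R :> F.
  by rewrite -e1 -e2.
by rewrite !natrM -mulf_div [X in _ = _ * X]divff ?mulr1 // nz.
Qed.

(** A nonzero [x] of Z/q corresponds to exactly one fraction [a/r] in lowest terms with [r > 1]
    dividing [q], where [r] is its order. Integrality of the sum of the [a_i/r_i] becomes a zero sum
    in Z/q, and the sums over the [d_i] factor. *)
Theorem V_nconv k : V R k q h = nconv (nseq k (@fV R q' h)) 0.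
Proof.
pose W (r a : {ffun 'I_k -> 'I_q.+1}) : R[i] :=
  \prod_(i < k) ((mobius (r i))%:~R / (totient (r i))%:R *
     \sum_(d < h.+1 | (0 < d)%N) e (d%:R * ((a i)%:R / (r i)%:R) : R)).
pose Pr (r : {ffun 'I_k -> 'I_q.+1}) := [forall i, (1 < r i)%N && (r i %| q)%N].
pose Pa (r a : {ffun 'I_k -> 'I_q.+1}) :=
  [forall i, (1 <= a i <= r i)%N && coprime (a i) (r i)] &&
  (\sum_(i < k) ((a i)%:R / (r i)%:R : rat) \is a Num.int).
have -> : V R k q h = \sum_(r | Pr r) \sum_(a | Pa r a) W r a.
  rewrite /V exchange_big; apply: eq_bigr => r _ /=.
  under eq_bigr => d _ do rewrite mulr_sumr.
  rewrite exchange_big; apply: eq_bigr => a _ /=.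
  rewrite -mulr_sumr /W [RHS]big_split /=; congr (_ * _).
  rewrite bigA_distr_big /=; apply: eq_big => [d|d _].
    by apply/forallP/ffun_onP => hd i; have := hd i.
  have eS (s : seq 'I_k) (u : 'I_k -> R) : e (\sum_(i <- s) u i) = \prod_(i <- s) e (u i).
    by elim: s => [|i s IH]; rewrite ?big_nil ?e0 // !big_cons eD IH.
  by rewrite eS; apply: eq_bigr => i _; congr e; rewrite mulrA [_%:R * (a i)%:R]mulrC.
rewrite (pair_big_dep Pr Pa W) /=.
pose H (x : {ffun 'I_k -> A}) : {ffun 'I_k -> 'I_q.+1} * {ffun 'I_k -> 'I_q.+1} :=
  ([ffun i => inord (ordA (x i))], [ffun i => inord (x i %/ (q %/ ordA (x i)))%N]).
pose H' (p : {ffun 'I_k -> 'I_q.+1} * {ffun 'I_k -> 'I_q.+1}) : {ffun 'I_k -> A} :=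
  [ffun i => inord (p.2 i * (q %/ p.1 i))%N].
have ordb (x : A) : (ordA x < q.+1)%N by rewrite ltnS dvdn_leq // ordA_dvdn.
have qb (x : A) n : (x %/ n < q.+1)%N.
  by rewrite ltnS; apply: leq_trans (leq_div _ _) _; apply: ltnW.
rewrite (reindex_onto H H') /=; last first.
  move=> [r a] /= /andP[/forallP hr /andP[/forallP ha _]].
  congr (_, _); apply/ffunP => i; rewrite !ffunE /=; apply/ord_inj;
    have /andP[r1 rq] := hr i; have /andP[ai ci] := ha i;
    have [lt /(_ (inord (a i * (q %/ r i))%N)) hx] := frac_inv r1 rq ai ci;
    have [x0 ox ax] := hx (inordK lt).
  - by rewrite inordK // ox.
  - by rewrite inordK // ox ax.
transitivity (\sum_(x : {ffun 'I_k -> A} | [forall i, x i != 0] && (\sum_i x i == 0))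
    \prod_i fV R h (x i)).
  apply: eq_big => [x|x].
    case: (boolP [forall i, x i != 0]) => [/forallP xn|nx] /=; last first.
      apply/negbTE; apply: contra nx => /andP[/andP[/forallP hr _] _]; apply/forallP => i.
      by have := hr i; rewrite !ffunE inordK // -ordA_eq1 => /andP[/gtn_eqF -> _].
    have hi i := frac_facts (xn i).
    have -> : Pr (H x).1.
      by apply/forallP => i; rewrite ffunE inordK //; have [/andP[-> _] _ _ _] := hi i; rewrite ordA_dvdn.
    have -> : H' (H x) == x.
      apply/eqP/ffunP => i; rewrite !ffunE !inordK //.
      by have [_ _ _ ->] := hi i; apply/ord_inj; rewrite inordK.
    rewrite andbT /=.
    have -> : Pa (H x).1 (H x).2 = (\sum_i ((x i)%:R / q%:R : rat) \is a Num.int).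
      rewrite /Pa; have -> : [forall i, (1 <= (H x).2 i <= (H x).1 i)%N && coprime ((H x).2 i) ((H x).1 i)].
        by apply/forallP => i; rewrite !ffunE !inordK //; have [_ -> -> _] := hi i.
      congr (_ \is a _); apply: eq_bigr => i _; rewrite !ffunE !inordK //.
      apply: frac_natr; [exact: pchar_num|exact: ordA_dvdn|].
      by rewrite -killed_divn ?ordA_dvdn // killed_ordA.
    rewrite -mulr_suml -natr_sum int_frac -val_eqE /= val_sum.
    by [].
  case/andP => /andP[/forallP hr _] _.
  apply: eq_bigr => i _; rewrite !ffunE !inordK // /fV.
  have xi : x i != 0 by have := hr i; rewrite !ffunE inordK // -ordA_eq1 => /andP[/gtn_eqF -> _].
  rewrite (negPf xi); congr (_ * _); apply: eq_bigr => d _; congr e; congr (_ * _).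
  apply: frac_natr; [exact: pchar_num|exact: ordA_dvdn|].
  by rewrite -killed_divn ?ordA_dvdn // killed_ordA.
rewrite nconv_tuple.
rewrite (reindex (fun t : k.-tuple A => [ffun i => tnth t i])) /=; last first.
  exists (fun x : {ffun 'I_k -> A} => [tuple x i | i < k]) => [t _|x _].
    by apply: eq_from_tnth => i; rewrite tnth_mktuple ffunE.
  by apply/ffunP => i; rewrite ffunE tnth_mktuple.
rewrite big_mkcond [RHS]big_mkcond; apply: eq_bigr => t _.
have -> : \sum_i [ffun i => tnth t i] i = \sum_i tnth t i by apply: eq_bigr => i _; rewrite ffunE.
have -> : \prod_i fV R h ([ffun i => tnth t i] i) = \prod_i fV R h (tnth t i).
  by apply: eq_bigr => i _; rewrite ffunE.
(* Tuples with a zero entry are absent from [V]; they contribute nothing because [fV] vanishes at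
   0. *)
case: (\sum_i _ == 0); rewrite ?andbF // andbT.
case: ifP => // /negbT; rewrite negb_forall; case/existsP => i.
by rewrite negbK ffunE => /eqP ti; rewrite (bigD1 i) //= ti /fV eqxx mul0r.
Qed.

End Conversion.

(** * Explicit divisor and harmonic bounds *)

Lemma leq_fact_prod_primes n : (0 < n)%N -> ((size (primes n))`! <= n)%N.
Proof.
move=> n0; set s := primes n.
have nthi i : (i < size s)%N -> (i < nth 0%N s i)%N.
  elim: i => [|i IH] hi.
    by have := mem_nth 0%N hi; rewrite mem_primes => /andP[/prime_gt0].
  apply: leq_ltn_trans (IH (ltnW hi)) _.
  by have := sorted_primes n => /(sortedP 0%N); apply.
apply: (@leq_trans (\prod_(p <- s) p)).
  rewrite (big_nth 0%N) big_mkord fact_prod big_add1 big_mkord.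
  by apply: leq_prod => i _; apply: nthi.
rewrite [leqRHS]prod_prime_decomp // prime_decompE big_map /= big_seq [leqRHS]big_seq.
apply: leq_prod => p; rewrite -/s => ps; have := ps; rewrite mem_primes => /andP[pp _].
apply: (@leq_trans (p ^ 1)%N); first by rewrite expn1.
by apply: leq_pexp2l; [exact: prime_gt0 | rewrite logn_gt0].
Qed.

Lemma expn_le_fact B n : (0 < B)%N -> (B ^ n <= B ^ B * n`!)%N.
Proof.
move=> B0; elim: n => [|n IH]; first by rewrite expn0 fact0 muln1 expn_gt0 B0.
case: (leqP n.+1 B) => h.
  by apply: leq_trans (leq_pexp2l B0 h) _; rewrite leq_pmulr ?fact_gt0.
rewrite expnS factS [(B ^ B * _)%N]mulnCA leq_mul //; exact: ltnW.
Qed.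

(** Put [B = 2^M] and let [n] have [s] distinct prime factors. The [i]-th of them exceeds [i], so
    [s! <= n] and [(2^s)^M = B^s <= B^B s! <= 2 B^B h^2]. Taking [M]-th roots gives the claim, the
    constant being at least 1. *)
Lemma pow2_primes_bound (R : rcfType) (M h n : nat) (w : R) : (0 < M)%N -> 0 <= w ->
  w ^+ M = h%:R -> (0 < n)%N -> (n <= 2 * h ^ 2)%N ->
  (2 ^ size (primes n))%:R <= (2 * (2 ^ M) ^ (2 ^ M))%:R * w ^+ 2.
Proof.
move=> M0 w0 wh n0 nh; set B := (2 ^ M)%N; have B0 : (0 < B)%N by rewrite expn_gt0.
have C1 : (1 <= 2 * B ^ B)%N by rewrite muln_gt0 expn_gt0 B0.
rewrite -(ler_pXn2r M0) ?nnegrE ?mulr_ge0 ?exprn_ge0 //.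
apply: (@le_trans _ _ ((2 * B ^ B)%:R * (w ^+ 2) ^+ M)); last first.
  rewrite [leRHS]exprMn ler_wpM2r ?exprn_ge0 // -{1}(expr1 (2 * B ^ B)%:R).
  by rewrite ler_weXn2l // (ler_nat R 1).
rewrite exprAC wh -natrX -natrX -natrM ler_nat -expnM mulnC expnM -/B.
apply: leq_trans (expn_le_fact _ B0) _.
apply: leq_trans (leq_mul (leqnn _) (leq_trans (leq_fact_prod_primes n0) nh)) _.
by rewrite mulnCA mulnA.
Qed.

Lemma harmonic_le_ln (R : realType) n : (0 < n)%N ->
  \sum_(i < n.+1 | (0 < i)%N) i%:R^-1 <= 1 + ln n%:R :> R.
Proof.
have shift k : \sum_(i < k.+1 | (0 < i)%N) i%:R^-1 = \sum_(i < k) i.+1%:R^-1 :> R.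
  by rewrite big_mkcond big_ord_recl /= add0r.
case: n => // n _; rewrite shift; elim: n => [|n IH].
  by rewrite big_ord_recr big_ord0 /= add0r invr1 ln1 addr0.
rewrite big_ord_recr /=; set x : R := n.+2%:R.
have x0 : 0 < x by rewrite ltr0n.
have n1 : 0 < n.+1%:R :> R by rewrite ltr0n.
have : ln (1 + - x^-1) <= - x^-1.
  by apply: le_ln1Dx; rewrite ltrN2 invf_lt1 // ltr1n.
have -> : 1 - x^-1 = n.+1%:R / x.
  have -> : n.+1%:R = x - 1 by rewrite /x -[n.+2%:R]natr1 addrK.
  by rewrite mulrBl divff ?gt_eqF // mul1r.
rewrite ln_div ?posrE // => hx; apply: le_trans (lerD IH (lexx _)) _; move: hx.
set u := ln x; set v := ln _; set y := x^-1; lra.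
Qed.

Lemma pow_root (R : realType) (h k : nat) : (0 < h)%N -> (0 < k)%N ->
  (h%:R `^ (k%:R^-1) : R) ^+ k = h%:R.
Proof.
move=> h0 k0; rewrite -powR_mulrn ?powR_ge0 // -powRrM mulVf ?pnatr_eq0 -?lt0n //.
by rewrite powRr1.
Qed.

(** With [w = h^(1/k)], [1 + ln h = 1 + k ln w], where [1 <= w] and [ln w <= w - 1]. *)
Lemma harmonic_root (R : realType) (h k : nat) : (0 < h)%N -> (0 < k)%N ->
  \sum_(i < h.+1 | (0 < i)%N) i%:R^-1 <= k.+1%:R * h%:R `^ (k%:R^-1) :> R.
Proof.
move=> h0 k0; apply: le_trans (harmonic_le_ln R h0) _.
set w := _ `^ _; have wk : w ^+ k = h%:R := pow_root R h0 k0.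
have w1 : 1 <= w by rewrite -[1](powRr0 h%:R) ler_powR // ?ler1n ?invr_ge0.
have w0 : 0 < w by exact: lt_le_trans w1.
rewrite -wk lnXn // -natr1 mulrDl mul1r addrC lerD //.
rewrite -[leLHS]mulr_natl ler_wpM2l //.
have : ln (1 + (w - 1)) <= w - 1 by apply: le_ln1Dx; lra.
by rewrite addrC subrK; lra.
Qed.

(** * The second moment *)

Section Variance.
Variables (R : realType) (q' h : nat).
Notation q := q'.+1.
Notation A := 'I_q'.+1.
Notation f := (@fV R q' h).
Notation g := (@gV R q' h).

Lemma ordAN (x : A) : ordA (- x) = ordA x.
Proof.
have d (y : A) : (ordA (- y) %| ordA y)%N by rewrite -killed_ordA killedN killed_ordA.
by apply/eqP; rewrite eqn_dvd d /=; have := d (- x); rewrite opprK.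
Qed.

Lemma EsumN (x : A) : x != 0 -> Esum R h (- x) = (Esum R h x)^*%C.
Proof.
move=> x0; rewrite /Esum rmorph_sum; apply: eq_bigr => d _.
have -> : nat_of_ord (- x) = (q - x)%N by rewrite /= modn_small // ltn_subrL val_gt0 x0.
rewrite natrB ?(ltnW (ltn_ord x)) // mulrBl divff // mulrBr mulr1 eD e_nat mul1r eN //.
Qed.

Lemma fVN (x : A) : f (- x) = (f x)^*%C.
Proof.
rewrite /fV oppr_eq0; case: eqP => [_|/eqP x0]; first by rewrite rmorph0.
by rewrite ordAN EsumN // !rmorphM fmorphV rmorph_int rmorph_nat.
Qed.

Lemma gVN (x : A) : g (- x) = g x.
Proof. by rewrite /gV fVN normcJ. Qed.

(** Since [f (- x)] is the conjugate of [f x], both sides are the sum of [|f x|^2]. *)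
Lemma nconv2_fV : nconv [:: f; f] 0 = (nconv [:: g; g] 0)%:C.
Proof.
have z2 (K : comNzRingType) (p : A -> K) : nconv [:: p; p] 0 = \sum_x p x * p (- x).
  rewrite /=; apply: eq_bigr => x _; congr (_ * _).
  rewrite sub0r (bigD1 (- x)) //= subrr eqxx mulr1 big1 ?addr0 // => y yx.
  by rewrite subr_eq0 eq_sym (negPf yx) mulr0.
rewrite !z2 rmorph_sum; apply: eq_bigr => x _.
by rewrite fVN -sqr_normc norm_fV gVN -rmorphXn /= expr2.
Qed.

Definition v2 := nconv [:: g; g] 0.

Lemma V2E : V2 R q h = v2.
Proof. by rewrite /V2 V_nconv /nseq /= -/(nconv [:: f; f] 0) nconv2_fV. Qed.

Lemma v2_ge0 : 0 <= v2.
Proof.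
rewrite /v2 /=; apply: sumr_ge0 => x _; apply: mulr_ge0; first exact: gV_ge0.
by apply: sumr_ge0 => y _; rewrite mulr_ge0 ?gV_ge0 ?ler0n.
Qed.

Lemma tame_gV : (0 < h)%N -> tame (4 * Num.sqrt h%:R, g).
Proof.
move=> h0; apply: tame_weight => // [x||x|x|x].
- exact: gV_ge0.
- exact: gV0.
- exact: gV_sqfree.
- exact: gV_h.
- exact: gV_nrm.
Qed.

Lemma v2_le : (0 < h)%N -> v2 <= 16 * h%:R * totratio R q ^+ 3.
Proof.
move=> h0; apply: le_trans (nconv_nseq_bound 2 (tame_gV h0)) _.
by rewrite exprMn sqr_sqrtr // -natrX.
Qed.

End Variance.

Lemma leq_expn2_add3 m : (2 ^ m + 3 <= 2 ^ m.+2 + 1)%N.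
Proof.
rewrite !expnS; have : (0 < 2 ^ m)%N by rewrite expn_gt0.
by move: (2 ^ m)%N => z; lia.
Qed.

(** * Induction on [k] in steps of two *)

Section Induction.
Variable R : realType.

Definition err (k q h : nat) : R :=
  h%:R `^ (k%:R / 2 - 1 / (7 * k%:R)) * totratio R q `^ ((2 ^ k)%:R + k%:R / 2).

Definition asymptotic (k : nat) := exists2 C : R, 0 <= C & forall q' h, (0 < h)%N ->
  `|nconv (nseq k (@fV R q' h)) 0 - ((gauss_moment k)%:R * v2 R q' h `^ (k%:R / 2))%:C|
    <= (C * err k q'.+1 h)%:C.

Lemma gauss_momentSS m : gauss_moment m.+2 = (m.+1 * (~~ odd m) * gauss_moment m)%N.
Proof.
rewrite /gauss_moment /= negbK; case: ifP => om; first by rewrite muln0.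
rewrite muln1 big_ord_recr /= mulnC; congr (_ * _)%N.
by rewrite -[in RHS](odd_double_half m) om.
Qed.

(** The only zero-sum tuple of length 1 is 0, where [fV] vanishes. *)
Lemma asymptotic1 : asymptotic 1.
Proof.
exists 0 => // q' h _; rewrite mul0r /gauss_moment /= mul0r subr0.
rewrite big1 ?normr0 // => x _; rewrite sub0r oppr_eq0.
by case: eqP => [->|_]; rewrite ?mulr0 // /fV eqxx mul0r.
Qed.

Lemma asymptotic2 : asymptotic 2.
Proof.
exists 0 => // q' h _; rewrite mul0r.
have -> : gauss_moment 2 = 1%N by rewrite /gauss_moment /= big_ord_recr big_ord0.
rewrite divff ?pnatr_eq0 // powRr1 ?v2_ge0 // mul1r.
by rewrite -[nseq 2 _]/[:: _; _] nconv2_fV subrr normr0.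
Qed.

Lemma err_ge0 k q h : 0 <= err k q h.
Proof. by rewrite mulr_ge0 ?powR_ge0. Qed.

(** The inductive error gets multiplied by [V_2], which is at most a constant times
    [h (q/phi(q))^3]. The exponent of [h] then fits because the saving weakens as [k] grows; that of
    [q/phi(q)] fits because [2^m + 3 <= 2^(m + 2) + 1]. *)
Lemma err_step m q h : (0 < m)%N -> (0 < q)%N -> (0 < h)%N ->
  h%:R * totratio R q ^+ 3 * err m q h <= err m.+2 q h.
Proof.
move=> m0 q0 h0; have h1 : 1 <= h%:R :> R by rewrite ler1n.
have Q1 := totratio_ge1 R q0; have Q0 : 0 <= totratio R q := le_trans ler01 Q1.
have hn : h%:R != 0 :> R by rewrite pnatr_eq0 -lt0n.
have Qn : totratio R q != 0 by rewrite gt_eqF // (lt_le_trans ltr01).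
have M0 : 0 < m%:R :> R by rewrite ltr0n.
rewrite /err mulrACA; apply: ler_pM; rewrite ?(mulr_ge0 (ler0n _ _)) ?(mulr_ge0 (exprn_ge0 _ Q0)) ?powR_ge0 //.
  rewrite -[X in X * _](powRr1 (ler0n R h)) -powRD ?hn ?implybT // ler_powR //.
  have -> : m.+2%:R = m%:R + 2 :> R by rewrite -addn2 natrD.
  have : (7 * (m%:R + 2))^-1 <= (7 * m%:R)^-1 :> R.
    by rewrite lef_pV2 ?posrE ?mulr_gt0 ?addr_gt0 // ler_pM2l // lerDl.
  rewrite !mul1r; lra.
rewrite -powR_mulrn // -powRD ?Qn ?implybT // ler_powR //.
have -> : m.+2%:R = m%:R + 2 :> R by rewrite -addn2 natrD.
have : (2 ^ m + 3)%:R <= (2 ^ m.+2 + 1)%:R :> R by rewrite ler_nat leq_expn2_add3.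
rewrite !natrD; lra.
Qed.

Lemma asymptotic_step m : (0 < m)%N -> asymptotic m -> asymptotic m.+2.
Proof.
move=> m0 [C C0 hC]; pose M := (35 * m.+2)%N; have M0 : (0 < M)%N by [].
pose Ch : R := M.+1%:R; pose Cd : R := (2 * (2 ^ M) ^ (2 ^ M))%:R.
pose C' := step_const m Ch Cd.
have C'0 : 0 <= C'.
  have Ch0 : 0 <= Ch by exact: ler0n.
  have Cd0 : 0 <= Cd by exact: ler0n.
  rewrite /C' /step_const.
  by do ?[exact: ler0n | exact: exprn_ge0 | assumption | apply: addr_ge0 | apply: mulr_ge0 | rewrite invr_ge0].
exists (C' + m.+1%:R * 16 * C) => [|q' h h0].
  by rewrite addr_ge0 // !mulr_ge0.
set q := q'.+1; set f := @fV R q' h; set g := @gV R q' h; set V2' := v2 R q' h.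
have h1 : 1 <= h%:R :> R by rewrite ler1n.
pose w : R := h%:R `^ (M%:R^-1).
have wM : w ^+ M = h%:R := pow_root R h0 M0.
have w1 : 1 <= w by rewrite -[1](powRr0 h%:R) ler_powR // invr_ge0.
have Q1 : 1 <= totratio R q := totratio_ge1 R (ltn0Sn q').
have Q0 : 0 <= totratio R q := le_trans ler01 Q1.
have := @step_bound R q' m f g h w Ch Cd (@norm_fV R q' h) (@gV_ge0 R q' h) (@gV0 R q' h)
  (@gV_sqfree R q' h) (@gV_h R q' h) (@gV_nrm R q' h) w1 wM
  (fun n n0 nh => pow2_primes_bound M0 (le_trans ler01 w1) wM n0 nh) (harmonic_root R h0 M0).
rewrite -/C' => hstep.
have hE : Num.sqrt h%:R ^+ m.+2 * w ^- 5 = h%:R `^ (m.+2%:R / 2 - 1 / (7 * m.+2%:R)) :> R.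
  rewrite -powR12_sqrt // -[X in X * _]powR_mulrn ?powR_ge0 // -powRrM.
  rewrite -[w ^- 5](_ : w `^ (- 5%:R) = _); last by rewrite powRN powR_mulrn // (le_trans ler01).
  rewrite /w -powRrM -powRD; last by rewrite pnatr_eq0 -lt0n h0 implybT.
  congr (_ `^ _); rewrite /M natrM.
  have : m.+2%:R != 0 :> R by rewrite pnatr_eq0.
  by move: (m.+2%:R : R) => x x0; field.
have hst : `|nconv (nseq m.+2 f) 0 - m.+1%:R * (nconv [:: f; f] 0 * nconv (nseq m f) 0)|
   <= (C' * err m.+2 q h)%:C.
  apply: le_trans hstep _; rewrite lecR hE -mulrA ler_wpM2l // /err ler_wpM2l ?powR_ge0 //.
  rewrite -powR_mulrn // ler_powR //.
  apply: (@le_trans _ _ (2 ^ m.+2)%:R); first by rewrite ler_nat leq_subr.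
  by rewrite lerDl divr_ge0.
have gE : (gauss_moment m.+2)%:R * V2' `^ (m.+2%:R / 2)
    = m.+1%:R * V2' * ((gauss_moment m)%:R * V2' `^ (m%:R / 2)) :> R.
  have -> : m.+2%:R / 2 = m%:R / 2 + 1 :> R by rewrite -addn2 natrD; field.
  have -> : V2' `^ (m%:R / 2 + 1) = V2' * V2' `^ (m%:R / 2).
    (* [powRD] is applied to a nonzero base; at base 0 both sides vanish because the exponent is
       positive. *)
    have [->|vn] := eqVneq V2' 0.
      by rewrite powR0 ?mul0r // gt_eqF // addr_gt0 // divr_gt0 // ltr0n.
    by rewrite powRD ?vn ?implybT // powRr1 ?v2_ge0 // mulrC.
  rewrite gauss_momentSS; case om : (odd m); last by rewrite /= muln1 natrM; ring.
  by rewrite /gauss_moment om /= !muln0 !mul0r mulr0.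
rewrite gE.
(* The error splits into that of the recursion step and [(m + 1) V_2] times the error for [m]. *)
have -> : nconv (nseq m.+2 f) 0 - (m.+1%:R * V2' * ((gauss_moment m)%:R * V2' `^ (m%:R / 2)))%:C
  = (nconv (nseq m.+2 f) 0 - m.+1%:R * (nconv [:: f; f] 0 * nconv (nseq m f) 0))
   + (m.+1%:R * V2')%:C * (nconv (nseq m f) 0 - ((gauss_moment m)%:R * V2' `^ (m%:R / 2))%:C).
  rewrite nconv2_fV -/g -/(v2 R q' h) -/V2'.
  by rewrite !rmorphM /= rmorph_nat; ring.
apply: le_trans (ler_normD _ _) _.
rewrite mulrDl rmorphD /=; apply: lerD => //.
have V0 : 0 <= V2' := v2_ge0 R q' h.
rewrite normrM; have -> : `|(m.+1%:R * V2')%:C| = (m.+1%:R * V2')%:C.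
  by apply: ger0_norm; rewrite -[0]/(0%:C) lecR mulr_ge0.
apply: le_trans (ler_wpM2l _ (hC q' h h0)) _; first by rewrite -[0]/(0%:C) lecR mulr_ge0.
rewrite -rmorphM lecR /=.
apply: le_trans (_ : m.+1%:R * (16 * h%:R * totratio R q ^+ 3) * (C * err m q h) <= _).
  apply: ler_wpM2r; first by rewrite mulr_ge0 // err_ge0.
  by apply: ler_wpM2l => //; apply: v2_le.
have -> : m.+1%:R * (16 * h%:R * totratio R q ^+ 3) * (C * err m q h)
  = m.+1%:R * 16 * C * (h%:R * totratio R q ^+ 3 * err m q h) by ring.
by rewrite ler_wpM2l ?mulr_ge0 // err_step.
Qed.

Lemma asymptotic_all k : (0 < k)%N -> asymptotic k.
Proof.
have [n] := ubnP k; elim: n k => // n IH [|[|[|m]]] // kn _.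
- exact: asymptotic1.
- exact: asymptotic2.
by apply: asymptotic_step => //; apply: IH => //; exact: ltnW (ltnSE kn).
Qed.

End Induction.

Theorem theorem1 (R : realType) (k : nat) (hk : (0 < k)%N) :
  exists C : R, forall q h : nat, (0 < q)%N -> (0 < h)%N ->
    `|V R k q h - ((gauss_moment k)%:R * V2 R q h `^ (k%:R / 2))%:C| <=
    (C * h%:R `^ (k%:R / 2 - 1 / (7 * k%:R))
       * (q%:R / (totient q)%:R) `^ ((2 ^ k)%:R + k%:R / 2))%:C.
Proof.
have [C C0 hC] := asymptotic_all R hk.
exists C => -[|q'] h // _ h0.
by rewrite V_nconv V2E -mulrA; apply: hC.
Qed.
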